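(* Let $d\in\mathbb{N}$, $\alpha\in(0,2\wedge d)$ and $\delta\in(0,d-\alpha)$. Then for every $f\in L^2(\mathbb{R}^d)$, $$\mathcal{E}(f,f)=\int_{\mathbb{R}^d}f^2(x)V_\delta(x)\,dx+\frac12\int_{\mathbb{R}^d}\int_{\mathbb{R}^d}\left[\frac{f(x)}{h_\delta(x)}-\frac{f(y)}{h_\delta(y)}\right]^2h_\delta(y)h_\delta(x)\,\nu(x-y)\,dy\,dx,$$ where $$h_\delta(x)=c_{d,\alpha,\delta}\,|x|^{-\frac{\delta}{2}}K_{\frac{\delta}{2}}(|x|),\qquad \nu(x)=\frac{2^{\frac{\alpha-d}{2}+1}}{\pi^{d/2}\,|\Gamma(-\frac{\alpha}{2})|}\,\frac{K_{\frac{d+\alpha}{2}}(|x|)}{|x|^{\frac{d+\alpha}{2}}}.$$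
   Context: $\mathbb{N}=\{1,2,\ldots\}$, $a\wedge b=\min\{a,b\}$. Functions in $L^2(\mathbb{R}^d)$ are real-valued, and both sides of the identity are allowed to equal $+\infty$. The constant is $$c_{d,\alpha,\delta}=\frac{2^{\frac{\delta}{2}+1}\,\Gamma\left(\frac{d-\delta}{\alpha}\right)}{(4\pi)^{d/2}\,\Gamma\left(\frac{d-\delta}{2}\right)}>0$$ (it cancels in the identity). Here $K_\nu(r)=\frac12\left(\frac r2\right)^\nu\int_0^\infty u^{-\nu-1}e^{-u-r^2/(4u)}\,du$ is the modified Bessel function of the second kind, and $$V_\delta(x)=\frac{2^{\alpha/2}\,\Gamma\left(\frac{d-\delta}{2}\right)}{\Gamma\left(\frac{d-\delta-\alpha}{2}\right)}\,\frac{K_{\frac{\delta+\alpha}{2}}(|x|)}{K_{\frac{\delta}{2}}(|x|)}\,|x|^{-\alpha/2},\qquad x\neq0.$$ Let $p(t,x,y)=(2\pi)^{-d}\int_{\mathbb{R}^d}e^{-i\langle y-x,z\rangle}e^{-t(|z|^2+1)^{\alpha/2}}\,dz$ be the heat kernel of $-(-\Delta+1)^{\alpha/2}$. For $f\in L^2(\mathbb{R}^d)$, $$P_tf(x)=\int_{\mathbb{R}^d}p(t,x,y)f(y)\,dy,\qquad \mathcal{E}(f,f)=\lim_{t\to0^+}\frac1t\langle f-P_tf,f\rangle,$$ where $\langle\cdot,\cdot\rangle$ is the inner product in $L^2(\mathbb{R}^d)$. *)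

(* Defs.v *)
From HB Require Import structures.
From mathcomp Require Import all_boot all_order all_algebra.
From mathcomp Require Import all_classical all_reals all_analysis.
From mathcomp Require Import complex.

Set Implicit Arguments.
Unset Strict Implicit.
Unset Printing Implicit Defensive.

Import Order.TTheory GRing.Theory Num.Theory.
Import numFieldNormedType.Exports.

Local Open Scope classical_set_scope.
Local Open Scope ring_scope.
Local Open Scope complex_scope.

(* [measurableTypeR R] is R with its Borel sets; tuples carry the product
   sigma-algebra, which is the Borel sigma-algebra of R^d. *)
Notation Rvec R d := (d.-tuple (measurableTypeR R)).

Section euclidean_space.
Context {R : realType} {d : nat}.
Implicit Types x y : Rvec R d.

Definition coord x (i : 'I_d) : R := tnth x i.

Definition vsub x y : Rvec R d := [tuple (coord x i - coord y i : R) | i < d].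

Definition dotv x y : R := \sum_(i < d) coord x i * coord y i.

Definition enorm x : R := Num.sqrt (dotv x x).

End euclidean_space.

(* Lebesgue measure on R^n, by recursion on n: the point mass on R^0, and on
   R^(n+1) the image of the product of the measures on R and R^n under
   (a, x) |-> a :: x. *)
Section lebesgue_measure_Rvec.
Context {R : realType}.

Definition cons_pair n (z : measurableTypeR R * Rvec R n) : Rvec R n.+1 :=
  [tuple of z.1 :: z.2].

Definition uncons_pair n (x : Rvec R n.+1) : measurableTypeR R * Rvec R n :=
  (thead x, [tuple of behead x]).

Lemma cons_pairK n : cancel (@cons_pair n) (@uncons_pair n).
Proof. by move=> [a x]; congr pair; exact/val_inj. Qed.

Lemma measurable_cons_pair n : measurable_fun [set: _] (@cons_pair n).
Proof. exact: measurable_cons. Qed.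

Lemma measurable_uncons_pair n : measurable_fun [set: _] (@uncons_pair n).
Proof.
by apply: measurable_fun_pair; [exact: measurable_tnth|exact: measurable_behead].
Qed.

Definition lebesgue_succ n (m : {sigma_finite_measure set (Rvec R n) -> \bar R}) :=
  pushforward (@lebesgue_measure R \x m)%E (@cons_pair n).

Section lebesgue_succ_measure.
Variables (n : nat) (m : {sigma_finite_measure set (Rvec R n) -> \bar R}).

Let m' : {measure set (Rvec R n.+1) -> \bar R} :=
  measure_function_pushforward__canonical__measure_function_Measure
    (@lebesgue_measure R \x m)%E (@measurable_cons_pair n).

Let lebesgue_succ0 : lebesgue_succ m set0 = 0%E.
Proof. exact: (measure0 m'). Qed.

Let lebesgue_succ_ge0 A : (0 <= lebesgue_succ m A)%E.
Proof. exact: (measure_ge0 m'). Qed.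

Let lebesgue_succ_sigma_additive : semi_sigma_additive (lebesgue_succ m).
Proof. exact: (@measure_semi_sigma_additive _ _ _ m'). Qed.

HB.instance Definition _ := isMeasure.Build _ _ _ (lebesgue_succ m)
  lebesgue_succ0 lebesgue_succ_ge0 lebesgue_succ_sigma_additive.

Let lebesgue_succ_sigma_finite : sigma_finite setT (lebesgue_succ m).
Proof.
have /sigma_finiteP[F [FT ndF Foo]] := sigma_finiteT (@lebesgue_measure R).
have /sigma_finiteP[G [GT ndG Goo]] := sigma_finiteT m.
exists (fun k => @uncons_pair n @^-1` (F k `*` G k)).
  rewrite -preimage_bigcup -[LHS](preimage_setT (@uncons_pair n)).
  congr (_ @^-1` _); apply/seteqP; split => // -[a x] _.
  have [i _ Fia] : (\bigcup_i F i) a by rewrite -FT.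
  have [j _ Gjx] : (\bigcup_j G j) x by rewrite -GT.
  exists (maxn i j) => //; split => /=.
    by move: a Fia; exact/subsetPset/ndF/leq_maxl.
  by move: x Gjx; exact/subsetPset/ndG/leq_maxr.
move=> k; have [mF Fk] := Foo k; have [mG Gk] := Goo k; split.
  rewrite -[X in measurable X]setTI; apply: measurable_uncons_pair => //.
  exact: measurableX.
rewrite /lebesgue_succ /pushforward -comp_preimage.
rewrite (_ : _ \o _ = id) ?preimage_id; last exact/funext/cons_pairK.
by rewrite product_measure1E// lte_mul_pinfty// ge0_fin_numE.
Qed.

HB.instance Definition _ := Measure_isSigmaFinite.Build _ _ _
  (lebesgue_succ m) lebesgue_succ_sigma_finite.

End lebesgue_succ_measure.

Fixpoint leb (n : nat) : {sigma_finite_measure set (Rvec R n) -> \bar R} :=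
  if n is n'.+1 then lebesgue_succ (leb n') else \d_([tuple] : Rvec R 0).

Lemma leb_box n (A : 'I_n -> set (measurableTypeR R)) :
  (forall i, measurable (A i)) ->
  leb n [set x | forall i, A i (tnth x i)] =
  (\prod_(i < n) lebesgue_measure (A i))%E.
Proof.
elim: n A => [|n ih] A mA.
  by rewrite big_ord0 /= diracE mem_set//= => -[].
rewrite big_ord_recl -ih//= /lebesgue_succ /pushforward -product_measure1E//; last first.
  rewrite (_ : [set x | _] =
      \bigcap_(i in [set: 'I_n]) ((@tnth _ _ ^~ i) @^-1` A (lift ord0 i))).
    apply: fin_bigcap_measurable => // i _.
    by rewrite -[X in measurable X]setTI; exact: measurable_tnth.
  by apply/seteqP; split => [x xA i _|x xA i]; [exact: xA|exact: (xA i)].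
congr (_ _); apply/seteqP; split => [[a x] /= xA|[a x] /= [aA xA] i].
  split; first exact: (xA ord0).
  by move=> i; have := xA (lift ord0 i); rewrite tnthS.
by case: (unliftP ord0 i) => [j|] ->; [rewrite tnthS; exact: xA|exact: aA].
Qed.

End lebesgue_measure_Rvec.

Arguments leb R n : clear implicits.

Section special_functions.
Context {R : realType}.

(* Euler's integral for 0 < s, continued to the other s by
   Gamma(s) = Gamma(s + n) / (s (s + 1) ... (s + n - 1)) with the least n such
   that 0 < s + n. At the poles 0, -1, -2, ... the value is 0. *)
Definition Gamma (s : R) : R :=
  let euler r :=
    \int[@lebesgue_measure R]_(t in `]0, +oo[) (t `^ (r - 1) * expR (- t)) in
  if 0 < s then euler s
  else let n := (Num.truncn (- s)).+1 in
       euler (s + n%:R) / \prod_(i < n) (s + i%:R).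

Definition BesselK (nu r : R) : R :=
  2^-1 * (r / 2) `^ nu *
  \int[@lebesgue_measure R]_(u in `]0, +oo[)
     (u `^ (- nu - 1) * expR (- u - r ^+ 2 / (4 * u))).

Definition expi (theta : R) : R[i] := cos theta +i* sin theta.

End special_functions.

(* The integral of a complex-valued function, taken componentwise. *)
Definition Cintegral {dsp} {T : measurableType dsp} {R : realType}
    (mu : {measure set T -> \bar R}) (F : T -> R[i]) : R[i] :=
  (\int[mu]_x complex.Re (F x)) +i* (\int[mu]_x complex.Im (F x)).

Section relativistic_form.
Context {R : realType}.
Variables (d : nat) (alpha : R).
Implicit Types (x y z : Rvec R d) (f g : Rvec R d -> R).

Definition heat_kernelC (t : R) x y : R[i] :=
  ((2 * pi) ^- d)%:C *
  Cintegral (leb R d) (fun z =>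
    expi (- dotv (vsub y x) z) *
    (expR (- t * (enorm z ^+ 2 + 1) `^ (alpha / 2)))%:C).

(* [heat_kernelC] is real-valued: its imaginary part is the integral of a
   function that is odd in z. *)
Definition heat_kernel (t : R) x y : R := complex.Re (heat_kernelC t x y).

Definition semigroup (t : R) f x : R :=
  \int[leb R d]_y (heat_kernel t x y * f y).

Definition inner_L2 f g : R := \int[leb R d]_x (f x * g x).

Definition form_quotient f (t : R) : R :=
  t^-1 * inner_L2 (fun x => f x - semigroup t f x) f.

(* The limit is taken in the extended reals, as it may be +oo. *)
Definition energy_form f : \bar R := lim ((form_quotient f t)%:E @[t --> 0^'+]).

Definition levy_density x : R :=
  2 `^ ((alpha - d%:R) / 2 + 1) / (pi `^ (d%:R / 2) * `|Gamma (- (alpha / 2))|) *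
  (BesselK ((d%:R + alpha) / 2) (enorm x) / enorm x `^ ((d%:R + alpha) / 2)).

Variable delta : R.

Definition c_const : R :=
  2 `^ (delta / 2 + 1) * Gamma ((d%:R - delta) / alpha) /
  ((4 * pi) `^ (d%:R / 2) * Gamma ((d%:R - delta) / 2)).

Definition h_fun x : R :=
  c_const * enorm x `^ (- (delta / 2)) * BesselK (delta / 2) (enorm x).

(* [V_fun], [h_fun] and [levy_density] are used only under integrals, so their
   values at x = 0 are irrelevant. *)
Definition V_fun x : R :=
  2 `^ (alpha / 2) * Gamma ((d%:R - delta) / 2) /
    Gamma ((d%:R - delta - alpha) / 2) *
  (BesselK ((delta + alpha) / 2) (enorm x) / BesselK (delta / 2) (enorm x)) *
  enorm x `^ (- (alpha / 2)).

End relativistic_form.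

(* Main.v *)
Require Import Defs.
From HB Require Import structures.
From mathcomp Require Import all_boot all_order all_algebra.
From mathcomp Require Import all_classical all_reals all_analysis.
From mathcomp Require Import measurable_realfun complex ring lra.

Set Implicit Arguments.
Unset Strict Implicit.
Unset Printing Implicit Defensive.

Import Order.TTheory GRing.Theory Num.Theory.
Import numFieldNormedType.Exports.

Local Open Scope classical_set_scope.
Local Open Scope ring_scope.

(** Write a = alpha/2, g = (d - delta)/2, let heat u be the Gauss kernel at time u,
    and let k = 1/|Gamma(-a)|. The formula
      lam^a = int_0^oo (1 - e^(-u lam)) k u^(-a-1) du
    at lam = |z|^2 + 1 exhibits the operator (-Delta + 1)^a as a mixture of the
    operators 1 - e^(-u) heat u. Keeping only the times u > e gives a bounded jump
    operator f |-> N f - nu * f, where N = int_(u > e) k u^(-a-1) du and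
      nu = int_(u > e) k u^(-a-1) e^(-u) heat u du
    is an integrable kernel: [jump_energy] is its quadratic form, and for e -> 0 the
    kernel nu increases to the Lévy density. The theorem is the sum of two facts.

    The form is the limit of the jump energies ([cvg_form_quotient]). In Fourier
    variables the energy at e and the quotient at time t have the symbols S(lam) and
    (1 - e^(-t lam^a))/t, where S(lam) <= lam^a is the truncated integral. Elementary
    inequalities between these symbols, with errors that vanish for t -> 0 at fixed e
    and for e -> 0 at fixed t respectively, are transferred to the forms by
    [quad_ge0]: a kernel whose Fourier transform is nonnegative is positive definite.
    The comparison holds whether the limit is finite or not. For the forms to be
    integrals of the kernels, the heat kernel of (-Delta + 1)^a has to be nonnegative of
    mass at most 1 ([rheat_ge0], [rheat_mass]); this holds because e^(-t lam^a) is a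
    limit of exponentials of mixtures of Gaussians.

    The jump energies satisfy the ground state identity. Let H be the mixture
    int_0^oo w^(g-1) e^(-w) heat w dw, a constant multiple of h_delta. By the semigroup
    property, nu * H is again a mixture of the heat w, and comparing coefficients
    reduces N H - nu * H to a truncated fractional derivative of the power w^(g-1):
      N H - nu * H = int_0^oo w^(g-a-1) e^(-w) D(e/w) heat w dw
    ([nu_trunc_gheat]), where D is bounded and D(0) = Gamma(g)/Gamma(g-a)
    ([beta_defect0E]). So the left side divided by H tends to V_delta, and it is
    dominated by a multiple of V_delta uniformly in e. Expanding the square in
      1/2 iint (f(x)/H(x) - f(y)/H(y))^2 H(x) H(y) nu(x-y) dy dx,
    which is legitimate because nu is integrable, gives the identity at level e
    ([ground_state_identity]). Both of its terms are dominated by multiples of their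
    limits, so they converge in [0, +oo] ([self_dominated_cvg], [cvg_jump_energy]).
    The mixtures of heat kernels are Bessel functions by the definition of the latter
    ([BesselK_heat]). *)

(** * Integration of real-valued functions *)

Section toolkit.
Context d (T : measurableType d) (R : realType).
Variable mu : {measure set T -> \bar R}.
Implicit Types f g h : T -> R.

Notation integ f := (mu.-integrable setT (EFin \o f)).

Lemma integ_measurable f : integ f -> measurable_fun setT f.
Proof. by move=> /integrableP[/measurable_EFinP]. Qed.

Lemma integ_le f g : measurable_fun setT f -> integ g ->
  (forall x, `|f x| <= g x) -> integ f.
Proof.
move=> mf ig fg; apply: (le_integrable measurableT _ _ ig).
  exact/measurable_EFinP.
move=> x _ /=; rewrite lee_fin (le_trans (fg x))// ler_norm//.
Qed.

Lemma integM_bounded f (k : T -> R) (M : R) : integ f -> measurable_fun setT k ->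
  (forall x, `|k x| <= M) -> integ (fun x => k x * f x).
Proof.
move=> fi mk kM; have mf := integ_measurable fi.
have Ni : integ (fun x => M * `|f x|).
  by apply: (@integrableZl _ _ _ mu setT measurableT M (EFin \o (fun x => `|f x|))); exact: integrable_norm.
apply: (integ_le _ Ni); first exact: measurable_funM.
by move=> x; rewrite normrM ler_wpM2r.
Qed.

Lemma integZ f (c : R) : integ f -> integ (fun x => c * f x).
Proof.
by move=> fi; exact: (@integrableZl _ _ _ mu setT measurableT c (EFin \o f)).
Qed.

Lemma integD f g : integ f -> integ g -> integ (fun x => f x + g x).
Proof. by move=> fi gi; apply: (integrableD measurableT fi gi). Qed.

Lemma integB f g : integ f -> integ g -> integ (fun x => f x - g x).
Proof. by move=> fi gi; apply: (integrableB measurableT fi gi). Qed.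

Lemma RintE f : integ f -> (\int[mu]_x f x)%:E = (\int[mu]_x (f x)%:E)%E.
Proof. by move=> fi; rewrite fineK//; exact: integrable_fin_num. Qed.

Lemma Rint_le f g : integ f -> integ g -> (forall x, f x <= g x) ->
  \int[mu]_x f x <= \int[mu]_x g x.
Proof. by move=> fi gi fg; apply: le_Rintegral => // x _; exact: fg. Qed.

Lemma eq_Rint f g : f =1 g -> \int[mu]_x f x = \int[mu]_x g x.
Proof. by move=> /funext ->. Qed.

Lemma Rint_norm_le f g : integ f -> integ g -> (forall x, `|f x| <= g x) ->
  `|\int[mu]_x f x| <= \int[mu]_x g x.
Proof.
move=> fi gi fg; apply: le_trans (le_normr_Rintegral measurableT fi) _.
by apply: Rint_le => //; exact: integrable_norm.
Qed.

Lemma Rint_dct (f_ : nat -> T -> R) f g :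
  (forall n, measurable_fun setT (f_ n)) -> measurable_fun setT f -> integ g ->
  (forall x, f_ n x @[n --> \oo] --> f x) ->
  (forall n x, `|f_ n x| <= g x) ->
  \int[mu]_x f_ n x @[n --> \oo] --> \int[mu]_x f x.
Proof.
move=> mf_ mf gi ff fg.
have [|||||fi _] := @dominated_convergence _ _ _ mu setT measurableT
   (fun n x => (f_ n x)%:E) (EFin \o f) (EFin \o g).
- by move=> n; exact/measurable_EFinP.
- exact/measurable_EFinP.
- by apply: aeW => x _; apply: cvg_EFin; [exact: nearW|exact: ff].
- by [].
- by apply: aeW => x n _; rewrite lee_fin.

  by rewrite /= -(RintE fi) => /fine_cvgP[_].
Qed.

Lemma ge0_integ f : measurable_fun setT f -> (forall x, 0 <= f x) ->
  (\int[mu]_x (f x)%:E < +oo)%E -> integ f.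
Proof.
move=> mf f0 foo; apply/integrableP; split; first exact/measurable_EFinP.
by under eq_integral do rewrite /= ger0_norm//.
Qed.

End toolkit.
Notation integ mu f := (integrable mu setT (EFin \o f)).

Section le_integral.
Context d (T : measurableType d) (R : realType).
Variable mu : {measure set T -> \bar R}.

Lemma ge0_le_int (f1 f2 : T -> \bar R) :
  (forall x, 0 <= f1 x)%E -> measurable_fun setT f1 -> measurable_fun setT f2 ->
  (forall x, f1 x <= f2 x)%E -> (\int[mu]_x f1 x <= \int[mu]_x f2 x)%E.
Proof.
move=> f10 mf1 mf2 f12; apply: ge0_le_integral.
- exact: measurableT.
- by move=> x _; exact: f10.
- exact: mf1.
- exact: mf2.
- by move=> x _; exact: f12.
Qed.

Lemma ge0_intZl (f : T -> R) (k : R) : measurable_fun setT f -> (forall x, 0 <= f x) ->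
  0 <= k -> (\int[mu]_x (k * f x)%:E = k%:E * \int[mu]_x (f x)%:E)%E.
Proof.
move=> mf f0 k0; under eq_integral do rewrite EFinM.
rewrite ge0_integralZl.
- by [].
- exact: measurableT.
- exact/measurable_EFinP.
- by move=> x _; rewrite lee_fin.
- by rewrite lee_fin.
Qed.

End le_integral.

Section product.
Context d1 d2 (X : measurableType d1) (Y : measurableType d2) (R : realType).
Variables (mu : {sigma_finite_measure set X -> \bar R})
  (nu : {sigma_finite_measure set Y -> \bar R}).

Lemma measurable_section1 (F : X * Y -> R) x :
  measurable_fun setT F -> measurable_fun setT (fun y => F (x, y)).
Proof. by move=> mF; apply: measurableT_comp mF _. Qed.

Lemma measurable_section2 (F : X * Y -> R) y :
  measurable_fun setT F -> measurable_fun setT (fun x => F (x, y)).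
Proof. by move=> mF; apply: measurableT_comp mF _. Qed.

Lemma integ_prod (F : X * Y -> R) : integ (mu \x nu)%E F ->
  integ mu (fun x => \int[nu]_y F (x, y)) /\
  \int[(mu \x nu)%E]_z F z = \int[mu]_x \int[nu]_y F (x, y).
Proof.
move=> Fi; have mF := integ_measurable Fi.
have aefin := ae_integrable1 Fi.
have mE : measurable_fun setT (fun x => \int[nu]_y F (x, y)).
  apply: (measurableT_comp (fine_measurable measurableT)).
  exact: (measurable_fubini_F Fi).
have ae : {ae mu, forall x, setT x ->
    (\int[nu]_y (F (x, y))%:E)%E = (\int[nu]_y F (x, y))%:E}.
  apply: filterS aefin => x Fx _; rewrite fineK//.
  exact: integrable_fin_num.
have iF := integrable_fubini_F Fi.
split.
  have /integrableP[mF' iF'] := iF.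
  apply/integrableP; split; first exact/measurable_EFinP.
  move: iF'; rewrite (@ae_eq_integral _ _ _ mu setT
    (fun x => `|(\int[nu]_y F (x, y))%:E|)%E)//.
  - exact: measurableT_comp.
  - by apply: measurableT_comp => //; exact/measurable_EFinP.
  - by apply: filterS ae => x /= h _; rewrite /fubini_F /= h.
rewrite /Rintegral; congr fine.
rewrite -(integral12_prod_meas1 Fi).
apply: ae_eq_integral => //.
- exact: measurable_fubini_F Fi.
- exact/measurable_EFinP.
Qed.

(** The inner integrals are finite only almost everywhere; their default value elsewhere
    does not change the outer integrals. *)
Lemma Rint_fubini (F : X * Y -> R) : integ (mu \x nu)%E F ->
  \int[mu]_x \int[nu]_y F (x, y) = \int[nu]_y \int[mu]_x F (x, y).
Proof.
move=> Fi; rewrite -(integ_prod Fi).2.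
have mF := integ_measurable Fi.
have aefin := ae_integrable2 Fi.
have mE : measurable_fun setT (fun y => \int[mu]_x F (x, y)).
  apply: (measurableT_comp (fine_measurable measurableT)).
  exact: (measurable_fubini_G Fi).
rewrite /Rintegral; congr fine.
rewrite -(integral21_prod_meas1 Fi).
apply: ae_eq_integral => //.
- exact: measurable_fubini_G Fi.
- exact/measurable_EFinP.
- apply: filterS aefin => x Fx _; rewrite fineK//.
  exact: integrable_fin_num.
Qed.

Lemma integ_tensor (f : X -> R) (g : Y -> R) : integ mu f -> integ nu g ->
  integ (mu \x nu)%E (fun z => f z.1 * g z.2).
Proof.
move=> fi gi; have mf := integ_measurable fi; have mg := integ_measurable gi.
have mfg : measurable_fun setT (fun z : X * Y => f z.1 * g z.2).
  by apply: measurable_funM; apply: measurableT_comp.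
apply/integrable12ltyP; first exact/measurable_EFinP.
under eq_integral => x _.
  under eq_integral => y _.
    rewrite /= normrM EFinM; over.
  rewrite ge0_integralZl//; last first.
    by apply/measurable_EFinP; exact: measurableT_comp.
  over.
have /integrableP[_ /= fi'] := fi; have /integrableP[_ /= gi'] := gi.
rewrite ge0_integralZr//; last 2 first.
- by apply/measurable_EFinP; exact: measurableT_comp.
- exact: integral_ge0.
by rewrite lte_mul_pinfty// ?integral_ge0// ge0_fin_numE// integral_ge0.
Qed.

Section bounded_kernel.
Variables (f : X -> R) (g : Y -> R) (k : X * Y -> R) (M : R).
Hypotheses (fi : integ mu f) (gi : integ nu g)
  (mk : measurable_fun setT k) (kM : forall z, `|k z| <= M).

Lemma integ_kernel : integ (mu \x nu)%E (fun z => k z * (f z.1 * g z.2)).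
Proof. exact: integM_bounded (integ_tensor fi gi) mk kM. Qed.

Lemma measurable_kernel :
  measurable_fun setT (fun x => \int[nu]_y (k (x, y) * g y)).
Proof.
have mg := integ_measurable gi.
have mF : measurable_fun setT (fun z : X * Y => (k z * g z.2)%:E).
  by apply/measurable_EFinP; apply: measurable_funM => //; apply: measurableT_comp.
apply: (measurableT_comp (fine_measurable measurableT)).
pose F (z : X * Y) := (k z * g z.2)%:E.
rewrite [X in measurable_fun _ X](_ : _ =
  ((fun x => \int[nu]_y F^\+ (x, y)) \- (fun x => \int[nu]_y F^\- (x, y)))%E).
  apply: emeasurable_funB.
    by apply: measurable_fun_fubini_tonelli_F => //; exact: measurable_funepos.
  by apply: measurable_fun_fubini_tonelli_F => //; exact: measurable_funeneg.
apply/funext => x.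
by rewrite -[LHS]/(\int[nu]_y (F \o pair x) y)%E integralE funepos_comp funeneg_comp.
Qed.

Lemma kernel_le x : `|\int[nu]_y (k (x, y) * g y)| <= M * \int[nu]_y `|g y|.
Proof.
rewrite -RintegralZl//; last exact: integrable_norm.
apply: Rint_norm_le.
- apply: (integM_bounded gi (measurable_section1 x mk)) => y; exact: kM.
- by apply: integZ; exact: integrable_norm.
- by move=> y; rewrite normrM ler_wpM2r.
Qed.

(** The form in which Fubini's theorem enters the Fourier computations below: k is a cosine,
    and the two weights are a function and a multiplier. *)
Lemma kernel_swap :
  \int[mu]_x (f x * \int[nu]_y (k (x, y) * g y)) =
  \int[nu]_y (g y * \int[mu]_x (k (x, y) * f x)).
Proof.
transitivity (\int[mu]_x \int[nu]_y (k (x, y) * (f x * g y))).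
  apply: eq_Rint => x; rewrite -RintegralZl//.
    by apply: eq_Rint => y; rewrite mulrCA.
  apply: (integM_bounded gi (measurable_section1 x mk)) => y; exact: kM.
rewrite (Rint_fubini integ_kernel)/=.
apply: eq_Rint => y; rewrite -RintegralZl//.
  by apply: eq_Rint => x /=; rewrite [f x * _]mulrC mulrCA.
apply: (integM_bounded fi (measurable_section2 y mk)) => x; exact: kM.
Qed.

End bounded_kernel.
End product.

(** * Affine substitutions and the one-dimensional Gaussian *)

Section affine.
Context {R : realType}.
Local Notation mu := (@lebesgue_measure R).

Lemma measurable_affine (c b : R) :
  measurable_fun [set: measurableTypeR R] (fun x => c * x + b : measurableTypeR R).
Proof. by apply: measurable_funD => //; apply: measurable_funM. Qed.

(** Uniqueness of Lebesgue measure: the scaled image measure gives half-open intervals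
    their length. *)
Lemma lebesgue_affine (c b : R) (A : set (measurableTypeR R)) : 0 < c ->
  measurable A ->
  mu A = (c%:E * mu ((fun x : R => (c * x + b)%R) @^-1` A))%E.
Proof.
move=> c0 mA.
pose phi : measurableTypeR R -> measurableTypeR R := fun x => c * x + b.
pose m : {measure set (measurableTypeR R) -> \bar R} :=
  measure_function_pushforward__canonical__measure_function_Measure mu
    (measurable_affine c b).
pose cc : {nonneg R} := NngNum (ltW c0).
rewrite (@lebesgue_measure_unique _ (mscale cc m)) //.
move=> _ [[x y]] _ <-.
rewrite /= /mscale /= /pushforward.
rewrite (_ : _ @^-1` _ = `](x - b) / c, (y - b) / c]%classic); last first.
  apply/seteqP; split => z /=; rewrite !in_itv/=
    ltr_pdivrMr// ler_pdivlMr// ltrBlDr lerBrDr (mulrC z)//.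
rewrite !lebesgue_measure_itv/= !lte_fin ltr_pM2r ?invr_gt0// ltrD2r.
case: ifP => _; last by rewrite mule0.
by rewrite -!EFinB -EFinM; congr EFin; field; rewrite gt_eqF.
Qed.

Lemma ge0_integral_affine (c b : R) (f : R -> \bar R) : 0 < c ->
  measurable_fun setT f -> (forall x, 0 <= f x)%E ->
  (\int[mu]_x f (c * x + b)%R = (c^-1)%:E * \int[mu]_x f x)%E.
Proof.
move=> c0 mf f0.
pose m : {measure set (measurableTypeR R) -> \bar R} :=
  measure_function_pushforward__canonical__measure_function_Measure mu
    (measurable_affine c b).
pose cc : {nonneg R} := NngNum (ltW c0).
have -> : (\int[mu]_x f x = \int[mscale cc m]_x f x)%E.
  by apply: eq_measure_integral => A mA _; exact: lebesgue_affine.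
rewrite ge0_integral_mscale//= muleA -EFinM mulVf ?gt_eqF// mul1e.
exact/esym/(ge0_integral_pushforward (measurable_affine c b) mu measurableT mf
  (fun x _ => f0 x)).
Qed.

Lemma integ_affine (c b : R) (f : R -> R) : 0 < c ->
  integ mu f -> integ mu (fun x => f (c * x + b)).
Proof.
move=> c0 /integrableP[/measurable_EFinP mf fi].
have mc := measurable_affine c b.
apply/integrableP; split; first by apply/measurable_EFinP; exact: measurableT_comp mf mc.
rewrite /= (@ge0_integral_affine c b (fun x => `|(f x)%:E|)%E)//.
  rewrite lte_mul_pinfty// ?lee_fin ?invr_ge0 ?ltW//.
by apply: measurableT_comp => //; exact/measurable_EFinP.
Qed.

Lemma Rint_affine (c b : R) (f : R -> R) : 0 < c -> integ mu f ->
  \int[mu]_x f (c * x + b) = c^-1 * \int[mu]_x f x.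
Proof.
move=> c0 fi; have ci := integ_affine b c0 fi.
have mf := integ_measurable fi.
apply: EFin_inj; rewrite EFinM !RintE//.
rewrite integralE [X in (_ * X)%E]integralE.
rewrite (funepos_comp (EFin \o f)) (funeneg_comp (EFin \o f)) /comp.
rewrite !ge0_integral_affine//; last 2 first.
- exact/measurable_funeneg/measurable_EFinP.
- exact/measurable_funepos/measurable_EFinP.
rewrite -muleBr//; apply: fin_num_adde_defl.
by rewrite fin_numN; apply: integrable_fin_num => //; exact: integrable_funeneg.
Qed.

End affine.

Section gauss1.
Context {R : realType}.
Local Notation mu := (@lebesgue_measure R).

Lemma integ_gauss_scaled (s : R) : 0 < s ->
  integ mu (fun z => expR (- s * z ^+ 2)).
Proof.
move=> s0; have := @integ_affine R (Num.sqrt s) 0 gauss_fun _ integrableT_gauss.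
rewrite sqrtr_gt0 => /(_ s0); apply: eq_integrable => //= z _.
by rewrite /gauss_fun addr0 exprMn sqr_sqrtr ?ltW// mulNr.
Qed.

Lemma Rint_gauss : \int[mu]_z gauss_fun z = Num.sqrt pi :> R.
Proof. by rewrite /Rintegral integralT_gauss. Qed.

Lemma abs_le_expR (z : R) : `|z| <= expR (z ^+ 2 / 2).
Proof.
apply: le_trans (expR_ge1Dx _).
rewrite -[z ^+ 2]real_normK ?num_real//; nra.
Qed.

Lemma integ_zgauss : integ mu (fun z : R => expR (- 2^-1 * z ^+ 2)).
Proof. by apply: integ_gauss_scaled; rewrite invr_gt0. Qed.

Lemma zgauss_le (z : R) : `|z| * gauss_fun z <= expR (- 2^-1 * z ^+ 2).
Proof.
apply: le_trans (ler_wpM2r (gauss_fun_ge0 z) (abs_le_expR z)) _.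
by rewrite /gauss_fun -expRD ler_expR; lra.
Qed.

Variable theta : R.
Let F (x : R) := \int[mu]_z (cos (theta + x * z) * gauss_fun z).

Lemma measurable_cosM (x : R) : measurable_fun setT (fun z : R => cos (theta + x * z)).
Proof.
apply: measurableT_comp; first by apply: continuous_measurable_fun; exact: continuous_cos.
by apply: measurable_funD => //; exact: measurable_funM.
Qed.

Lemma measurable_sinM (x : R) : measurable_fun setT (fun z : R => sin (theta + x * z)).
Proof.
apply: measurableT_comp; first by apply: continuous_measurable_fun; exact: continuous_sin.
by apply: measurable_funD => //; exact: measurable_funM.
Qed.

Lemma integ_cosgauss x : integ mu (fun z : R => cos (theta + x * z) * gauss_fun z).
Proof.
apply: (@integM_bounded _ _ _ _ _ _ 1) => //; [exact: integrableT_gauss|exact: measurable_cosM|].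
by move=> z; rewrite ler_norml cos_geN1 cos_le1.
Qed.

Lemma zsingauss_le x z :
  `|z * sin (theta + x * z) * gauss_fun z| <= expR (- 2^-1 * z ^+ 2).
Proof.
rewrite !normrM (ger0_norm (gauss_fun_ge0 z)) -mulrA mulrCA.
apply: le_trans (zgauss_le z); rewrite ler_piMl ?mulr_ge0 ?gauss_fun_ge0//.
by rewrite ler_norml sin_geN1 sin_le1.
Qed.

Lemma integ_zsingauss x : integ mu (fun z : R => z * sin (theta + x * z) * gauss_fun z).
Proof.
apply: (integ_le _ integ_zgauss) => [|z]; last exact: zsingauss_le.
apply: measurable_funM; last exact: measurable_gauss_fun.
by apply: measurable_funM => //; exact: measurable_sinM.
Qed.

Lemma derive_cosgauss (x : R) :
  is_derive x (1 : R) F (- \int[mu]_z (z * sin (theta + x * z) * gauss_fun z)).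
Proof.
pose f (x z : R) : R := cos (theta + x * z) * gauss_fun z.
have df (y z : R) : is_derive y (1 : R) (f ^~ z) (- (z * sin (theta + y * z) * gauss_fun z)).
  rewrite /f; apply: is_derive_eq.
  by rewrite /GRing.scale/=; ring.
have d1 (y z : R) : partial1of2 f y z = - (z * sin (theta + y * z) * gauss_fun z).
  by rewrite partial1of2E; apply: derive_val.
have h1 : forall y, `](x - 1), (x + 1)[%classic y -> integ mu (f y).
  by move=> y _; exact: integ_cosgauss.
have h2 : forall y z, `](x - 1), (x + 1)[%classic y -> [set: R] z ->
    `|partial1of2 f y z| <= expR (- 2^-1 * z ^+ 2).
  by move=> y z _ _; rewrite d1 normrN; exact: zsingauss_le.
have h3 : forall y z, `](x - 1), (x + 1)[%classic y -> [set: R] z ->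
    derivable (f ^~ z) y (1 : R) by move=> y z _ _; apply: ex_derive.
have xI : `](x - 1), (x + 1)[%classic x by rewrite /= in_itv/= ltrBlDr ltrDl ltr01.
have := @derivable_under_integral _ _ _ mu f setT measurableT x _ _ xI h1 h3
  _ (fun z => expR_ge0 _) integ_zgauss h2.
move=> dF; split; first exact: dF.
have := @differentiation_under_integral _ _ _ mu f setT measurableT x _ _ xI h1 h3
  _ (fun z => expR_ge0 _) integ_zgauss h2.
rewrite derive1E => ->.
under eq_Rint do rewrite d1 -mulN1r.
by rewrite RintegralZl// ?mulN1r//; exact: integ_zsingauss.
Qed.

Let psi (x z : R) := x * (cos (theta + x * z) * gauss_fun z) -
  2 * (z * sin (theta + x * z) * gauss_fun z).

Let phi (x z : R) := sin (theta + x * z) * gauss_fun z.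

Let dphi (x z : R) : is_derive z (1 : R) (phi x) (psi x z).
Proof.
rewrite /phi/gauss_fun; apply: is_derive_eq.
by rewrite /psi /gauss_fun /GRing.scale/=; ring.
Qed.

Let integ_psi x : integ mu (psi x).
Proof.
by apply: integB; apply: integZ; [exact: integ_cosgauss|exact: integ_zsingauss].
Qed.

Let cpsi x : continuous (psi x).
Proof.
move=> z; apply: differentiable_continuous; apply/derivable1_diffP.
by rewrite /psi /gauss_fun; apply: ex_derive.
Qed.

Let FTC x (n : nat) : \int[mu]_z (psi x z * \1_`[- n%:R, n%:R] z) = phi x n%:R - phi x (- n%:R).
Proof.
case: n => [|n].
  rewrite oppr0 subrr set_itv1.
  rewrite (_ : (fun z => _) = (psi x) \_ [set 0]); last first.
    by rewrite [RHS]patch_indic; apply/funext.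
  by rewrite -Rintegral_mkcond Rintegral_set1.
rewrite (_ : (fun z => _) = (psi x) \_ `[- n.+1%:R, n.+1%:R]); last first.
  by rewrite [RHS]patch_indic; apply/funext.
rewrite -Rintegral_mkcond /Rintegral.
rewrite (@continuous_FTC2 _ (psi x) (phi x))//.
- by rewrite gt0_cp// ltr0n.
- by apply: continuous_subspaceT; exact: cpsi.
- have cphi : continuous (phi x).
    by move=> z; apply: differentiable_continuous; apply/derivable1_diffP; apply: ex_derive.
  split; first by move=> z _; apply: ex_derive.
    by apply: cvg_at_right_filter; exact: cphi.
  by apply: cvg_at_left_filter; exact: cphi.
- by move=> z _; rewrite derive1E; exact: (@derive_val _ _ _ _ _ _ _ (dphi x z)).
Qed.

Let phi_cvg0 x : phi x n%:R - phi x (- n%:R) @[n --> \oo] --> (0 : R).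
Proof.
have g0 : gauss_fun (n%:R : R) @[n --> \oo] --> (0 : R).
  exact: (cvg_comp _ _ (@cvgr_idn R) cvg_gauss_fun).
apply: norm_cvg0.
apply: (@squeeze_cvgr _ _ _ _ (cst 0) (fun n : nat => 2 * gauss_fun n%:R)).
- apply: nearW => n; rewrite /= normr_ge0/=.
  apply: le_trans (ler_normB _ _) _; rewrite mulr2n mulrDl mul1r.
  rewrite /phi !normrM {2}/gauss_fun sqrrN -/(gauss_fun _) (ger0_norm (gauss_fun_ge0 _)).
  by apply: lerD; rewrite ler_piMl ?gauss_fun_ge0// ler_norml sin_geN1 sin_le1.
- exact: cvg_cst.
- by rewrite -(mulr0 2); apply: cvgMr.
Qed.

(** The difference of the two sides is the integral of the derivative of
    z |-> sin (theta + x z) e^(-z^2), which vanishes at infinity. *)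
Lemma gauss_by_parts x : x * F x =
  2 * \int[mu]_z (z * sin (theta + x * z) * gauss_fun z).
Proof.
apply/eqP; rewrite -subr_eq0 /F -!RintegralZl//; last 2 first.
- exact: integ_zsingauss.
- exact: integ_cosgauss.
rewrite -RintegralB//; last 2 first.
- exact/integZ/integ_cosgauss.
- exact/integZ/integ_zsingauss.
apply/eqP.
have h : \int[mu]_z (psi x z * \1_`[- n%:R, n%:R] z) @[n --> \oo] --> \int[mu]_z psi x z.
  apply: (@Rint_dct _ _ _ mu (fun n z => psi x z * \1_`[- n%:R, n%:R] z) (psi x) (fun z => `|psi x z|)).
  - move=> n; apply: measurable_funM; first exact: integ_measurable (integ_psi x).
    exact: measurable_indic.
  - exact: integ_measurable (integ_psi x).
  - exact/integrable_norm/integ_psi.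
  - move=> z; apply: cvg_near_cst; near=> n.
    rewrite indicE mem_set ?mulr1//= in_itv/= -ler_norml.
    by near: n; exact: nbhs_infty_ger.
  - by move=> n z; rewrite normrM ler_piMr// indicE; case: (_ \in _); rewrite ?normr1 ?normr0.
have -> : \int[mu]_z psi x z = 0.
  apply: (cvg_unique _ h); first exact: norm_hausdorff.
  have -> : (fun n : nat => \int[mu]_z (psi x z * \1_`[- n%:R, n%:R] z)) =
    (fun n : nat => phi x n%:R - phi x (- n%:R)) by apply/funext => n; exact: FTC.
  exact: phi_cvg0.
by [].
Unshelve. all: by end_near. Qed.

(** Differentiation under the integral and integration by parts give F' = - x F / 2,
    so F e^(x^2/4) is constant. The phase theta allows the induction on the dimension in
    [gauss_fourier]. *)
Lemma gauss_fourier1 x : F x = cos theta * Num.sqrt pi * expR (- (x ^+ 2 / 4)).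
Proof.
pose Phi y := F y * expR (y ^+ 2 / 4).
have dPhi y : is_derive y (1 : R) Phi 0.
  have dF := derive_cosgauss y.
  rewrite /Phi; apply: is_derive_eq.
  rewrite /GRing.scale/=.
  have := gauss_by_parts y; rewrite /F; set I := (\int[mu]_z (z * _ * _)); set J := Rintegral _ _ _ => h.
  have -> : I = y * J / 2 by rewrite h; field.
  by field.
have h : Phi x = Phi 0 by apply: is_derive_0_is_cst.
have F0 : F 0 = cos theta * Num.sqrt pi.
  rewrite /F; under eq_Rint do rewrite mul0r addr0.
  by rewrite RintegralZl ?Rint_gauss//; exact: integrableT_gauss.
move: h; rewrite /Phi F0 expr0n /= mul0r expR0 mulr1 => <-.
by rewrite -mulrA -expRD subrr expR0 mulr1.
Qed.

End gauss1.

Lemma gauss_fourier1s {R : realType} (theta s x : R) : 0 < s ->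
  \int[lebesgue_measure]_z (cos (theta + x * z) * expR (- s * z ^+ 2)) =
  cos theta * Num.sqrt (pi / s) * expR (- (x ^+ 2 / (4 * s))).
Proof.
move=> s0; have ss : 0 < Num.sqrt s by rewrite sqrtr_gt0.
have := @Rint_affine R (Num.sqrt s) 0 _ ss (integ_cosgauss theta (x / Num.sqrt s)).
rewrite gauss_fourier1 /gauss_fun.
under eq_Rint => z.
  rewrite addr0 exprMn sqr_sqrtr ?ltW// -mulNr mulrA divfK ?gt_eqF//. over.
move=> ->; rewrite sqrtrM ?pi_ge0// sqrtrV ?ltW//.
have -> : (x / Num.sqrt s) ^+ 2 / 4 = x ^+ 2 / (4 * s).
  by rewrite exprMn exprVn sqr_sqrtr ?ltW// invfM; ring.
ring.
Qed.

(** * Gaussian Fourier transforms and heat kernels on R^d *)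

Lemma cvg_expR_harmonic {R : realType} (c : R) :
  expR (- n.+1%:R^-1 * c) @[n --> \oo] --> (1 : R).
Proof.
rewrite -[X in _ --> X]expR0; apply: continuous_cvg; first exact: continuous_expR.
have : - (@harmonic R n) * c @[n --> \oo] --> - 0 * c.
  by apply: cvgMl; apply: cvgN; exact: cvg_harmonic.
by rewrite oppr0 mul0r.
Qed.

Section rvec_measurable.
Context {R : realType} {d : nat} {dsp} {T : measurableType dsp}.
Implicit Types f g : T -> Rvec R d.

Lemma measurable_coordT f i : measurable_fun setT f ->
  measurable_fun setT (fun t => Defs.coord (f t) i : measurableTypeR R).
Proof. by move=> mf; apply: (measurableT_comp (@measurable_tnth _ _ d i) mf). Qed.

Lemma measurable_dotvT f g : measurable_fun setT f -> measurable_fun setT g ->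
  measurable_fun setT (fun t => dotv (f t) (g t)).
Proof.
move=> mf mg; rewrite /dotv.
by apply: measurable_sum => i; apply: measurable_funM; exact: measurable_coordT.
Qed.

Lemma measurable_vsubT f g : measurable_fun setT f -> measurable_fun setT g ->
  measurable_fun setT (fun t => vsub (f t) (g t)).
Proof.
move=> mf mg; apply/measurable_fun_tnthP => i.
rewrite [X in measurable_fun _ X](_ : _ = (fun t => (Defs.coord (f t) i : R) - Defs.coord (g t) i)); last first.
  by apply/funext => t; rewrite /= tnth_mktuple.
by apply: measurable_funB; exact: measurable_coordT.
Qed.

End rvec_measurable.

Section rvec_algebra.
Context {R : realType} {d : nat}.
Implicit Types x y z : Rvec R d.

Lemma dotvBl x y z : dotv (vsub x y) z = dotv x z - dotv y z.
Proof.
rewrite /dotv -sumrB; apply: eq_bigr => i _.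
by rewrite {1}/Defs.coord tnth_mktuple mulrBl.
Qed.

Lemma dotvC x y : dotv x y = dotv y x.
Proof. by apply: eq_bigr => i _; rewrite mulrC. Qed.

Lemma dotv_ge0 x : 0 <= dotv x x.
Proof. by apply: sumr_ge0 => i _; rewrite -expr2 sqr_ge0. Qed.

Lemma dotv_vsubC x y : dotv (vsub x y) (vsub x y) = dotv (vsub y x) (vsub y x).
Proof.
by apply: eq_bigr => i _; rewrite /Defs.coord !tnth_mktuple -mulrNN !opprB.
Qed.

Lemma enormK x : enorm x ^+ 2 = dotv x x.
Proof. by rewrite sqr_sqrtr// dotv_ge0. Qed.

End rvec_algebra.

Lemma dotv_cons {R : realType} n (a b : R) (x z : Rvec R n) :
  dotv (cons_pair (a, x)) (cons_pair (b, z)) = a * b + dotv x z.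
Proof.
rewrite /dotv big_ord_recl; congr (_ + _).
by apply: eq_bigr => i _; rewrite /Defs.coord !tnthS.
Qed.

Lemma cons_pair_surj {R : realType} n (x : Rvec R n.+1) :
  exists a y, x = cons_pair (a, y).
Proof. by case/tupleP: x => a y; exists a, y; apply/val_inj. Qed.

Section leb_succ.
Context {R : realType} (n : nat).
Local Notation mu := (@lebesgue_measure R).

Lemma integ_leb_succ (F : Rvec R n.+1 -> R) : measurable_fun setT F ->
  integ (mu \x leb R n)%E (F \o @cons_pair R n) ->
  integ (leb R n.+1) F /\
  \int[leb R n.+1]_x F x = \int[mu]_a \int[leb R n]_x F (cons_pair (a, x)).
Proof.
move=> mF Fi; split.
  have := @integrable_pushforward _ _ _ _ R (@cons_pair R n)
    (@measurable_cons_pair R n) (mu \x leb R n)%E setT (EFin \o F).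
  by apply => //; exact/measurable_EFinP.
rewrite -(integ_prod Fi).2 /Rintegral; congr fine.
have := @integral_pushforward _ _ _ _ R (@cons_pair R n)
    (@measurable_cons_pair R n) (mu \x leb R n)%E setT (EFin \o F).
by apply => //; exact/measurable_EFinP.
Qed.

End leb_succ.

Section gauss_fourier.
Context {R : realType}.

Lemma integ_leb0 (F : Rvec R 0 -> R) : measurable_fun setT F ->
  integ (leb R 0) F /\ \int[leb R 0]_x F x = F [tuple].
Proof.
move=> mF; have mF' : measurable_fun setT (EFin \o F) by exact/measurable_EFinP.
have dT : \d_([tuple] : Rvec R 0) setT = 1%E :> \bar R by rewrite diracE mem_set.
split.
  apply/integrableP; split => //.
  rewrite (@integral_dirac _ _ _ _ _ measurableT (fun x => `|(EFin \o F) x|)%E); last exact: measurableT_comp.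
  by rewrite dT mul1e/= ltry.
by rewrite /Rintegral (@integral_dirac _ _ _ _ _ measurableT (EFin \o F))// dT mul1e.
Qed.

Lemma measurable_cosdot d (theta : R) (x : Rvec R d) :
  measurable_fun setT (fun z => cos (theta + dotv x z)).
Proof.
apply: measurableT_comp; first by apply: continuous_measurable_fun; exact: continuous_cos.
by apply: measurable_funD => //; exact: measurable_dotvT.
Qed.

Lemma measurable_gaussd d (s : R) :
  measurable_fun setT (fun z : Rvec R d => expR (- s * dotv z z)).
Proof.
by apply: measurableT_comp => //; apply: measurable_funM => //; exact: measurable_dotvT.
Qed.

Lemma integ_gaussd d (s : R) : 0 < s ->
  integ (leb R d) (fun z => expR (- s * dotv z z)).
Proof.
move=> s0; elim: d => [|n ih].
  by have [] := integ_leb0 (@measurable_gaussd 0 s).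
suff : integ (lebesgue_measure \x leb R n)%E
    ((fun z => expR (- s * dotv z z)) \o @cons_pair R n).
  by move=> /(integ_leb_succ (@measurable_gaussd n.+1 s))[].
have := integ_tensor (integ_gauss_scaled s0) ih.
apply: eq_integrable => // -[a x] _ /=; congr EFin.
by rewrite dotv_cons mulrDr expRD expr2.
Qed.

(** Induction on d: integrating out the other coordinates leaves the one-dimensional
    transform with the phase theta + a b. *)
Lemma gauss_fourier d (theta s : R) (x : Rvec R d) : 0 < s ->
  \int[leb R d]_z (cos (theta + dotv x z) * expR (- s * dotv z z)) =
  cos theta * Num.sqrt (pi / s) ^+ d * expR (- (dotv x x / (4 * s))).
Proof.
move=> s0; elim: d theta x => [|n ih] theta x.
  rewrite (integ_leb0 _).2; last first.
    by apply: measurable_funM; [exact: measurable_cosdot|exact: measurable_gaussd].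
  by rewrite /dotv !big_ord0 mulr0 mul0r oppr0 addr0 expR0 expr0 !mulr1.
have [a [y ->]] := cons_pair_surj x.
have mF : measurable_fun setT (fun z => cos (theta + dotv (cons_pair (a, y)) z) *
    expR (- s * dotv z z)).
  by apply: measurable_funM; [exact: measurable_cosdot|exact: measurable_gaussd].
rewrite (integ_leb_succ mF _).2; last first.
  have h := integ_tensor (integ_gauss_scaled s0) (integ_gaussd n s0).
  apply: (integ_le _ h).
    by apply: measurableT_comp mF _; exact: measurable_cons_pair.
  move=> -[b z] /=; rewrite normrM (ger0_norm (expR_ge0 _)).
  rewrite [X in _ * expR (_ * X)]dotv_cons mulrDr expRD -expr2.
  by rewrite ler_piMl ?mulr_ge0 ?expR_ge0// ler_norml cos_geN1 cos_le1.
transitivity (\int[lebesgue_measure]_b ((Num.sqrt (pi / s) ^+ n * expR (- (dotv y y / (4 * s)))) *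
  (cos (theta + a * b) * expR (- s * b ^+ 2)))).
  apply: eq_Rint => b.
  transitivity (\int[leb R n]_z (expR (- s * b ^+ 2) *
      (cos ((theta + a * b) + dotv y z) * expR (- s * dotv z z)))).
    apply: eq_Rint => z; rewrite !dotv_cons mulrDr expRD -expr2 addrA; ring.
  rewrite RintegralZl//; last first.
    apply: (@integM_bounded _ _ _ _ _ _ 1); first exact: integ_gaussd.
      exact: measurable_cosdot.
    by move=> z; rewrite ler_norml cos_geN1 cos_le1.
  by rewrite ih; ring.
rewrite RintegralZl//; last first.
  apply: (@integM_bounded _ _ _ _ _ _ 1); first exact: integ_gauss_scaled.
    exact: measurable_cosM.
  by move=> z; rewrite ler_norml cos_geN1 cos_le1.
rewrite gauss_fourier1s// [X in _ = _ * expR (- (X / _))]dotv_cons.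
rewrite [(a * a + _) / _]mulrDl opprD expRD -expr2 [Num.sqrt _ ^+ n.+1]exprS.
have aux (P A B C c : R) : P * B * (c * A * C) = c * (A * P) * (C * B) by ring.
exact: aux.
Qed.

Lemma Rint_gaussd d (s : R) : 0 < s ->
  \int[leb R d]_z expR (- s * dotv z z) = Num.sqrt (pi / s) ^+ d.
Proof.
move=> s0; pose o : Rvec R d := [tuple 0 | i < d].
have := gauss_fourier 0 (vsub o o) s0.
have e z : dotv (vsub o o) z = 0 by rewrite dotvBl subrr.
rewrite e mul0r oppr0 expR0 mulr1 cos0 mul1r => <-.
by apply: eq_Rint => z; rewrite e addr0 cos0 mul1r.
Qed.

End gauss_fourier.

Section fourier.
Context {R : realType} {d : nat}.
Local Notation mu := (leb R d).
Implicit Types (m : Rvec R d -> R) (x y z : Rvec R d).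

(** The inverse Fourier transform of an even multiplier, as a real integral. *)
Definition cosft m x : R := (2 * pi) ^- d * \int[mu]_z (cos (dotv x z) * m z).

Definition heat (s : R) x : R :=
  Num.sqrt (4 * pi * s) ^- d * expR (- (dotv x x / (4 * s))).

Lemma heat_ge0 s x : 0 <= heat s x.
Proof. by rewrite mulr_ge0 ?expR_ge0// invr_ge0 exprn_ge0// sqrtr_ge0. Qed.

Lemma cosft_gauss s x : 0 < s -> cosft (fun z => expR (- s * dotv z z)) x = heat s x.
Proof.
move=> s0; have := @gauss_fourier R d 0 s x s0.
rewrite /cosft /heat; under eq_Rint do rewrite add0r.
move=> ->; rewrite cos0 mul1r mulrA; congr (_ * _).
rewrite -!exprVn -exprMn; congr (_ ^+ _).
rewrite -mulrA (_ : 4 = 2 ^+ 2); last by rewrite -natrX.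
rewrite (sqrtrM _ (sqr_ge0 2)) sqrtr_sqr ger0_norm// !sqrtrM ?pi_ge0//.
rewrite sqrtrV ?ltW//.
have p0 : Num.sqrt (pi : R) != 0 by rewrite sqrtr_eq0 -ltNge pi_gt0.
have ss0 : Num.sqrt s != 0 by rewrite sqrtr_eq0 -ltNge.
rewrite -{1}(sqr_sqrtr (pi_ge0 R)).
by field; rewrite ss0 p0.
Qed.

Lemma measurable_cosdot2 : measurable_fun setT
  (fun p : Rvec R d * Rvec R d => cos (dotv p.1 p.2)).
Proof.
apply: measurableT_comp; first by apply: continuous_measurable_fun; exact: continuous_cos.
exact: measurable_dotvT.
Qed.

Lemma cos_bnd (t : R) : `|cos t| <= 1.
Proof. by rewrite ler_norml cos_geN1 cos_le1. Qed.

Lemma sin_bnd (t : R) : `|sin t| <= 1.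
Proof. by rewrite ler_norml sin_geN1 sin_le1. Qed.

Lemma measurable_cosft m : integ mu m -> measurable_fun setT (cosft m).
Proof.
move=> mi; apply: measurable_funM => //.
exact: (measurable_kernel mi measurable_cosdot2).
Qed.

Lemma cosft_bnd m : integ mu m -> forall x,
  `|cosft m x| <= (2 * pi) ^- d * \int[mu]_z `|m z|.
Proof.
move=> mi x.
have p0 : 0 <= (2 * pi : R) ^- d.
  by rewrite invr_ge0 exprn_ge0// mulr_ge0// pi_ge0.
rewrite /cosft normrM (ger0_norm p0); apply: ler_wpM2l p0 _ _ _.
have := kernel_le mi measurable_cosdot2 (fun p => cos_bnd _) x.
by rewrite mul1r.
Qed.

(** Exchanging the integrals moves the Gaussian weight into the Fourier variable. This
    gives both the mass bound [cosft_mass] and the semigroup property [heat_semigroup]. *)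
Lemma cosft_gauss_weight m s x : integ mu m -> 0 < s ->
  \int[mu]_y (expR (- s * dotv y y) * cosft m (vsub x y)) =
  (2 * pi) ^- d * Num.sqrt (pi / s) ^+ d *
   \int[mu]_z (cos (dotv x z) * expR (- (dotv z z / (4 * s))) * m z).
Proof.
move=> mi s0.
pose k (p : Rvec R d * Rvec R d) := cos (dotv (vsub x p.1) p.2).
have mk : measurable_fun setT k.
  apply: (measurableT_comp measurable_cosdot2 (g := fun p => (vsub x p.1, p.2))).
  apply: measurable_fun_pair => //.
  exact: measurable_vsubT.
have sw := kernel_swap (integ_gaussd d s0) mi mk (fun p => cos_bnd _).
under eq_Rint => y do rewrite /cosft mulrCA.
rewrite RintegralZl//; last first.
  have := measurable_kernel mi mk.
  move=> mK; have := integM_bounded (integ_gaussd d s0) mK (kernel_le mi mk (fun p => cos_bnd _)).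
  by apply: eq_integrable => // y _ /=; rewrite mulrC.
rewrite -mulrA; congr (_ * _).
rewrite /k /= in sw; rewrite sw.
rewrite -RintegralZl//; last first.
  apply: (@integM_bounded _ _ _ _ _ _ 1) => //.
    apply: measurable_funM.
      by have := measurable_cosdot 0 x; under eq_fun do rewrite add0r.
    apply: measurableT_comp => //; apply: measurableT_comp => //.
    by apply: measurable_funM => //; exact: measurable_dotvT.
  move=> z; rewrite normrM [`|expR _|]ger0_norm ?expR_ge0//.
  apply: le_trans (ler_piMl (expR_ge0 _) (cos_bnd _)) _.
  rewrite -[leRHS]expR0 ler_expR lerNl oppr0.
  by rewrite divr_ge0 ?dotv_ge0// mulr_ge0// ltW.
apply: eq_Rint => z.
have := @gauss_fourier R d (- dotv x z) s z s0.
under eq_Rint => y.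
  rewrite (_ : cos (- dotv x z + dotv z y) = cos (dotv (vsub x y) z)); last first.
    by rewrite -cosN dotvBl (dotvC z y); congr cos; ring.
  over.
by move=> ->; rewrite cosN; ring.
Qed.

(** The integral of the kernel over R^d is formally m 0. Against a Gaussian weight in y it
    becomes an average of m, which is at most M; monotone convergence removes the weight. *)
Lemma cosft_mass m M : integ mu m -> (forall z, `|m z| <= M) ->
  (forall x, 0 <= cosft m x) -> forall x,
  (\int[mu]_y (cosft m (vsub x y))%:E <= M%:E)%E.
Proof.
move=> mi mM k0 x.
have mk : measurable_fun setT (fun y => cosft m (vsub x y)).
  by apply: measurableT_comp; [exact: measurable_cosft|exact: measurable_vsubT].
pose s (n : nat) : R := n.+1%:R^-1.
have s0 n : 0 < s n by rewrite invr_gt0.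
pose g n y := (expR (- s n * dotv y y) * cosft m (vsub x y))%:E.
have mg n : measurable_fun setT (g n).
  by apply/measurable_EFinP; apply: measurable_funM => //; exact: measurable_gaussd.
have gk y : setT y -> g n y @[n --> \oo] --> (cosft m (vsub x y))%:E.
  move=> _; apply: cvg_EFin; first exact: nearW.
  rewrite -[X in _ --> X]mul1r; apply: cvgM; last exact: cvg_cst.
  exact: cvg_expR_harmonic.
have ndg : forall y, setT y -> nondecreasing_seq (g ^~ y).
  move=> y _ a b ab; rewrite /g lee_fin ler_wpM2r// ler_expR !mulNr lerN2.
  by rewrite ler_wpM2r ?dotv_ge0// lef_pV2 ?posrE// ler_nat.
have g0 n y : setT y -> (0 <= g n y)%E.
  by move=> _; rewrite lee_fin mulr_ge0// expR_ge0.
have cv := @cvg_monotone_convergence _ _ _ mu _ measurableT _ mg g0 ndg.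
rewrite [X in (X <= _)%E](_ : _ = limn (fun n => \int[mu]_y g n y)%E); last first.
  rewrite (cvg_lim _ cv)//; apply: eq_integral => y _.
  by apply/esym/cvg_lim => //; exact: gk.
apply: lime_le; first by apply/cvg_ex; eexists; exact: cv.
apply: nearW => n.
have gi : integ mu (fun y => expR (- s n * dotv y y) * cosft m (vsub x y)).
  have := integM_bounded (integ_gaussd d (s0 n)) mk (fun y => cosft_bnd mi _).
  by apply: eq_integrable => // y _ /=; rewrite mulrC.
rewrite /g -RintE// lee_fin cosft_gauss_weight//.
have M0 : 0 <= M by apply: le_trans (mM x).
have s40 : 0 < (4 * s n)^-1 by rewrite invr_gt0 mulr_gt0.
have gi2 := integ_gaussd d s40.
(* the weight in the Fourier variable is a probability density *)
have -> : M = (2 * pi) ^- d * Num.sqrt (pi / s n) ^+ d * (M * Num.sqrt (pi / (4 * s n)^-1) ^+ d).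
  rewrite invrK [RHS]mulrCA -mulrA -!exprVn -!exprMn.
  rewrite -sqrtrM ?divr_ge0 ?pi_ge0 ?ltW//.
  rewrite (_ : pi / s n * (pi * (4 * s n)) = (2 * pi) ^+ 2); last first.
    by rewrite exprMn -natrX; field; rewrite gt_eqF.
  rewrite sqrtr_sqr ger0_norm ?mulr_ge0 ?pi_ge0// mulVf ?expr1n ?mulr1//.
  by rewrite mulf_neq0// gt_eqF// pi_gt0.
apply: ler_wpM2l.
  by rewrite mulr_ge0 ?exprn_ge0 ?sqrtr_ge0// invr_ge0 exprn_ge0// mulr_ge0 ?pi_ge0.
rewrite -Rint_gaussd// -RintegralZl//.
have b z : `|cos (dotv x z) * expR (- (dotv z z / (4 * s n))) * m z| <=
    M * expR (- (4 * s n)^-1 * dotv z z).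
  rewrite !normrM [`|expR _|]ger0_norm ?expR_ge0// mulrC ler_pM//.
  rewrite mulNr [(4 * s n)^-1 * _]mulrC.
  by rewrite ler_piMl ?expR_ge0 ?cos_bnd.
have ci : integ mu (fun z => cos (dotv x z) * expR (- (dotv z z / (4 * s n))) * m z).
  apply: integ_le b; last exact: integZ.
  apply: measurable_funM; last exact: integ_measurable mi.
  apply: measurable_funM.
    by have := measurable_cosdot 0 x; under eq_fun do rewrite add0r.
  apply: measurableT_comp => //; apply: measurableT_comp => //.
  by apply: measurable_funM => //; exact: measurable_dotvT.
apply: Rint_le => // [|z]; first exact: integZ.
exact: le_trans (ler_norm _) (b z).
Qed.

End fourier.

(** * Powers and the Gamma integral *)

Section powers.
Context {R : realType}.
Local Notation mu := (@lebesgue_measure R).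
Implicit Types (e u v a r lam : R).

(** The indicator of u > e as a real factor: all integrals are taken over the whole line, so
    that Fubini's theorem and dominated convergence apply uniformly. *)
Definition above e u : R := (e < u)%R%:R.

Lemma aboveE e : above e = \1_`]e, +oo[%classic.
Proof.
apply/funext => u; rewrite /above indicE; congr (nat_of_bool _)%:R.
by apply/idP/idP => [h|/set_mem]; [apply/mem_set|]; rewrite /= in_itv/= andbT.
Qed.

Lemma measurable_above e : measurable_fun setT (above e).
Proof. by rewrite aboveE; exact: measurable_indic. Qed.

Lemma above_ge0 e u : 0 <= above e u. Proof. exact: ler0n. Qed.

Lemma above_le1 e u : above e u <= 1.
Proof. by rewrite /above lern1 leq_b1. Qed.

Lemma integral_above e (f : R -> R) :
  (\int[mu]_u (above e u * f u)%:E = \int[mu]_(u in `]e, +oo[) (f u)%:E)%E.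
Proof.
rewrite [RHS]integral_mkcond; apply: eq_integral => u _.
rewrite /patch aboveE indicE; case: ifPn => _; first by rewrite mul1r.
by rewrite mul0r.
Qed.

Lemma Rintegral_above e (f : R -> R) :
  \int[mu]_u (above e u * f u) = \int[mu]_(u in `]e, +oo[) f u.
Proof. by rewrite /Rintegral integral_above. Qed.

(** Inversion is not continuous at 0, so it is written as a sign times a power of the
    absolute value. *)
Lemma measurable_invr : measurable_fun [set: R] (fun r : R => r^-1).
Proof.
have -> : (fun r : R => r^-1) = (fun r : R => (Num.sg r) * (`|r| `^ (-1))).
  apply/funext => r; rewrite powR_inv1//.
  have [->|r0] := eqVneq r 0; first by rewrite sgr0 invr0 mul0r.
  have [r1|r1] := ltP 0 r; first by rewrite gtr0_sg// mul1r gtr0_norm.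
  have r2 : r < 0 by rewrite lt_neqAle r0.
  by rewrite ltr0_sg// ltr0_norm// mulN1r invrN opprK.
apply: measurable_funM.
  have -> : @Num.sg R = (fun r => above 0 r - above 0 (- r)).
    apply/funext => r; rewrite /above oppr_gt0.
    have [r0|r0|->] := ltgtP r 0; [rewrite ltr0_sg//|rewrite gtr0_sg//|rewrite sgr0].
    + by rewrite sub0r.
    + by rewrite subr0.
    + by rewrite subr0.
  apply: measurable_funB; first exact: measurable_above.
  by apply: measurableT_comp; [exact: measurable_above|exact: measurable_funN].
by apply: (measurableT_comp (measurable_powR (-1))); exact: normr_measurable.
Qed.

Lemma powR_le1 u r : 0 < u <= 1 -> 0 <= r -> u `^ r <= 1.
Proof. by move=> u01 r0; rewrite -(powRr0 u) ger_powR. Qed.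

Lemma powR_ge1 u r : 0 < u <= 1 -> r <= 0 -> 1 <= u `^ r.
Proof. by move=> u01 r0; rewrite -(powRr0 u) ger_powR. Qed.

Lemma powRDp u a r : 0 < u -> u `^ (a + r) = u `^ a * u `^ r.
Proof. by move=> u0; rewrite powRD//; apply/implyP => _; rewrite gt_eqF. Qed.

Lemma powR_cvgy0 a : 0 < a -> u `^ (- a) @[u --> +oo] --> (0 : R).
Proof.
move=> a0; apply/cvgrPdist_le => /= e e0; near=> u.
have u0 : 0 < u by near: u; exact: nbhs_pinfty_gt.
rewrite sub0r normrN ger0_norm ?powR_ge0// powRN -[e]invrK.
rewrite lef_pV2 ?posrE ?invr_gt0// ?powR_gt0//.
have ue : e^-1 `^ a^-1 <= u by near: u; exact: nbhs_pinfty_ge.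
have := ge0_ler_powR (ltW a0) _ _ ue.
rewrite !nnegrE powR_ge0 (ltW u0) -powRrM mulVf ?gt_eqF// powRr1 ?invr_ge0 ?(ltW e0)//.
exact.
Unshelve. all: by end_near. Qed.

Lemma powR_continuous a v : 0 < v -> {for v, continuous (fun u : R => u `^ a)}.
Proof.
move=> v0; apply: differentiable_continuous; apply/derivable1_diffP.
by apply: derivable_powR; rewrite in_itv/= v0.
Qed.

Lemma integral_powR_tail a v : 0 < a -> 0 < v ->
  (\int[mu]_u (above v u * u `^ (- a - 1))%:E = (v `^ (- a) / a)%:E)%E.
Proof.
move=> a0 v0; rewrite integral_above.
have pu (u : R) : v <= u -> 0 < u by exact: lt_le_trans.
have dF (u : R) : v <= u -> is_derive u (1 : R) (fun u => - a^-1 * u `^ (- a)) (u `^ (- a - 1)).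
  move=> /pu u0; have d := is_derive1_powR (- a) u0; apply: is_derive_eq.
  by rewrite /GRing.scale/= mulrA mulrNN mulVf ?gt_eqF// mul1r.
rewrite integral_itv_obnd_cbnd; last first.
  by apply/measurable_EFinP/measurable_funTS; exact: measurable_powR.
rewrite (@ge0_continuous_FTC2y _ _ (fun u => - a^-1 * u `^ (- a)) v 0).
- by rewrite sub0e -EFinN mulNr opprK mulrC.
- by move=> u _; exact: powR_ge0.
- apply/continuous_within_itvcyP; split.
    by move=> u; rewrite in_itv/= andbT => vu; apply: powR_continuous; exact: lt_trans vu.
  by apply: cvg_at_right_filter; exact: powR_continuous.
- by rewrite -(mulr0 (- a^-1)); apply: cvgMr; exact: powR_cvgy0.
- by move=> u /ltW vu; have [] := dF u vu.
- apply: cvg_at_right_filter; apply: cvgMr; exact: powR_continuous.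
- move=> u; rewrite in_itv/= andbT => /ltW vu.
  by rewrite derive1E; have := dF u vu => ?; exact: derive_val.
Qed.

Lemma expR_bound (n : nat) u : 0 <= u -> u ^+ n <= n`!%:R * expR u.
Proof.
move=> u0; have f0 : 0 < n`!%:R :> R by rewrite ltr0n fact_gt0.
rewrite mulrC -ler_pdivrMr//.
case: n f0 => [|n] f0.
  by rewrite expr0 fact0 divr1 -expR0 ler_expR.
by apply: le_trans (expR_ge1Dxn n u0); rewrite lerDr.
Qed.

Definition gamma_fun r u : R := above 0 u * (u `^ (r - 1) * expR (- u)).

Lemma gamma_fun_ge0 r u : 0 <= gamma_fun r u.
Proof. by rewrite !mulr_ge0 ?above_ge0 ?powR_ge0 ?expR_ge0. Qed.

Lemma measurable_gamma_fun r : measurable_fun setT (gamma_fun r).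
Proof.
apply: measurable_funM; first exact: measurable_above.
apply: measurable_funM; first exact: measurable_powR.
by apply: measurableT_comp => //; exact: measurable_funN.
Qed.

(** The part of the Gamma integral near 0, where u^(r-1) may be unbounded. *)
Let near0 r u : R := above 0 u * (u <= 1)%R%:R * u `^ (r - 1).

Let near0E r (n : nat) u : near0 r u * above (n.+2%:R)^-1 u =
  ((fun u => u `^ (r - 1)) \_ `]n.+2%:R^-1, 1]) u.
Proof.
rewrite /patch; case: ifPn => [/set_mem|].
  rewrite /= in_itv/= => /andP[nu u1]; rewrite /near0 /above nu u1.
  by rewrite (lt_trans _ nu)// !mul1r mulr1.
rewrite notin_setE/= in_itv/= => /negP; rewrite negb_and => /orP[|].
  by rewrite /above => /negbTE ->; rewrite mulr0.
by rewrite /near0 => /negbTE ->; rewrite mulr0 !mul0r.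
Qed.

Let measurable_near0 r : measurable_fun setT (near0 r).
Proof.
apply: measurable_funM; last exact: measurable_powR.
apply: measurable_funM; first exact: measurable_above.
rewrite (_ : (fun u => _) = \1_`]-oo, 1]%classic); first exact: measurable_indic.
apply/funext => u; rewrite indicE; congr (nat_of_bool _)%:R.
by apply/idP/idP => [h|/set_mem]; [apply/mem_set|]; rewrite /= in_itv/=.
Qed.

Let near0_ge0 r u : 0 <= near0 r u.
Proof. by rewrite !mulr_ge0 ?powR_ge0 ?above_ge0. Qed.

(** The primitive u^r / r bounds the integral away from 0 uniformly in the cut. *)
Let near0_trunc r (n : nat) : 0 < r ->
  (\int[mu]_u (near0 r u * above (n.+2%:R)^-1 u)%:E <= (r^-1)%:E)%E.
Proof.
move=> r0; pose v : R := n.+2%:R^-1.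
have v0 : 0 < v by rewrite invr_gt0.
have v1 : v < 1 by rewrite invf_lt1// ltr1n.
have dF (u : R) : v <= u -> is_derive u (1 : R) (fun u => r^-1 * u `^ r) (u `^ (r - 1)).
  move=> /(lt_le_trans v0) u0; have d := is_derive1_powR r u0; apply: is_derive_eq.
  by rewrite /GRing.scale/= mulrA mulVf ?gt_eqF// mul1r.
have cF (u : R) : v <= u -> {for u, continuous (fun u => r^-1 * u `^ r)}.
  by move=> /(lt_le_trans v0) u0; apply: cvgMr; exact: powR_continuous.
under eq_integral => u _ do rewrite near0E.
rewrite -[X in (X <= _)%E]/(\int[mu]_u (EFin \o ((fun u : R => (u `^ (r - 1))%R) \_ `]v, 1%R])) u)%E.
rewrite -restrict_EFin -integral_mkcond integral_itv_obnd_cbnd; last first.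
  by apply/measurable_EFinP/measurable_funTS; exact: measurable_powR.
rewrite (@continuous_FTC2 _ _ (fun u => r^-1 * u `^ r) v 1)//.
- by rewrite powR1 mulr1 -EFinB lee_fin gerBl mulr_ge0 ?powR_ge0// invr_ge0 ltW.
- apply: derivable_within_continuous => u; rewrite in_itv/= => /andP[vu _].
  by apply: derivable_powR; rewrite in_itv/= andbT (lt_le_trans v0).
- split.
  + by move=> u; rewrite in_itv/= => /andP[/ltW vu _]; have [] := dF u vu.
  + by apply: cvg_at_right_filter; exact: cF.
  + by apply: cvg_at_left_filter; apply: cF; exact: ltW.
- move=> u; rewrite in_itv/= => /andP[/ltW vu _].
  by rewrite derive1E; have := dF u vu => ?; exact: derive_val.
Qed.

Let integ_near0 r : 0 < r -> integ mu (near0 r).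
Proof.
move=> r0; apply: ge0_integ; [exact: measurable_near0|exact: near0_ge0|].
pose g n u := (near0 r u * above (n.+2%:R)^-1 u)%:E.
have mg n : measurable_fun setT (g n).
  by apply/measurable_EFinP; apply: measurable_funM => //; exact: measurable_above.
have g0 n u : setT u -> (0 <= g n u)%E by move=> _; rewrite lee_fin mulr_ge0// above_ge0.
have ndg u : setT u -> nondecreasing_seq (g ^~ u).
  move=> _ m n mn; rewrite lee_fin ler_wpM2l// /above ler_nat.
  case: ltP => // mu0; rewrite (le_lt_trans _ mu0)// lef_pV2 ?posrE// ler_nat.
  by rewrite !ltnS.
have cv := @cvg_monotone_convergence _ _ _ mu _ measurableT _ mg g0 ndg.
rewrite (_ : (\int[mu]_u (near0 r u)%:E = \int[mu]_u limn (g ^~ u))%E); last first.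
  apply: eq_integral => u _; apply/esym/cvg_lim => //.
  apply: cvg_near_cst; near=> n; rewrite /g.
  have [u0|u0] := leP u 0; first by rewrite /near0 /above ltNge u0 !mul0r.
  rewrite /above (_ : _ < u) ?mulr1//.
  rewrite -[u]invrK ltf_pV2 ?posrE ?invr_gt0//.
  near: n; exists (Num.truncn u^-1) => // n /= un.
  by rewrite (lt_le_trans (truncnS_gt _))// ler_nat ltnS (leq_trans un).
rewrite -(cvg_lim _ cv)//.
apply: (@le_lt_trans _ _ (r^-1)%:E); last exact: ltry.
apply: lime_le; first by apply/cvg_ex; eexists; exact: cv.
by apply: nearW => n; exact: near0_trunc.
Unshelve. all: by end_near. Qed.

Lemma integ_gamma_fun r : 0 < r -> integ mu (gamma_fun r).
Proof.
move=> r0; pose n := (Num.truncn (r + 1)).+1.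
have it : integ mu (fun u => above 1 u * u `^ (- 1 - 1)).
  apply: ge0_integ.
  - by apply: measurable_funM; [exact: measurable_above|exact: measurable_powR].
  - by move=> u; rewrite mulr_ge0 ?above_ge0 ?powR_ge0.
  - by rewrite integral_powR_tail// ltry.
apply: (integ_le _ (integD (integ_near0 r0) (integZ n`!%:R it))).
  exact: measurable_gamma_fun.
move=> u; rewrite ger0_norm ?gamma_fun_ge0// /gamma_fun /near0.
have [u0|u0] := leP u 0.
  by rewrite {1}/above ltNge u0 !mul0r addr_ge0 // !mulr_ge0 ?above_ge0 ?powR_ge0.
have [u1|u1] := leP u 1.
  rewrite mulr1 [above 0 u]/above u0 !mul1r.
  apply: ler_wpDr; first by rewrite !mulr_ge0 ?above_ge0 ?powR_ge0.
  by rewrite ler_piMr ?powR_ge0// -expR0 ler_expR lerNl oppr0 ltW.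
rewrite /above u0 u1 !mulr0 !mul0r add0r !mul1r expRN ler_pdivrMr ?expR_gt0//.
rewrite -mulrA mulrCA.
have -> : u `^ (r - 1) = u `^ (- 1 - 1) * u `^ (r + 1).
  by rewrite -powRDp//; congr (_ `^ _); lra.
rewrite ler_wpM2l ?powR_ge0//; apply: le_trans (expR_bound n (ltW u0)).
rewrite -powR_mulrn ?(ltW u0)//; apply: ler_powR; first exact: ltW.
by rewrite ltW// truncnS_gt.
Qed.

Lemma GammaE r : 0 < r -> Gamma r = \int[mu]_u gamma_fun r u.
Proof.
by move=> r0; rewrite /Gamma r0 -Rintegral_above.
Qed.

(** The integral of a nonnegative function vanishes only if the function is 0 almost
    everywhere, and ]0, 1] has positive measure. *)
Lemma Rint_gt0 (f : R -> R) : integ mu f -> (forall u, 0 <= f u) ->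
  (forall u, 0 < u <= 1 -> 0 < f u) -> 0 < \int[mu]_u f u.
Proof.
move=> fi f0 fpos; rewrite lt_neqAle Rintegral_ge0 ?andbT//.
apply/negP => /eqP/esym I0.
have : (\int[mu]_u (f u)%:E = 0)%E by rewrite -(RintE fi) I0.
have -> : (\int[mu]_u (f u)%:E = \int[mu]_u `|(f u)%:E|)%E.
  by apply: eq_integral => u _; rewrite gee0_abs// lee_fin.
have mf : measurable_fun setT (EFin \o f).
  by apply/measurable_EFinP; exact: integ_measurable fi.
move=> /(ae_eq_integral_abs mu measurableT mf) [N [mN N0 sN]].
have : (mu `]0%R, 1%R]%classic <= mu N)%E.
  apply: le_measure; [by rewrite inE; exact: measurable_itv|by rewrite inE|].
  move=> u; rewrite /= in_itv/= => u01; apply: sN => /=.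
  by move=> /(_ I) [] /eqP; rewrite gt_eqF// fpos.
by rewrite lebesgue_measure_itv/= lte_fin ltr01 N0 sube0 lee_fin ler10.
Qed.

Lemma Gamma_gt0 r : 0 < r -> 0 < Gamma r.
Proof.
move=> r0; rewrite (GammaE r0); apply: Rint_gt0; first exact: integ_gamma_fun.
  exact: gamma_fun_ge0.
move=> u /andP[u0 _]; rewrite /gamma_fun /above u0 mul1r.
by rewrite mulr_gt0 ?powR_gt0 ?expR_gt0.
Qed.

Lemma gamma_scaled lam r u : 0 < lam ->
  above 0 u * (u `^ (r - 1) * expR (- (lam * u))) =
  lam `^ (1 - r) * gamma_fun r (lam * u + 0).
Proof.
move=> l0; rewrite addr0 /gamma_fun /above pmulr_rgt0//.
have [u0|u0] := leP u 0; first by rewrite !mul0r mulr0.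
rewrite !mul1r powRM ?ltW// !mulrA -powRDp//.
by rewrite (_ : 1 - r + _ = 0) ?powRr0 ?mul1r//; ring.
Qed.

Lemma integ_gamma_scaled lam r : 0 < lam -> 0 < r ->
  integ mu (fun u => above 0 u * (u `^ (r - 1) * expR (- (lam * u)))).
Proof.
move=> l0 r0; have := integZ (lam `^ (1 - r)) (integ_affine 0 l0 (integ_gamma_fun r0)).
by apply: eq_integrable => // u _; congr EFin; rewrite gamma_scaled.
Qed.

Lemma Rint_gamma_scaled lam r : 0 < lam -> 0 < r ->
  \int[mu]_u (above 0 u * (u `^ (r - 1) * expR (- (lam * u)))) = lam `^ (- r) * Gamma r.
Proof.
move=> l0 r0; under eq_Rint do rewrite gamma_scaled//.
rewrite RintegralZl//; last exact: integ_affine l0 (integ_gamma_fun r0).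
rewrite (Rint_affine 0 l0 (integ_gamma_fun r0)) -GammaE// mulrA.
rewrite -(powR_inv1 (ltW l0)) -powRDp//.
by congr (_ `^ _ * _); ring.
Qed.

End powers.

(** * The truncated Lévy measure of the stable subordinator *)

Section levy_weight.
Context {R : realType}.
Local Notation mu := (@lebesgue_measure R).
Variable a : R.
Hypotheses (a0 : 0 < a) (a1 : a < 1).

(** The constant of the Lévy measure of the a-stable subordinator. *)
Definition levy_cst : R := `|Gamma (- a)|^-1.

Lemma levy_cstE : levy_cst = a / Gamma (1 - a).
Proof.
have g0 : 0 < Gamma (1 - a) by rewrite Gamma_gt0// subr_gt0.
rewrite /levy_cst /Gamma oppr_gt0 ltNge (ltW a0)/= opprK.
rewrite (_ : Num.truncn a = 0%N); last first.
  by apply: truncn_def; rewrite (ltW a0) a1.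
rewrite big_ord1 addr0 (addrC (- a)).
move: g0; rewrite {1}/Gamma subr_gt0 a1 => g0.
rewrite normrM normfV normrN (gtr0_norm a0) gtr0_norm// invfM invrK mulrC.
by [].
Qed.

Lemma levy_cst_gt0 : 0 < levy_cst.
Proof. by rewrite levy_cstE divr_gt0// Gamma_gt0// subr_gt0. Qed.

(** The density of the Lévy measure of the a-stable subordinator, cut at e. *)
Definition wlevy (e u : R) : R := above e u * (levy_cst * u `^ (- a - 1)).

Lemma wlevy_ge0 e u : 0 <= wlevy e u.
Proof. by rewrite !mulr_ge0 ?above_ge0 ?powR_ge0 ?ltW ?levy_cst_gt0. Qed.

Lemma measurable_wlevy e : measurable_fun setT (wlevy e).
Proof.
apply: measurable_funM; first exact: measurable_above.
by apply: measurable_funM => //; exact: measurable_powR.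
Qed.

Lemma wlevy_le e e' u : e' <= e -> wlevy e u <= wlevy e' u.
Proof.
move=> ee; apply: ler_wpM2r; first by rewrite mulr_ge0 ?powR_ge0// ltW// levy_cst_gt0.
rewrite /above; case: (ltP e u) => [/(le_lt_trans ee) ->//|_]; exact: ler0n.
Qed.

Lemma wlevy0 e u : u <= e -> wlevy e u = 0.
Proof. by move=> ue; rewrite /wlevy /above ltNge ue mul0r. Qed.

Lemma integral_expR_head (lam u : R) : 0 < lam -> 0 < u ->
  (\int[mu]_v (above 0 v * (v < u)%R%:R * (lam * expR (- (lam * v))))%:E =
  (1 - expR (- (lam * u)))%:E)%E.
Proof.
move=> l0 u0.
have dF (v : R) : is_derive v (1 : R) (fun v => - expR (- (lam * v))) (lam * expR (- (lam * v))).
  by apply: is_derive_eq; rewrite /GRing.scale/=; ring.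
have cF : continuous (fun v : R => - expR (- (lam * v))).
  by move=> v; apply: differentiable_continuous; apply/derivable1_diffP; have [] := dF v.
transitivity (\int[mu]_(v in `[0%R, u]) (lam * expR (- (lam * v)))%:E)%E.
  rewrite -integral_itv_obnd_cbnd; last first.
    apply/measurable_EFinP/measurable_funTS; apply: measurable_funM => //.
    by apply: measurableT_comp => //; apply: measurable_funN; exact: measurable_funM.
  rewrite -integral_itv_bndo_bndc; last first.
    apply/measurable_EFinP/measurable_funTS; apply: measurable_funM => //.
    by apply: measurableT_comp => //; apply: measurable_funN; exact: measurable_funM.
  rewrite [RHS]integral_mkcond; apply: eq_integral => v _.
  rewrite /patch; case: ifPn => [/set_mem|].
    by rewrite /= in_itv/= /above => /andP[-> ->]; rewrite !mul1r.
  rewrite notin_setE/= in_itv/= => /negP; rewrite negb_and /above => /orP[|] /negbTE ->.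
    by rewrite !mul0r.
  by rewrite mulr0 mul0r.
rewrite (@continuous_FTC2 _ _ (fun v => - expR (- (lam * v))) 0 u)//.
- by rewrite mulr0 oppr0 expR0 -EFinB; congr EFin; ring.
- apply: continuous_subspaceT => v.
  apply: differentiable_continuous; apply/derivable1_diffP; apply: ex_derive.
- split; first by move=> v _; have [] := dF v.
    by apply: cvg_at_right_filter; exact: cF.
  by apply: cvg_at_left_filter; exact: cF.
- by move=> v _; rewrite derive1E; have := dF v => ?; exact: derive_val.
Qed.

(** Writing 1 - e^(-u lam) as the integral of lam e^(-v lam) over v < u and integrating in
    u first leaves a Gamma integral in v. *)
Lemma levy_khintchine_e (lam : R) : 0 < lam ->
  (\int[mu]_u (wlevy 0 u * (1 - expR (- (`|u| * lam))))%:E = (lam `^ a)%:E)%E.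
Proof.
move=> l0.
pose F (p : measurableTypeR R * measurableTypeR R) : \bar R :=
  (wlevy 0 p.1 * (above 0 p.2 * (p.2 < p.1)%R%:R * (lam * expR (- (lam * p.2)))))%:E.
have mlt : measurable_fun setT (fun p : measurableTypeR R * measurableTypeR R => (p.2 < p.1)%R%:R : R).
  have -> : (fun p : measurableTypeR R * measurableTypeR R => (p.2 < p.1)%R%:R : R) =
    (fun p => above 0 (p.1 - p.2)).
    by apply/funext => p; rewrite /above subr_gt0.
  apply: measurableT_comp; first exact: measurable_above.
  exact: measurable_funB.
have mF : measurable_fun setT F.
  apply/measurable_EFinP; apply: measurable_funM.
    by apply: measurableT_comp => //; exact: measurable_wlevy.
  apply: measurable_funM.
    by apply: measurable_funM => //; apply: measurableT_comp => //; exact: measurable_above.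
  apply: measurable_funM => //; apply: measurableT_comp => //.
  by apply: measurable_funN; apply: measurable_funM.
have F0 p : (0 <= F p)%E.
  rewrite lee_fin mulr_ge0 ?wlevy_ge0// !mulr_ge0 ?above_ge0 ?expR_ge0//.
  exact: ltW.
transitivity (\int[mu]_u \int[mu]_v F (u, v))%E.
  apply: eq_integral => u _.
  have [u0|u0] := leP u 0.
    rewrite wlevy0// mul0r; apply/esym; apply: integral0_eq => v _.
    by rewrite /F /= wlevy0// mul0r.
  rewrite /F /=; under [RHS]eq_integral do rewrite EFinM.
  rewrite ge0_integralZl//=.
  - by rewrite integral_expR_head// -EFinM gtr0_norm// (mulrC u).
  - apply/measurable_EFinP; apply: measurable_funM.
      apply: measurable_funM; first exact: measurable_above.
      exact: (measurable_section1 (u : measurableTypeR R) mlt).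
    apply: measurable_funM => //; apply: measurableT_comp => //.
    by apply: measurable_funN; apply: measurable_funM.
  - by move=> v _; rewrite lee_fin !mulr_ge0 ?above_ge0 ?expR_ge0 ?ltW.
  - by rewrite lee_fin wlevy_ge0.
rewrite fubini_tonelli//.
transitivity (\int[mu]_v ((lam * levy_cst / a)%:E *
  (above 0 v * (v `^ ((1 - a) - 1) * expR (- (lam * v))))%:E))%E.
  apply: eq_integral => v _.
  have [v0|v0] := leP v 0.
    rewrite /above ltNge v0 mul0r mule0; apply: integral0_eq => u _.
    by rewrite /F /above /= [(0 < v)%R]ltNge v0 !(mul0r,mulr0).
  transitivity (\int[mu]_u ((lam * expR (- (lam * v)) * levy_cst)%:E * (above v u * u `^ (- a - 1))%:E))%E.
    apply: eq_integral => u _; rewrite /F/= -EFinM; congr EFin.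
    rewrite /wlevy /above v0; case: (ltP v u) => [vu|_]; last by rewrite !(mul0r,mulr0).
    by rewrite (lt_trans v0 vu) !mul1r; ring.
  rewrite ge0_integralZl//=.
  - rewrite integral_powR_tail// -!EFinM; congr EFin.
    by rewrite /above v0 mul1r (_ : 1 - a - 1 = - a) ; ring.
  - apply/measurable_EFinP; apply: measurable_funM; first exact: measurable_above.
    exact: measurable_powR.
  - by move=> u _; rewrite lee_fin mulr_ge0 ?above_ge0 ?powR_ge0.
  - by rewrite lee_fin !mulr_ge0 ?expR_ge0 ?ltW ?levy_cst_gt0.
have b0 : 0 < 1 - a by rewrite subr_gt0.
rewrite ge0_integralZl//=.
- rewrite -RintE ?Rint_gamma_scaled//; last exact: integ_gamma_scaled.
  rewrite -EFinM levy_cstE; congr EFin.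
  have -> : lam `^ a = lam * lam `^ (- (1 - a)).
    rewrite -{2}(powRr1 (ltW l0)) -powRDp//; congr (_ `^ _); ring.
  by field; rewrite !gt_eqF// Gamma_gt0.
- apply/measurable_EFinP; apply: measurable_funM; first exact: measurable_above.
  apply: measurable_funM; first exact: measurable_powR.
  by apply: measurableT_comp => //; apply: measurable_funN; exact: measurable_funM.
- by move=> u _; rewrite lee_fin !mulr_ge0 ?above_ge0 ?powR_ge0 ?expR_ge0.
- by rewrite lee_fin !mulr_ge0 ?invr_ge0 ?(ltW l0) ?(ltW a0) ?(ltW levy_cst_gt0).
Qed.

(** The absolute value makes the function bounded on the whole line; it is paired with the
    weights [wlevy], which vanish for u <= 0. *)
Definition cexp (lam u : R) : R := expR (- (`|u| * lam)).

Lemma measurable_cexp lam : measurable_fun setT (cexp lam).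
Proof.
apply: measurableT_comp => //; apply: measurable_funN.
by apply: measurable_funM => //; exact: normr_measurable.
Qed.

Lemma cexp_ge0 lam u : 0 <= cexp lam u. Proof. exact: expR_ge0. Qed.

Lemma cexp_le1 lam u : 0 <= lam -> cexp lam u <= 1.
Proof. by move=> l0; rewrite -expR0 ler_expR lerNl oppr0 mulr_ge0. Qed.

Lemma wexp_ge0 e lam u : 0 <= lam -> 0 <= wlevy e u * (1 - cexp lam u).
Proof. by move=> l0; apply: mulr_ge0; rewrite ?wlevy_ge0// subr_ge0 cexp_le1. Qed.

Lemma wcexp_ge0 e lam u : 0 <= wlevy e u * cexp lam u.
Proof. by apply: mulr_ge0; rewrite ?wlevy_ge0// cexp_ge0. Qed.

Lemma integ_wlevy_exp e lam : 0 <= e -> 0 < lam ->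
  integ mu (fun u => wlevy e u * (1 - cexp lam u)).
Proof.
move=> e0 l0.
have m1 e' : measurable_fun setT (fun u => wlevy e' u * (1 - cexp lam u)).
  apply: measurable_funM; first exact: measurable_wlevy.
  by apply: measurable_funB => //; exact: measurable_cexp.
have i0 : integ mu (fun u => wlevy 0 u * (1 - cexp lam u)).
  apply: ge0_integ; first exact: m1.
    by move=> u; exact: wexp_ge0 (ltW l0).
  by rewrite levy_khintchine_e// ltry.
apply: (integ_le _ i0); first exact: m1.
move=> u; have c0 : 0 <= 1 - cexp lam u by rewrite subr_ge0 cexp_le1// ltW.
by rewrite (ger0_norm (wexp_ge0 e u (ltW l0))); apply: ler_wpM2r c0 _ _ _; exact: wlevy_le.
Qed.

(** For u > e the factor 1 - e^(-u) is bounded below, so the finite integral of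
    [levy_khintchine_e] controls the mass. *)
Lemma integ_wlevy e : 0 < e -> integ mu (wlevy e).
Proof.
move=> e0.
have c0 : 0 < 1 - cexp 1 e by rewrite subr_gt0 /cexp expR_lt1 mulr1 oppr_lt0 gtr0_norm.
apply: (integ_le _ (integZ (1 - cexp 1 e)^-1 (integ_wlevy_exp (lexx 0) ltr01))).
  exact: measurable_wlevy.
move=> u; rewrite (ger0_norm (wlevy_ge0 e u)).
have [ue|ue] := leP u e.
  by rewrite wlevy0// mulr_ge0 ?invr_ge0 ?(ltW c0)// wexp_ge0.
rewrite mulrCA -[leLHS]mulr1; apply: ler_pM; rewrite ?wlevy_ge0//.
  by apply: wlevy_le; exact: ltW.
rewrite mulrC ler_pdivlMr// mul1r lerD2l lerN2 ler_expR lerN2 !mulr1.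
by rewrite !gtr0_norm ?ltW// (lt_trans e0).
Qed.

(** Total mass, Laplace transform and Laplace exponent of the cut Lévy measure; the
    exponent is the difference of the other two ([SlevyE]) but stays finite at e = 0. *)
Definition Nlevy e : R := \int[mu]_u wlevy e u.
Definition Llevy e lam : R := \int[mu]_u (wlevy e u * cexp lam u).
Definition Slevy e lam : R := \int[mu]_u (wlevy e u * (1 - cexp lam u)).

Lemma integ_wlevy_cexp e lam : 0 < e -> 0 <= lam ->
  integ mu (fun u => wlevy e u * cexp lam u).
Proof.
move=> e0 l0; apply: (integ_le _ (integ_wlevy e0)).
  by apply: measurable_funM; [exact: measurable_wlevy|exact: measurable_cexp].
by move=> u; rewrite (ger0_norm (wcexp_ge0 e lam u)); apply: ler_piMr; [exact: wlevy_ge0|exact: cexp_le1].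
Qed.

Lemma SlevyE e lam : 0 < e -> 0 <= lam -> Slevy e lam = Nlevy e - Llevy e lam.
Proof.
move=> e0 l0; rewrite /Nlevy /Llevy -RintegralB//; last 2 first.
- exact: (integ_wlevy e0).
- exact: (integ_wlevy_cexp e0 l0).
by apply: eq_Rint => u; rewrite mulrBr mulr1.
Qed.

Lemma Slevy_le_pow e lam : 0 <= e -> 0 < lam -> Slevy e lam <= lam `^ a.
Proof.
move=> e0 l0; rewrite -lee_fin -levy_khintchine_e// -RintE; last first.
  exact: integ_wlevy_exp.
rewrite lee_fin; apply: Rint_le; try exact: integ_wlevy_exp.
move=> u; apply: ler_wpM2r; last exact: wlevy_le.
by rewrite subr_ge0 cexp_le1// ltW.
Qed.

Lemma Slevy_homo e lam lam' : 0 <= e -> 0 < lam -> lam <= lam' -> Slevy e lam <= Slevy e lam'.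
Proof.
move=> e0 l0 ll; have l0' := lt_le_trans l0 ll.
apply: Rint_le; try exact: integ_wlevy_exp.
move=> u; apply: ler_wpM2l; first exact: wlevy_ge0.
by rewrite lerD2l lerN2 ler_expR lerN2 ler_wpM2l.
Qed.

Lemma Slevy_ge0 e lam : 0 <= lam -> 0 <= Slevy e lam.
Proof.
move=> l0; apply: Rintegral_ge0 => u _.
by rewrite mulr_ge0 ?wlevy_ge0// subr_ge0 cexp_le1.
Qed.

Lemma Llevy_ge0 e lam : 0 <= Llevy e lam.
Proof. by apply: Rintegral_ge0 => u _; rewrite mulr_ge0 ?wlevy_ge0 ?cexp_ge0. Qed.

Lemma Nlevy_ge0 e : 0 <= Nlevy e.
Proof. by apply: Rintegral_ge0 => u _; exact: wlevy_ge0. Qed.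

Lemma Slevy_le_N e lam : 0 < e -> 0 <= lam -> Slevy e lam <= Nlevy e.
Proof. by move=> e0 l0; rewrite SlevyE// gerBl Llevy_ge0. Qed.

Lemma Llevy_le_N e lam : 0 < e -> 0 <= lam -> Llevy e lam <= Nlevy e.
Proof. by move=> e0 l0; rewrite -subr_ge0 -SlevyE// Slevy_ge0. Qed.

Definition epsn (n : nat) : R := n.+1%:R^-1.

Lemma epsn_gt0 n : 0 < epsn n. Proof. by rewrite invr_gt0. Qed.

Lemma epsn_ltE u : 0 < u -> \forall n \near \oo, epsn n < u.
Proof.
move=> u0; exists (Num.truncn u^-1) => // n /= un.
rewrite /epsn -[u]invrK ltf_pV2 ?posrE ?invr_gt0//.
by rewrite (lt_le_trans (truncnS_gt _))// ler_nat ltnS.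
Qed.

Lemma cvg_above_epsn u : above (epsn n) u @[n --> \oo] --> above 0 u.
Proof.
apply: cvg_near_cst.
have [u0|u0] := leP u 0.
  by apply: nearW => n; rewrite /above !ltNge u0 (le_trans u0)// ltW// epsn_gt0.
by apply: filterS (epsn_ltE u0) => n nu; rewrite /above nu u0.
Qed.

Lemma cvg_wlevy u : wlevy (epsn n) u @[n --> \oo] --> wlevy 0 u.
Proof. by apply: cvgMl; exact: cvg_above_epsn. Qed.

Lemma cvg_Slevy lam : 0 < lam -> Slevy (epsn n) lam @[n --> \oo] --> lam `^ a.
Proof.
move=> l0.
have -> : lam `^ a = Slevy 0 lam.
  by apply: EFin_inj; rewrite -levy_khintchine_e// RintE//; exact: integ_wlevy_exp.
have m1 e : measurable_fun setT (fun u => wlevy e u * (1 - cexp lam u)).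
  apply: measurable_funM; first exact: measurable_wlevy.
  by apply: measurable_funB => //; exact: measurable_cexp.
apply: (@Rint_dct _ _ _ mu (fun n u => wlevy (epsn n) u * (1 - cexp lam u)) _
  (fun u => wlevy 0 u * (1 - cexp lam u))).
- by move=> n; exact: m1.
- exact: m1.
- exact: integ_wlevy_exp.
- by move=> u; apply: cvgMl; exact: cvg_wlevy.
- move=> n u; have c0 : 0 <= 1 - cexp lam u by rewrite subr_ge0 cexp_le1// ltW.
  rewrite (ger0_norm (wexp_ge0 _ u (ltW l0))); apply: ler_wpM2r c0 _ _ _.
  by apply: wlevy_le; exact/ltW/epsn_gt0.
Qed.

End levy_weight.

(** * Positivity of the relativistic heat kernel *)

Section mixtures.
Context {R : realType} {d : nat}.
Local Notation mu1 := (@lebesgue_measure R).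
Local Notation mu := (leb R d).
Implicit Types (m : Rvec R d -> R) (x z : Rvec R d) (v : R -> R).

Definition sqnorm1 z : R := dotv z z + 1.

Lemma sqnorm1_ge1 z : 1 <= sqnorm1 z. Proof. by rewrite lerDr dotv_ge0. Qed.

Lemma sqnorm1_gt0 z : 0 < sqnorm1 z. Proof. exact: lt_le_trans (sqnorm1_ge1 z). Qed.

Lemma measurable_sqnorm1 : measurable_fun setT sqnorm1.
Proof. by apply: measurable_funD => //; exact: measurable_dotvT. Qed.

Lemma measurable_cexp_dot : measurable_fun setT
  (fun p : measurableTypeR R * Rvec R d => cexp (dotv p.2 p.2) p.1).
Proof.
apply: measurableT_comp => //; apply: measurable_funN; apply: measurable_funM.
  by apply: measurableT_comp => //; exact: normr_measurable.
exact: measurable_dotvT.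
Qed.

Lemma cexp_dot_bnd z (u : R) : `|cexp (dotv z z) u| <= 1.
Proof. by rewrite ger0_norm ?cexp_ge0// cexp_le1// dotv_ge0. Qed.

(** A Gaussian mixture of multipliers has the mixture of the kernels as its kernel. *)
Lemma cosft_mix v m x : integ mu1 v -> integ mu m ->
  cosft (fun z => (\int[mu1]_u (v u * cexp (dotv z z) u)) * m z) x =
  \int[mu1]_u (v u * cosft (fun z => cexp (dotv z z) u * m z) x).
Proof.
move=> vi mi; rewrite /cosft.
pose k (p : measurableTypeR R * Rvec R d) := cos (dotv x p.2) * cexp (dotv p.2 p.2) p.1.
have mcos : measurable_fun setT (fun p : measurableTypeR R * Rvec R d => cos (dotv x p.2)).
  apply: measurableT_comp; first by apply: continuous_measurable_fun; exact: continuous_cos.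
  exact: measurable_dotvT.
have mk : measurable_fun setT k.
  by apply: measurable_funM; [exact: mcos|exact: measurable_cexp_dot].
have k1 p : `|k p| <= 1.
  by rewrite normrM -[leRHS]mul1r ler_pM// ?cos_bnd// cexp_dot_bnd.
have sw := kernel_swap vi mi mk k1.
rewrite /k /= in sw.
transitivity ((2 * pi) ^- d * \int[mu]_y (m y *
  \int[mu1]_x0 (cos (dotv x y) * cexp (dotv y y) x0 * v x0))).
  congr (_ * _); apply: eq_Rint => z; rewrite mulrA mulrC; congr (_ * _).
  rewrite -RintegralZl//; last first.
    have := integM_bounded vi (measurable_cexp (dotv z z)) (fun u => cexp_dot_bnd z u).
    by apply: eq_integrable => // u _ /=; rewrite mulrC.
  by apply: eq_Rint => u; ring.
have ivk : integ mu1 (fun u => v u * \int[mu]_y (k (u, y) * m y)).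
  have := integM_bounded vi (measurable_kernel mi mk) (kernel_le mi mk k1).
  by apply: eq_integrable => // u _ /=; rewrite mulrC.
rewrite -sw -(RintegralZl _ measurableT ivk).
apply: eq_Rint => u; rewrite mulrCA; congr (_ * (_ * _)).
by apply: eq_Rint => z; rewrite mulrA.
Qed.

(** Multipliers whose kernel is nonnegative after Gaussian regularisation. The
    regularisation makes the kernel an absolutely convergent integral for every bounded
    multiplier, and it is compatible with pointwise limits and with multiplication by
    Gaussian mixtures. *)
Definition posdef_mult m := forall (s : R) x, 0 < s ->
  0 <= cosft (fun z => m z * expR (- s * dotv z z)) x.

Definition bounded_meas m := measurable_fun setT m /\ exists M, forall z, `|m z| <= M.

Lemma integ_bounded_meas m (s : R) : bounded_meas m -> 0 < s ->
  integ mu (fun z => m z * expR (- s * dotv z z)).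
Proof.
by move=> [mm [M mM]] s0; exact: integM_bounded (integ_gaussd d s0) mm mM.
Qed.

Lemma measurable_cosx x : measurable_fun setT (fun z => cos (dotv x z)).
Proof. by have := measurable_cosdot 0 x; under eq_fun do rewrite add0r. Qed.

Lemma cosft_dct (m_ : nat -> Rvec R d -> R) m g x :
  (forall n, measurable_fun setT (m_ n)) -> measurable_fun setT m ->
  integ mu g -> (forall z, m_ n z @[n --> \oo] --> m z) ->
  (forall n z, `|m_ n z| <= g z) ->
  cosft (m_ n) x @[n --> \oo] --> cosft m x.
Proof.
move=> mm_ mm gi cv b; apply: cvgMr.
have mc := measurable_cosx x.
apply: (@Rint_dct _ _ _ mu (fun n z => cos (dotv x z) * m_ n z) _ g) => //.
- by move=> n; exact: measurable_funM.
- exact: measurable_funM.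
- by move=> z; apply: cvgMr; exact: cv.
- move=> n z; rewrite normrM; apply: le_trans (b n z).
  by rewrite ler_piMl// cos_bnd.
Qed.

Lemma posdef_mult_cvg (m_ : nat -> Rvec R d -> R) m M :
  (forall n, measurable_fun setT (m_ n)) -> measurable_fun setT m ->
  (forall z, m_ n z @[n --> \oo] --> m z) ->
  (forall n z, `|m_ n z| <= M) -> (forall n, posdef_mult (m_ n)) -> posdef_mult m.
Proof.
move=> mm_ mm cv b P s x s0.
have mg := @measurable_gaussd R d s.
have h : cosft (fun z => m_ n z * expR (- s * dotv z z)) x @[n --> \oo] -->
    cosft (fun z => m z * expR (- s * dotv z z)) x.
  apply: (@cosft_dct _ _ (fun z => M * expR (- s * dotv z z))).
  - by move=> n; exact: measurable_funM.
  - exact: measurable_funM.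
  - exact/integZ/integ_gaussd.
  - by move=> z; apply: cvgMl; exact: cv.
  - move=> n z; rewrite normrM [`|expR _|]ger0_norm ?expR_ge0//.
    by rewrite ler_wpM2r ?expR_ge0.
apply: (cvgr_to_ge h); apply: nearW => n; exact: P.
Qed.

Lemma posmult1 : posdef_mult (cst 1).
Proof.
move=> s x s0; have -> : (fun z => cst 1 z * expR (- s * dotv z z)) =
  (fun z => expR (- s * dotv z z)) by apply/funext => z; rewrite mul1r.
by rewrite cosft_gauss// heat_ge0.
Qed.

(** Multiplying by e^(-u |z|^2) only increases the time of the regularisation. *)
Lemma posdef_mult_mix v m : integ mu1 v -> (forall u, 0 <= v u) -> bounded_meas m -> posdef_mult m ->
  posdef_mult (fun z => (\int[mu1]_u (v u * cexp (dotv z z) u)) * m z).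
Proof.
move=> vi v0 bm P s x s0.
have mi := integ_bounded_meas bm s0.
have -> : (fun z => (\int[mu1]_u (v u * cexp (dotv z z) u) * m z) * expR (- s * dotv z z)) =
  (fun z => \int[mu1]_u (v u * cexp (dotv z z) u) * (m z * expR (- s * dotv z z))).
  by apply/funext => z; rewrite mulrA.
rewrite cosft_mix//; apply: Rintegral_ge0 => u _; apply: mulr_ge0 => //.
have -> : (fun z => cexp (dotv z z) u * (m z * expR (- s * dotv z z))) =
  (fun z => m z * expR (- (`|u| + s) * dotv z z)).
  apply/funext => z; rewrite mulrCA -expRD; congr (_ * expR _); ring.
by apply: P; rewrite ltr_wpDl.
Qed.

Lemma cosftD m m' x : integ mu m -> integ mu m' ->
  cosft (fun z => m z + m' z) x = cosft m x + cosft m' x.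
Proof.
move=> mi mi'; rewrite /cosft -mulrDr; congr (_ * _).
have h n : integ mu n -> integ mu (fun z => cos (dotv x z) * n z).
  by move=> ni; apply: integM_bounded ni (measurable_cosx x) _ => z; exact: cos_bnd.
rewrite -RintegralD//; try exact: h.
by apply: eq_Rint => z; rewrite mulrDr.
Qed.

Lemma cosftZ m (c : R) x : integ mu m -> cosft (fun z => c * m z) x = c * cosft m x.
Proof.
move=> mi; rewrite /cosft mulrCA; congr (_ * _).
rewrite -RintegralZl//; last first.
  by apply: integM_bounded mi (measurable_cosx x) _ => z; exact: cos_bnd.
by apply: eq_Rint => z; rewrite mulrCA.
Qed.

Lemma posdef_multD m m' : bounded_meas m -> bounded_meas m' -> posdef_mult m -> posdef_mult m' ->
  posdef_mult (fun z => m z + m' z).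
Proof.
move=> bm bm' P P' s x s0.
under eq_fun do rewrite mulrDl.
by rewrite cosftD ?addr_ge0 ?P ?P'//; exact: integ_bounded_meas.
Qed.

Lemma posdef_multZ m (c : R) : 0 <= c -> bounded_meas m -> posdef_mult m ->
  posdef_mult (fun z => c * m z).
Proof.
move=> c0 bm P s x s0.
under eq_fun do rewrite -mulrA.
rewrite cosftZ; first by rewrite mulr_ge0// P.
exact: integ_bounded_meas.
Qed.

Lemma bounded_measM m m' : bounded_meas m -> bounded_meas m' -> bounded_meas (fun z => m z * m' z).
Proof.
move=> [mm [M mM]] [mm' [M' mM']]; split; first exact: measurable_funM.
by exists (M * M') => z; rewrite normrM ler_pM.
Qed.

Lemma bounded_measD m m' : bounded_meas m -> bounded_meas m' -> bounded_meas (fun z => m z + m' z).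
Proof.
move=> [mm [M mM]] [mm' [M' mM']]; split; first exact: measurable_funD.
by exists (M + M') => z; apply: le_trans (ler_normD _ _) _; exact: lerD.
Qed.

Lemma bounded_meas_cst c : bounded_meas (cst c).
Proof. by split => //; exists `|c| => z. Qed.

Section levy.
Variable a : R.
Hypotheses (a0 : 0 < a) (a1 : a < 1).

(** The Lévy measure cut at e and tempered by e^(-u), which accounts for the mass 1 in
    -Delta + 1. *)
Definition vlevy (e u : R) : R := wlevy a e u * cexp 1 u.

Lemma vlevy_ge0 e u : 0 <= vlevy e u.
Proof. exact: wcexp_ge0. Qed.

Lemma integ_vlevy e : 0 < e -> integ mu1 (vlevy e).
Proof. by move=> e0; exact: integ_wlevy_cexp. Qed.

(** The symbol of the convolution with the truncated Lévy density. *)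
Definition jump_symbol (e : R) z : R := Llevy a e (sqnorm1 z).

Lemma jump_symbolE e z : jump_symbol e z = \int[mu1]_u (vlevy e u * cexp (dotv z z) u).
Proof.
apply: eq_Rint => u; rewrite /vlevy -[RHS]mulrA; congr (_ * _).
by rewrite /cexp -expRD /sqnorm1; congr expR; ring.
Qed.

Lemma bounded_meas_jump_symbol e : 0 < e -> bounded_meas (jump_symbol e).
Proof.
move=> e0; split.
  have mk : measurable_fun setT (fun p : Rvec R d * measurableTypeR R => cexp (dotv p.1 p.1) p.2).
    have sw : measurable_fun setT (fun p : Rvec R d * measurableTypeR R => (p.2, p.1)).
      by apply: measurable_fun_pair.
    exact: (measurableT_comp measurable_cexp_dot sw).
  have := measurable_kernel (integ_vlevy e0) mk.
  rewrite (_ : (fun x => _) = jump_symbol e)//; apply/funext => z; rewrite jump_symbolE.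
  by apply: eq_Rint => u /=; rewrite mulrC.
exists (Nlevy a e) => z; rewrite ger0_norm ?Llevy_ge0//.
by apply: Llevy_le_N => //; exact/ltW/sqnorm1_gt0.
Qed.

Lemma bounded_meas_jump_symbolX e n : 0 < e -> bounded_meas (fun z => jump_symbol e z ^+ n).
Proof.
move=> e0; elim: n => [|n ih]; first exact: bounded_meas_cst.
under eq_fun do rewrite exprS.
by apply: bounded_measM => //; exact: bounded_meas_jump_symbol.
Qed.

Lemma posdef_mult_jump_symbolX e n : 0 < e -> posdef_mult (fun z => jump_symbol e z ^+ n).
Proof.
move=> e0; elim: n => [|n ih]; first exact: posmult1.
have -> : (fun z => jump_symbol e z ^+ n.+1) =
  (fun z => (\int[mu1]_u (vlevy e u * cexp (dotv z z) u)) * jump_symbol e z ^+ n).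
  by apply/funext => z; rewrite exprS jump_symbolE.
apply: posdef_mult_mix => //; [exact: integ_vlevy|exact: vlevy_ge0|exact: bounded_meas_jump_symbolX].
Qed.

(** Partial sums of e^(t L), where L is the symbol of the truncated jumps: each power of L
    is an iterated Gaussian mixture. *)
Definition expsum (t e : R) n z : R := series (exp_coeff (t * jump_symbol e z)) n.

Lemma expsumS t e n z : expsum t e n.+1 z = expsum t e n z + (n`!%:R^-1 * t ^+ n) * jump_symbol e z ^+ n.
Proof.
by rewrite /expsum /series/= big_nat_recr//= /exp_coeff/= exprMn; congr (_ + _); ring.
Qed.

Lemma expsum_pos t e n : 0 <= t -> 0 < e ->
  bounded_meas (expsum t e n) /\ posdef_mult (expsum t e n).
Proof.
move=> t0 e0; elim: n => [|n [ihb ihp]].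
  have -> : expsum t e 0 = cst 0 by apply/funext => z; rewrite /expsum /series/= big_geq.
  split; first exact: bounded_meas_cst.
  move=> s x s0; have -> : (fun z => cst 0 z * expR (- s * dotv z z)) = (fun z => 0 * expR (- s * dotv z z)) by [].
  by rewrite cosftZ ?mul0r//; exact: integ_gaussd.
have c0 : 0 <= n`!%:R^-1 * t ^+ n by rewrite mulr_ge0 ?exprn_ge0.
have -> : expsum t e n.+1 = (fun z => expsum t e n z + (n`!%:R^-1 * t ^+ n) * jump_symbol e z ^+ n).
  by apply/funext => z; exact: expsumS.
have b2 : bounded_meas (fun z => n`!%:R^-1 * t ^+ n * jump_symbol e z ^+ n).
  apply: bounded_measM; first exact: bounded_meas_cst.
  exact: bounded_meas_jump_symbolX.
split; first exact: bounded_measD.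
apply: posdef_multD => //; apply: posdef_multZ => //; first exact: bounded_meas_jump_symbolX.
exact: posdef_mult_jump_symbolX.
Qed.

Lemma cvg_expsum t e z : expsum t e n z @[n --> \oo] --> expR (t * jump_symbol e z).
Proof. by rewrite /expR; exact: is_cvg_series_exp_coeff. Qed.

Lemma expsum_le t e n z : 0 <= t -> 0 < e -> `|expsum t e n z| <= expR (t * Nlevy a e).
Proof.
move=> t0 e0.
have L0 : 0 <= t * jump_symbol e z by rewrite mulr_ge0// Llevy_ge0.
have nd : nondecreasing_seq (series (exp_coeff (t * jump_symbol e z))).
  apply: nondecreasing_series => k _ _; exact: exp_coeff_ge0.
rewrite ger0_norm; last by apply: sumr_ge0 => k _; exact: exp_coeff_ge0.
apply: le_trans (nondecreasing_cvgn_le nd (is_cvg_series_exp_coeff _) n) _.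
rewrite -/(expR _) ler_expR ler_wpM2l// Llevy_le_N//; exact/ltW/sqnorm1_gt0.
Qed.

(** The symbol of (-Delta + 1)^a. *)
Definition rsymbol z : R := sqnorm1 z `^ a.

Lemma measurable_rsymbol : measurable_fun setT rsymbol.
Proof. exact: (measurableT_comp (measurable_powR a) measurable_sqnorm1). Qed.

Lemma rsymbol_ge1 z : 1 <= rsymbol z.
Proof.
have -> : 1 = 1 `^ a by rewrite powR1.
apply: ge0_ler_powR; rewrite ?nnegrE ?(ltW a0)//.
  exact/ltW/sqnorm1_gt0.
exact: sqnorm1_ge1.
Qed.

Definition rsymbol_exp (t : R) z : R := expR (- t * rsymbol z).

Lemma measurable_rsymbol_exp t : measurable_fun setT (rsymbol_exp t).
Proof.
by apply: measurableT_comp => //; apply: measurable_funM => //; exact: measurable_rsymbol.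
Qed.

Lemma rsymbol_exp_le1 t z : 0 <= t -> `|rsymbol_exp t z| <= 1.
Proof.
move=> t0; rewrite ger0_norm ?expR_ge0// -expR0 ler_expR mulNr lerNl oppr0.
by rewrite mulr_ge0// (le_trans _ (rsymbol_ge1 z)).
Qed.

(** The multiplier is the limit for e -> 0 of e^(-t N) e^(t L), the semigroup of a compound
    Poisson process, whose exponential series has positive terms. *)
Lemma posdef_mult_rsymbol_exp t : 0 <= t -> posdef_mult (rsymbol_exp t).
Proof.
move=> t0.
have mS e : 0 < e -> measurable_fun setT (fun z => expR (- t * Slevy a e (sqnorm1 z))).
  move=> e0; apply: measurableT_comp => //; apply: measurable_funM => //.
  rewrite (_ : (fun z => _) = (fun z => Nlevy a e - jump_symbol e z)).
    by apply: measurable_funB => //; have [] := bounded_meas_jump_symbol e0.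
  by apply/funext => z; rewrite SlevyE//; exact/ltW/sqnorm1_gt0.
apply: (@posdef_mult_cvg (fun n z => expR (- t * Slevy a (epsn n) (sqnorm1 z))) _ 1).
- by move=> n; apply: mS; exact: epsn_gt0.
- exact: measurable_rsymbol_exp.
- move=> z; apply: continuous_cvg; first exact: continuous_expR.
  by apply: cvgMr; apply: cvg_Slevy => //; exact: sqnorm1_gt0.
- move=> n z; rewrite ger0_norm ?expR_ge0// -expR0 ler_expR mulNr lerNl oppr0.
  by rewrite mulr_ge0// Slevy_ge0//; exact/ltW/sqnorm1_gt0.
move=> n; have e0 := @epsn_gt0 R n.
rewrite (_ : (fun z => _) = (fun z => expR (- t * Nlevy a (epsn n)) * expR (t * jump_symbol (epsn n) z))); last first.
  apply/funext => z; rewrite -expRD SlevyE//; last exact/ltW/sqnorm1_gt0.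
  by rewrite /jump_symbol; congr expR; ring.
have mE : measurable_fun setT (fun z => expR (t * jump_symbol (epsn n) z)).
  by apply: measurableT_comp => //; apply: measurable_funM => //; have [] := bounded_meas_jump_symbol e0.
apply: posdef_multZ; first exact: expR_ge0.
  split => //; exists (expR (t * Nlevy a (epsn n))) => z.
  rewrite ger0_norm ?expR_ge0// ler_expR ler_wpM2l// Llevy_le_N//; exact/ltW/sqnorm1_gt0.
apply: (@posdef_mult_cvg (expsum t (epsn n)) _ (expR (t * Nlevy a (epsn n)))) => //.
- by move=> k; have [[]] := expsum_pos k t0 e0.
- by move=> z; exact: cvg_expsum.
- by move=> k z; exact: expsum_le.
- by move=> k; have [] := expsum_pos k t0 e0.
Qed.

End levy.

(** The power is a Gamma mixture of Gaussians e^(-u |z|^2), whose integrals in z are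
    (pi/u)^(d/2); the exponent d + 1 makes the remaining integral in u converge. *)
Lemma integ_sqnorm1_inv : integ mu (fun z => sqnorm1 z `^ (- d.+1%:R)).
Proof.
have d0 : 0 < d.+1%:R :> R by [].
pose F (p : Rvec R d * measurableTypeR R) : \bar R :=
  (gamma_fun d.+1%:R p.2 * cexp (dotv p.1 p.1) p.2)%:E.
have mk : measurable_fun setT (fun p : Rvec R d * measurableTypeR R => cexp (dotv p.1 p.1) p.2).
  have sw : measurable_fun setT (fun p : Rvec R d * measurableTypeR R => (p.2, p.1)).
    by apply: measurable_fun_pair.
  exact: (measurableT_comp measurable_cexp_dot sw).
have mF : measurable_fun setT F.
  apply/measurable_EFinP; apply: measurable_funM => //.
  by apply: measurableT_comp => //; exact: measurable_gamma_fun.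
have F0 p : (0 <= F p)%E by rewrite lee_fin mulr_ge0 ?gamma_fun_ge0 ?cexp_ge0.
have FE z : (\int[mu1]_u F (z, u) = (sqnorm1 z `^ (- d.+1%:R) * Gamma d.+1%:R)%:E)%E.
  have l0 := sqnorm1_gt0 z.
  rewrite -Rint_gamma_scaled// RintE; last exact: integ_gamma_scaled.
  apply: eq_integral => u _; rewrite /F/= /gamma_fun; congr EFin.
  rewrite /above; case: ltP => u0; last by rewrite !mul0r.
  by rewrite !mul1r -mulrA -expRD gtr0_norm// /sqnorm1; congr (_ * expR _); ring.
have fin : (\int[mu]_z (sqnorm1 z `^ (- d.+1%:R) * Gamma d.+1%:R)%:E < +oo)%E.
  under eq_integral do rewrite -FE.
  rewrite fubini_tonelli//.
  pose c : R := Num.sqrt pi ^+ d.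
  have c0 : 0 <= c by rewrite exprn_ge0// sqrtr_ge0.
  have gi : integ mu1 (fun u => c * (gamma_fun d.+1%:R u + gamma_fun 1 u)).
    by apply: integZ; apply: integD; exact: integ_gamma_fun.
  apply: le_lt_trans (_ : \int[mu1]_u (c * (gamma_fun d.+1%:R u + gamma_fun 1 u))%:E < +oo)%E; last first.
    by rewrite -RintE// ltry.
  apply: ge0_le_integral => //.
  - by move=> u _; apply: integral_ge0.
  - exact: measurable_fun_fubini_tonelli_G.
  - by apply/measurable_EFinP; exact: integ_measurable gi.
  move=> u _.
  have [u0|u0] := leP u 0.
    rewrite integral0_eq; last by move=> z _; rewrite /F/= /gamma_fun /above ltNge u0 !mul0r.
    by rewrite lee_fin mulr_ge0// addr_ge0// gamma_fun_ge0.
  rewrite /F/=; under eq_integral do rewrite EFinM.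
  rewrite ge0_integralZl//; last 3 first.
  - by apply/measurable_EFinP; exact: (measurable_section2 (u : measurableTypeR R) mk).
  - by move=> z _; rewrite lee_fin cexp_ge0.
  - by rewrite lee_fin gamma_fun_ge0.
  have -> : (\int[mu]_z (cexp (dotv z z) u)%:E = (Num.sqrt (pi / u) ^+ d)%:E)%E.
    rewrite -Rint_gaussd// RintE; last exact: integ_gaussd.
    by apply: eq_integral => z _; rewrite /cexp gtr0_norm// mulNr.
  rewrite -EFinM lee_fin sqrtrM ?pi_ge0// exprMn mulrCA ler_wpM2l// -/c.
  rewrite sqrtrV ?(ltW u0)//; set y := (Num.sqrt u)^-1.
  (* bounding u^(-d/2) by integral powers of 1 / u leads to two Gamma integrals *)
  have yy : y ^+ d <= 1 + u ^- d.
    have -> : u ^- d = (y ^+ d) ^+ 2.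
      by rewrite -exprM mulnC exprM /y exprVn sqr_sqrtr ?(ltW u0)// exprVn.
    set w := y ^+ d; nra.
  apply: le_trans (ler_wpM2l (gamma_fun_ge0 _ _) yy) _.
  rewrite mulrDr mulr1 lerD2l /gamma_fun /above u0 !mul1r.
  rewrite (_ : d.+1%:R - 1 = d%:R :> R); last by rewrite -natr1 addrK.
  by rewrite subrr powRr0 mul1r powR_mulrn ?(ltW u0)// mulrC mulrA mulVf ?mul1r// expf_neq0// gt_eqF.
have G0 := Gamma_gt0 d0.
have ml : measurable_fun setT (fun z => sqnorm1 z `^ (- d.+1%:R) * Gamma d.+1%:R).
  apply: measurable_funM => //.
  exact: (measurableT_comp (measurable_powR _) measurable_sqnorm1).
have gi : integ mu (fun z => sqnorm1 z `^ (- d.+1%:R) * Gamma d.+1%:R).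
  by apply: ge0_integ => // z; rewrite mulr_ge0 ?powR_ge0// ltW.
have := integZ (Gamma d.+1%:R)^-1 gi.
apply: eq_integrable => // z _ /=; congr EFin.
by rewrite mulrCA mulVf ?mulr1// gt_eqF.
Qed.

Section heat_kernel.
Variable a : R.
Hypotheses (a0 : 0 < a) (a1 : a < 1).

Lemma integ_rsymbol_exp t : 0 < t -> integ mu (rsymbol_exp a t).
Proof.
(* e^y >= y^n / n! at y = t lam^a, where n a > d + 1 *)
move=> t0; pose n := (Num.truncn (d.+1%:R / a)).+1.
apply: (integ_le _ (integZ (n`!%:R * t ^- n) integ_sqnorm1_inv)); first exact: measurable_rsymbol_exp.
move=> z; rewrite ger0_norm ?expR_ge0// /rsymbol_exp mulNr expRN.
have l0 := sqnorm1_gt0 z; have p0 : 0 < rsymbol a z by exact: powR_gt0.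
have := expR_bound n (ltW (mulr_gt0 t0 p0)).
rewrite exprMn => h.
have pn : sqnorm1 z `^ d.+1%:R <= rsymbol a z ^+ n.
  rewrite -powR_mulrn ?(ltW p0)// -powRrM; apply: ler_powR; first exact: sqnorm1_ge1.
  rewrite mulrC -ler_pdivrMr//; apply: ltW; exact: truncnS_gt.
rewrite powRN ler_pdivlMr ?powR_gt0// mulrC ler_pdivrMr ?expR_gt0//.
rewrite mulrAC ler_pdivlMr ?exprn_gt0// mulrC.
by apply: le_trans h; rewrite ler_wpM2l// exprn_ge0// ltW.
Qed.

(** The heat kernel of (-Delta + 1)^a as a function of the difference of the points. *)
Definition rheat t : Rvec R d -> R := cosft (rsymbol_exp a t).

Lemma cvg_cosft_smooth m : integ mu m -> forall x,
  cosft (fun z => m z * expR (- n.+1%:R^-1 * dotv z z)) x @[n --> \oo] --> cosft m x.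
Proof.
move=> mi x; have mm := integ_measurable mi.
apply: (@cosft_dct _ _ (fun z => `|m z|)).
- by move=> n; apply: measurable_funM => //; exact: measurable_gaussd.
- by [].
- exact: integrable_norm.
- by move=> z; rewrite -[X in _ --> X]mulr1; apply: cvgMr; exact: cvg_expR_harmonic.
- move=> n z; rewrite normrM ler_piMr// ger0_norm ?expR_ge0//.
  by rewrite -expR0 ler_expR mulNr lerNl oppr0 mulr_ge0// dotv_ge0.
Qed.

Lemma rheat_ge0 t x : 0 < t -> 0 <= rheat t x.
Proof.
move=> t0; have h := cvg_cosft_smooth (x := x) (integ_rsymbol_exp t0).
rewrite /rheat; apply: (cvgr_to_ge h).
by apply: nearW => n; apply: posdef_mult_rsymbol_exp => //; exact: ltW.
Qed.

Lemma rheat_mass t x : 0 < t -> (\int[mu]_y (rheat t (vsub x y))%:E <= 1)%E.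
Proof.
move=> t0; apply: cosft_mass; first exact: integ_rsymbol_exp.
  by move=> z; apply: rsymbol_exp_le1 => //; exact: ltW.
by move=> y; exact: rheat_ge0.
Qed.

Lemma measurable_rheat t : 0 < t -> measurable_fun setT (rheat t).
Proof. by move=> t0; apply: measurable_cosft; exact: integ_rsymbol_exp. Qed.

End heat_kernel.
End mixtures.

(** * Quadratic forms of convolution kernels *)

Section measurable_integral.
Context d1 d2 (X : measurableType d1) (Y : measurableType d2) (R : realType).
Variable (nu : {sigma_finite_measure set Y -> \bar R}).

Lemma measurable_Rint1 (F : X * Y -> R) : measurable_fun setT F ->
  measurable_fun setT (fun x => \int[nu]_y F (x, y)).
Proof.
move=> mF0; pose F' := EFin \o F.
have mF : measurable_fun setT F' by exact/measurable_EFinP.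
apply: (measurableT_comp (fine_measurable measurableT)).
rewrite [X in measurable_fun _ X](_ : _ =
  ((fun x => \int[nu]_y F'^\+ (x, y)) \- (fun x => \int[nu]_y F'^\- (x, y)))%E).
  apply: emeasurable_funB.
    by apply: measurable_fun_fubini_tonelli_F => //; exact: measurable_funepos.
  by apply: measurable_fun_fubini_tonelli_F => //; exact: measurable_funeneg.
apply/funext => x.
by rewrite -[LHS]/(\int[nu]_y (F' \o pair x) y)%E integralE funepos_comp funeneg_comp.
Qed.

End measurable_integral.

Section quadratic_form.
Context {R : realType} {d : nat}.
Local Notation mu1 := (@lebesgue_measure R).
Local Notation mu := (leb R d).
Local Notation mu2 := (leb R d \x leb R d)%E.
Implicit Types (K f : Rvec R d -> R) (x y z : Rvec R d).

(** Symmetric nonnegative convolution kernels of mass at most M, for which the form is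
    bounded on L^2. *)
Definition conv_kernel K (M : R) := [/\ measurable_fun setT K, (forall x, 0 <= K x),
  (forall x y, K (vsub x y) = K (vsub y x)) &
  (forall x, (\int[mu]_y (K (vsub x y))%:E <= M%:E)%E)].

Definition qform K f : R := \int[mu2]_p (K (vsub p.1 p.2) * (f p.1 * f p.2)).

Lemma measurable_Kdiff K : measurable_fun setT K ->
  measurable_fun setT (fun p : Rvec R d * Rvec R d => K (vsub p.1 p.2)).
Proof. by move=> mK; apply: measurableT_comp mK _; exact: measurable_vsubT. Qed.

Section good.
Variables (K : Rvec R d -> R) (M : R) (f : Rvec R d -> R).
Hypotheses (gK : conv_kernel K M) (mf : measurable_fun setT f)
  (f2 : integ mu (fun x => f x ^+ 2)).

Let mK : measurable_fun setT K. Proof. by case: gK. Qed.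
Let K0 x : 0 <= K x. Proof. by case: gK. Qed.

Let mf1 : measurable_fun setT (fun p : Rvec R d * Rvec R d => f p.1).
Proof. exact: measurableT_comp mf _. Qed.

Let mf2 : measurable_fun setT (fun p : Rvec R d * Rvec R d => f p.2).
Proof. exact: measurableT_comp mf _. Qed.

(** Integrating first in y only sees the mass of the kernel. *)
Lemma conv_kernel_sq1 : (\int[mu2]_p (K (vsub p.1 p.2) * f p.1 ^+ 2)%:E <=
  M%:E * (\int[mu]_x f x ^+ 2)%:E)%E.
Proof.
have mF : measurable_fun setT (fun p : Rvec R d * Rvec R d => (K (vsub p.1 p.2) * f p.1 ^+ 2)%:E).
  apply/measurable_EFinP; apply: measurable_funM; first exact: measurable_Kdiff.
  exact: measurable_funX.
have F0 (p : Rvec R d * Rvec R d) : (0 <= (K (vsub p.1 p.2) * f p.1 ^+ 2)%:E)%E.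
  by rewrite lee_fin mulr_ge0// sqr_ge0.
have M0 : 0 <= M.
  case: gK => _ _ _ /(_ [tuple 0 | i < d]); rewrite -lee_fin; apply: le_trans.
  by apply: integral_ge0 => y _; rewrite lee_fin; exact: K0.
have mff := measurable_funX 2 mf.
have ff0 x : 0 <= f x ^+ 2 by exact: sqr_ge0.
rewrite (fubini_tonelli1 _ mF F0) (RintE f2) -(ge0_intZl mu mff ff0 M0).
apply: ge0_le_int.
- by move=> x; apply: integral_ge0 => y _; exact: (F0 (x, y)).
- exact: (measurable_fun_fubini_tonelli_F _ mF F0).
- by apply/measurable_EFinP; apply: measurable_funM; [exact: measurable_cst|exact: mff].
move=> x; rewrite /fubini_F.
have -> : (\int[mu]_y (K (vsub (x, y).1 (x, y).2) * f (x, y).1 ^+ 2)%:E =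
   \int[mu]_y (f x ^+ 2 * K (vsub x y))%:E)%E.
  by apply: eq_integral => y _; rewrite mulrC.
rewrite (ge0_intZl mu (measurable_section1 x (measurable_Kdiff mK)) (fun y => K0 _) (ff0 x)).
rewrite [(M * _)%:E]EFinM [leLHS]muleC; apply: lee_wpmul2r; first by rewrite lee_fin.
have [_ _ _ h] := gK; exact: h.
Qed.

Let integ_sq1 : integ mu2 (fun p => K (vsub p.1 p.2) * f p.1 ^+ 2).
Proof.
apply: ge0_integ.
- apply: measurable_funM; first exact: measurable_Kdiff.
  exact: measurable_funX.
- by move=> p; rewrite mulr_ge0// sqr_ge0.
- by apply: le_lt_trans conv_kernel_sq1 _; rewrite -EFinM ltry.
Qed.

Let sq2E : (\int[mu2]_p (K (vsub p.1 p.2) * f p.2 ^+ 2)%:E =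
   \int[mu2]_p (K (vsub p.1 p.2) * f p.1 ^+ 2)%:E)%E.
Proof.
have m1 : measurable_fun setT (fun p : Rvec R d * Rvec R d => (K (vsub p.1 p.2) * f p.1 ^+ 2)%:E).
  apply/measurable_EFinP; apply: measurable_funM; first exact: measurable_Kdiff.
  exact: measurable_funX.
have m2 : measurable_fun setT (fun p : Rvec R d * Rvec R d => (K (vsub p.1 p.2) * f p.2 ^+ 2)%:E).
  apply/measurable_EFinP; apply: measurable_funM; first exact: measurable_Kdiff.
  exact: measurable_funX.
have n1 (p : Rvec R d * Rvec R d) : (0 <= (K (vsub p.1 p.2) * f p.1 ^+ 2)%:E)%E.
  by rewrite lee_fin; apply: mulr_ge0; [exact: K0|exact: sqr_ge0].
have n2 (p : Rvec R d * Rvec R d) : (0 <= (K (vsub p.1 p.2) * f p.2 ^+ 2)%:E)%E.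
  by rewrite lee_fin; apply: mulr_ge0; [exact: K0|exact: sqr_ge0].
rewrite (fubini_tonelli2 _ m2 n2) (fubini_tonelli1 _ m1 n1).
apply: eq_integral => x _; apply: eq_integral => y _ /=.
by case: gK => _ _ -> _.
Qed.

Let integ_sq2 : integ mu2 (fun p => K (vsub p.1 p.2) * f p.2 ^+ 2).
Proof.
apply: ge0_integ.
- apply: measurable_funM; first exact: measurable_Kdiff.
  exact: measurable_funX.
- by move=> p; rewrite mulr_ge0// sqr_ge0.
- by rewrite sq2E; apply: le_lt_trans conv_kernel_sq1 _; rewrite -EFinM ltry.
Qed.

Let dom p := 2^-1 * (K (vsub p.1 p.2) * f p.1 ^+ 2 + K (vsub p.1 p.2) * f p.2 ^+ 2).

Let integ_dom : integ mu2 dom.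
Proof. by apply: integZ; apply: integD. Qed.

Let dom_bnd p : `|K (vsub p.1 p.2) * (f p.1 * f p.2)| <= dom p.
Proof.
rewrite normrM (ger0_norm (K0 _)) /dom -mulrDr mulrCA ler_wpM2l//.
rewrite normrM; have := sqr_ge0 (`|f p.1| - `|f p.2|).
rewrite -[f p.1 ^+ 2]real_normK ?num_real// -[f p.2 ^+ 2]real_normK ?num_real//.
by nra.
Qed.

Let mQ : measurable_fun setT (fun p : Rvec R d * Rvec R d => K (vsub p.1 p.2) * (f p.1 * f p.2)).
Proof. by apply: measurable_funM; [exact: measurable_Kdiff|exact: measurable_funM]. Qed.

Lemma integ_qform : integ mu2 (fun p => K (vsub p.1 p.2) * (f p.1 * f p.2)).
Proof. exact: (integ_le mQ integ_dom dom_bnd). Qed.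

Lemma Rint_qform_sq2 : \int[mu2]_p (K (vsub p.1 p.2) * f p.2 ^+ 2) =
  \int[mu2]_p (K (vsub p.1 p.2) * f p.1 ^+ 2).
Proof. by rewrite /Rintegral sq2E. Qed.

Lemma qform_le : qform K f <= M * \int[mu]_x f x ^+ 2.
Proof.
have h : \int[mu2]_p (K (vsub p.1 p.2) * f p.1 ^+ 2) <= M * \int[mu]_x f x ^+ 2.
  by rewrite -lee_fin EFinM RintE//; exact: conv_kernel_sq1.
apply: le_trans (_ : \int[mu2]_p dom p <= _).
  apply: Rint_le => //; first exact: integ_qform.
  by move=> p; exact: le_trans (ler_norm _) (dom_bnd p).
rewrite /dom RintegralZl//; last exact: integD.
rewrite RintegralD// Rint_qform_sq2.
apply: le_trans h; rewrite -[X in _ <= X]mul1r; lra.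
Qed.

(** By Chebyshev's inequality, cutting off the small values makes a square-integrable
    function integrable; forms of integrable functions can be computed by Fourier
    transform. *)
Definition ftrunc (n : nat) x : R := above (epsn n) `|f x| * f x.

Lemma measurable_ftrunc n : measurable_fun setT (ftrunc n).
Proof.
apply: measurable_funM => //.
apply: measurableT_comp; first exact: measurable_above.
exact: measurableT_comp.
Qed.

Lemma ftrunc_le n x : `|ftrunc n x| <= `|f x|.
Proof. by rewrite normrM ler_piMl// ger0_norm ?above_ge0 ?above_le1. Qed.

Lemma integ_ftrunc2 n : integ mu (fun x => ftrunc n x ^+ 2).
Proof.
apply: (integ_le _ f2); first by apply: measurable_funX; exact: measurable_ftrunc.
move=> x; rewrite normrX -[f x ^+ 2]real_normK ?num_real//.
by rewrite lerXn2r ?nnegrE// ftrunc_le.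
Qed.

Lemma integ_ftrunc n : integ mu (ftrunc n).
Proof.
apply: (integ_le (measurable_ftrunc n) (integZ (epsn n)^-1 f2)) => x.
rewrite /ftrunc /above; case: ltP => h; last first.
  by rewrite mul0r normr0 mulr_ge0 ?sqr_ge0// invr_ge0 ltW// epsn_gt0.
rewrite mul1r ler_pdivlMl ?epsn_gt0// -[f x ^+ 2]real_normK ?num_real// expr2.
by rewrite ler_wpM2r// ltW.
Qed.

Lemma cvg_ftrunc x : ftrunc n x @[n --> \oo] --> f x.
Proof.
have [fx|fx] := eqVneq (f x) 0.
  by rewrite /ftrunc fx; apply: cvg_near_cst; apply: nearW => n; rewrite mulr0.
rewrite -[X in _ --> X]mul1r; apply: cvgMl.
have := @cvg_above_epsn R `|f x|.
by rewrite {2}/above normr_gt0 fx.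
Qed.

Lemma cvg_qform_ftrunc : qform K (ftrunc n) @[n --> \oo] --> qform K f.
Proof.
apply: (@Rint_dct _ _ _ mu2 (fun n p => K (vsub p.1 p.2) * (ftrunc n p.1 * ftrunc n p.2)) _ dom).
- move=> n; apply: measurable_funM; first exact: measurable_Kdiff.
  by apply: measurable_funM; (apply: measurableT_comp; [exact: measurable_ftrunc|by []]).
- exact: mQ.
- exact: integ_dom.
- by move=> p; apply: cvgMr; apply: cvgM; exact: cvg_ftrunc.
- move=> n p; apply: le_trans (dom_bnd p).
  rewrite normrM [in leRHS]normrM; apply: ler_wpM2l => //.
  rewrite normrM [in leRHS]normrM.
  by apply: ler_pM => //; exact: ftrunc_le.
Qed.

Lemma cvg_ftrunc2 : \int[mu]_x (ftrunc n x ^+ 2) @[n --> \oo] --> \int[mu]_x (f x ^+ 2).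
Proof.
apply: (@Rint_dct _ _ _ mu (fun n x => ftrunc n x ^+ 2) _ (fun x => f x ^+ 2)) => //.
- by move=> n; apply: measurable_funX; exact: measurable_ftrunc.
- exact: measurable_funX.
- by move=> x; rewrite expr2; under eq_cvg do rewrite expr2; apply: cvgM; exact: cvg_ftrunc.
- move=> n x; rewrite normrX -[f x ^+ 2]real_normK ?num_real//.
  by rewrite lerXn2r ?nnegrE// ftrunc_le.
Qed.

End good.

(** The form is the integral of m (C^2 + S^2), where C and S are the cosine and sine
    transforms of f. *)
Lemma qform_cosft_ge0 m f : integ mu m -> (forall z, 0 <= m z) -> integ mu f ->
  0 <= qform (cosft m) f.
Proof.
move=> mi m0 fi; have mf := integ_measurable fi; have mm := integ_measurable mi.
have p0 : 0 <= (2 * pi : R) ^- d by rewrite invr_ge0 exprn_ge0// mulr_ge0// pi_ge0.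
have mkc := measurable_Kdiff (measurable_cosft mi).
have ik := integ_kernel fi fi mkc (fun p => cosft_bnd mi _).
rewrite /qform (integ_prod ik).2 /=.
pose C z := \int[mu]_y (cos (dotv z y) * f y).
pose S z := \int[mu]_y (sin (dotv z y) * f y).
have msindot2 : measurable_fun setT (fun p : Rvec R d * Rvec R d => sin (dotv p.1 p.2)).
  apply: measurableT_comp; first by apply: continuous_measurable_fun; exact: continuous_sin.
  exact: measurable_dotvT.
have mC : measurable_fun setT C := measurable_kernel fi measurable_cosdot2.
have mS : measurable_fun setT S := measurable_kernel fi msindot2.
pose N := \int[mu]_y `|f y|.
have CN z : `|C z| <= N.
  by have := kernel_le fi measurable_cosdot2 (fun p => cos_bnd _) z; rewrite mul1r.
have SN z : `|S z| <= N.
  by have := kernel_le fi msindot2 (fun p => sin_bnd _) z; rewrite mul1r.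
pose k (p : Rvec R d * Rvec R d) := cos (dotv p.1 p.2) * C p.2 + sin (dotv p.1 p.2) * S p.2.
have mk : measurable_fun setT k.
  by apply: measurable_funD; apply: measurable_funM => //; [exact: measurable_cosdot2|
    exact: measurableT_comp mC _|exact: measurableT_comp mS _].
have kN p : `|k p| <= N + N.
  apply: le_trans (ler_normD _ _) _; rewrite !normrM.
  by apply: lerD; rewrite -[leRHS]mul1r ler_pM// ?cos_bnd ?sin_bnd ?CN ?SN.
have fcos z : integ mu (fun y => cos (dotv z y) * f y).
  exact: integM_bounded fi (measurable_section1 z measurable_cosdot2) (fun y => cos_bnd _).
have fsin z : integ mu (fun y => sin (dotv z y) * f y).
  exact: integM_bounded fi (measurable_section1 z msindot2) (fun y => sin_bnd _).
have inner x : \int[mu]_y (cosft m (vsub x y) * (f x * f y)) =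
    (2 * pi) ^- d * (f x * \int[mu]_z (k (x, z) * m z)).
  pose k' (p : Rvec R d * Rvec R d) := cos (dotv (vsub x p.1) p.2).
  have mk' : measurable_fun setT k'.
    apply: (measurableT_comp measurable_cosdot2 (g := fun p => (vsub x p.1, p.2))).
    apply: measurable_fun_pair => //; exact: measurable_vsubT.
  have sw := kernel_swap fi mi mk' (fun p => cos_bnd _).
  have e1 : \int[mu]_z (k (x, z) * m z) = \int[mu]_z (m z * \int[mu]_y (k' (y, z) * f y)).
    apply: eq_Rint => z; rewrite mulrC; congr (_ * _).
    rewrite /k /= /C /S -RintegralZl// -RintegralZl// -RintegralD//; last 2 first.
      exact: integZ.
      exact: integZ.
    apply: eq_Rint => y; rewrite /k' /= dotvBl cosB !(dotvC y z); ring.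
  rewrite e1 -sw -RintegralZl//; last first.
    have := integM_bounded fi (measurable_kernel mi mk') (kernel_le mi mk' (fun p => cos_bnd _)).
    by apply: eq_integrable => // u _ /=; rewrite mulrC.
  rewrite -RintegralZl//; last first.
    apply: integZ.
    have := integM_bounded fi (measurable_kernel mi mk') (kernel_le mi mk' (fun p => cos_bnd _)).
    by apply: eq_integrable => // u _ /=; rewrite mulrC.
  by apply: eq_Rint => y; rewrite /cosft /k' /=; ring.
under eq_Rint do rewrite inner.
have ifk : integ mu (fun x => f x * \int[mu]_z (k (x, z) * m z)).
  have := integM_bounded fi (measurable_kernel mi mk) (kernel_le mi mk kN).
  by apply: eq_integrable => // u _ /=; rewrite mulrC.
rewrite RintegralZl//; apply: mulr_ge0 => //.
rewrite (kernel_swap fi mi mk kN).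
apply: Rintegral_ge0 => z _; apply: mulr_ge0 => //.
have -> : \int[mu]_x (k (x, z) * f x) = C z ^+ 2 + S z ^+ 2; last by rewrite addr_ge0// sqr_ge0.
rewrite !expr2 {2}/C {2}/S -RintegralZl// -RintegralZl// -RintegralD//; last 2 first.
  exact: integZ.
  exact: integZ.
by apply: eq_Rint => x; rewrite /k /= !(dotvC x z); ring.
Qed.

End quadratic_form.

(** * Comparison of quadratic forms through their symbols *)

Section energy_comparison.
Context {R : realType} {d : nat}.
Local Notation mu1 := (@lebesgue_measure R).
Local Notation mu := (leb R d).
Local Notation mu2 := (leb R d \x leb R d)%E.
Variable a : R.
Hypotheses (a0 : 0 < a) (a1 : a < 1).
Implicit Types (K f : Rvec R d -> R) (x y z : Rvec R d).

(** The sine part of the transform has been dropped, so the kernel is even. *)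
Lemma cosft_sym (m : Rvec R d -> R) x y : cosft m (vsub x y) = cosft m (vsub y x).
Proof.
congr (_ * _); apply: eq_Rint => z; congr (_ * _).
by rewrite -cosN; congr cos; rewrite !dotvBl opprB.
Qed.

Lemma conv_kernel_rheat t : 0 < t -> conv_kernel (@rheat R d a t) 1.
Proof.
move=> t0; split; first exact: measurable_rheat.
- by move=> x; exact: rheat_ge0.
- by move=> x y; exact: cosft_sym.
- by move=> x; exact: rheat_mass.
Qed.

Lemma conv_kernel_heat s : 0 < s -> conv_kernel (@heat R d s) 1.
Proof.
move=> s0; have si := @integ_gaussd R d s s0.
have -> : @heat R d s = cosft (fun z => expR (- s * dotv z z)).
  by apply/funext => x; rewrite cosft_gauss.
have k0 x : 0 <= cosft (fun z : Rvec R d => expR (- s * dotv z z)) x.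
  by rewrite cosft_gauss// heat_ge0.
split => //; first exact: measurable_cosft.
- by move=> x y; exact: cosft_sym.
- move=> x; apply: cosft_mass => // z.
  by rewrite ger0_norm ?expR_ge0// -expR0 ler_expR mulNr lerNl oppr0 mulr_ge0 ?dotv_ge0// ltW.
Qed.

(** The regularised kernel: a Gaussian factor in the Fourier variable shifts the time of the
    heat kernels by s. *)
Definition nu_smooth (e s : R) x : R := \int[mu1]_u (vlevy a e u * heat (`|u| + s) x).
(** The Lévy density of the relativistic stable process with the jumps produced by times
    below e removed. *)
Definition nu_trunc (e : R) x : R := \int[mu1]_u (vlevy a e u * heat `|u| x).

Lemma heat_le (e s : R) x : 0 < e -> e <= s -> heat s x <= Num.sqrt (4 * pi * e) ^- d.
Proof.
move=> e0 es; have s0 := lt_le_trans e0 es.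
have p0 : 0 < 4 * pi :> R by rewrite mulr_gt0// pi_gt0.
have i0 : 0 <= Num.sqrt (4 * pi * s) ^- d by rewrite invr_ge0 exprn_ge0// sqrtr_ge0.
rewrite /heat -[leRHS]mulr1; apply: ler_pM i0 (expR_ge0 _) _ _.
- have q (r : R) : 0 < r -> Num.sqrt (4 * pi * r) ^+ d \is Num.pos.
    by move=> r0; rewrite posrE exprn_gt0// sqrtr_gt0 mulr_gt0.
  rewrite lef_pV2 ?q//.
  by apply: lerXn2r; rewrite ?nnegrE ?sqrtr_ge0// ler_wsqrtr// ler_wpM2l// ltW.
- by rewrite -[leRHS]expR0 ler_expR lerNl oppr0 divr_ge0 ?dotv_ge0// mulr_ge0// ltW.
Qed.

Lemma measurable_heat2 (s : R) : measurable_fun setT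
  (fun p : measurableTypeR R * Rvec R d => heat (`|p.1| + s) p.2).
Proof.
have mabs : measurable_fun setT (fun p : measurableTypeR R * Rvec R d => `|p.1| + s).
  by apply: measurable_funD => //; apply: measurableT_comp => //; exact: normr_measurable.
have minv := @measurable_invr R.
apply: measurable_funM.
  apply: (measurableT_comp minv); apply: measurable_funX.
  apply: (measurableT_comp (f := @Num.sqrt R)).
    by apply: continuous_measurable_fun; exact: sqrt_continuous.
  exact: measurable_funM.
apply: measurableT_comp => //; apply: measurable_funN; apply: measurable_funM.
  exact: measurable_dotvT.
apply: (measurableT_comp minv); exact: measurable_funM.
Qed.

(** For times u > e the heat kernels are bounded by their value at time e at the origin. *)
Lemma vheat_bnd e s u x : 0 < e -> 0 <= s ->
  `|vlevy a e u * heat (`|u| + s) x| <= Num.sqrt (4 * pi * e) ^- d * vlevy a e u.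
Proof.
move=> e0 s0; rewrite (ger0_norm (mulr_ge0 (vlevy_ge0 _ _ _ _) (heat_ge0 _ _)))// mulrC.
have [ue|ue] := leP u e; first by rewrite /vlevy wlevy0// mul0r !mulr0.
apply: ler_wpM2r; first exact: vlevy_ge0.
by apply: heat_le => //; rewrite gtr0_norm ?(lt_trans e0)// ler_wpDr// ltW.
Qed.

Lemma measurable_vheat e s x : 0 < e -> measurable_fun setT (fun u => vlevy a e u * heat (`|u| + s) x).
Proof.
move=> e0; apply: measurable_funM; first exact: integ_measurable (integ_vlevy a0 a1 e0).
exact: (measurable_section2 x (measurable_heat2 s)).
Qed.

Lemma integ_vheat e s x : 0 < e -> 0 <= s ->
  integ mu1 (fun u => vlevy a e u * heat (`|u| + s) x).
Proof.
move=> e0 s0.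
apply: (@integ_le _ _ _ mu1 _ (fun u => Num.sqrt (4 * pi * e) ^- d * vlevy a e u)).
- exact: measurable_vheat.
- exact/integZ/integ_vlevy.
- by move=> u; exact: vheat_bnd.
Qed.

Lemma nu_smooth_bnd e s x : 0 < e -> 0 <= s ->
  `|nu_smooth e s x| <= Num.sqrt (4 * pi * e) ^- d * \int[mu1]_u vlevy a e u.
Proof.
move=> e0 s0; rewrite -RintegralZl//; last exact: integ_vlevy.
apply: Rint_norm_le; first exact: integ_vheat.
  exact/integZ/integ_vlevy.
by move=> u; exact: vheat_bnd.
Qed.

Lemma nu_truncE e x : nu_trunc e x = nu_smooth e 0 x.
Proof. by apply: eq_Rint => u; rewrite addr0. Qed.

Lemma cvg_heat (s : R) x : 0 < s -> heat (s + n.+1%:R^-1) x @[n --> \oo] --> heat s x.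
Proof.
move=> s0.
have h : s + n.+1%:R^-1 @[n --> \oo] --> s.
  by rewrite -[X in _ --> X]addr0; apply: cvgD; [exact: cvg_cst|exact: cvg_harmonic].
have p0 : 0 < 4 * pi :> R by rewrite mulr_gt0// pi_gt0.
apply: cvgM.
  apply: cvgV; first by rewrite expf_neq0// gt_eqF// sqrtr_gt0 mulr_gt0.
  have h1 : 4 * pi * (s + n.+1%:R^-1) @[n --> \oo] --> 4 * pi * s by exact: cvgMr.
  have h2 := cvg_comp _ _ h1 (@sqrt_continuous R _).
  exact: (cvg_comp _ _ h2 (@exprn_continuous R d _)).
apply: continuous_cvg; first exact: continuous_expR.
apply: cvgN; apply: cvgMr; apply: cvgV; first by rewrite gt_eqF// mulr_gt0.
exact: cvgMr.
Qed.

Lemma cvg_nu_smooth e x : 0 < e -> nu_smooth e n.+1%:R^-1 x @[n --> \oo] --> nu_trunc e x.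
Proof.
move=> e0; rewrite nu_truncE.
apply: (@Rint_dct _ _ _ mu1 (fun n u => vlevy a e u * heat (`|u| + n.+1%:R^-1) x) _
  (fun u => Num.sqrt (4 * pi * e) ^- d * vlevy a e u)).
- by move=> n; exact: measurable_vheat.
- exact: measurable_vheat.
- exact/integZ/integ_vlevy.
- move=> u; have [ue|ue] := leP u e.
    rewrite /vlevy wlevy0// mul0r; apply: cvg_near_cst.
    by apply: nearW => n; rewrite !mul0r.
  apply: cvgMr; rewrite addr0; apply: cvg_heat.
  by rewrite normr_gt0 gt_eqF// (lt_trans e0).
- by move=> n u; apply: vheat_bnd.
Qed.

(** The symbol of the truncated jumps does not decay, hence the Gaussian factor. *)
Lemma cosft_jump_symbol e s x : 0 < e -> 0 < s ->
  cosft (fun z => jump_symbol a e z * expR (- s * dotv z z)) x = nu_smooth e s x.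
Proof.
move=> e0 s0.
have -> : (fun z : Rvec R d => jump_symbol a e z * expR (- s * dotv z z)) =
  (fun z => (\int[mu1]_u (vlevy a e u * cexp (dotv z z) u)) * expR (- s * dotv z z)).
  by apply/funext => z; rewrite jump_symbolE.
rewrite cosft_mix//; [|exact: integ_vlevy|exact: integ_gaussd].
apply: eq_Rint => u; congr (_ * _); rewrite -cosft_gauss; last by rewrite ltr_wpDl.
congr (cosft _ _); apply/funext => z; rewrite -expRD; congr expR; ring.
Qed.

Lemma measurable_nu_trunc e : measurable_fun setT (nu_trunc e).
Proof.
apply: (@measurable_Rint1 _ _ _ _ _ mu1 (fun p : Rvec R d * measurableTypeR R =>
  vlevy a e p.2 * heat `|p.2| p.1)).
apply: measurable_funM.
  apply: measurableT_comp => //; apply: measurable_funM; first exact: measurable_wlevy.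
  exact: measurable_cexp.
have sw : measurable_fun setT (fun p : Rvec R d * measurableTypeR R => (p.2, p.1)).
  by apply: measurable_fun_pair.
have := measurableT_comp (measurable_heat2 0) sw.
by apply: eq_measurable_fun => p _ /=; rewrite addr0.
Qed.

Lemma conv_kernel_nu_trunc e : 0 < e -> conv_kernel (nu_trunc e) (\int[mu1]_u vlevy a e u).
Proof.
move=> e0; split; first exact: measurable_nu_trunc.
- by move=> x; apply: Rintegral_ge0 => u _; rewrite mulr_ge0 ?vlevy_ge0 ?heat_ge0.
- by move=> x y; apply: eq_Rint => u; rewrite /heat dotv_vsubC.
move=> x; have vi := integ_vlevy a0 a1 e0.
pose F (p : Rvec R d * measurableTypeR R) : \bar R :=
  (vlevy a e p.2 * heat `|p.2| (vsub x p.1))%:E.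
have mF : measurable_fun setT F.
  apply/measurable_EFinP; apply: measurable_funM.
    by apply: measurableT_comp => //; exact: integ_measurable vi.
  have sw : measurable_fun setT (fun p : Rvec R d * measurableTypeR R => (p.2, vsub x p.1)).
    by apply: measurable_fun_pair => //; exact: measurable_vsubT.
  have := measurableT_comp (measurable_heat2 0) sw.
  by apply: eq_measurable_fun => p _ /=; rewrite addr0.
have F0 p : (0 <= F p)%E by rewrite lee_fin mulr_ge0 ?vlevy_ge0 ?heat_ge0.
have -> : (\int[mu]_y (nu_trunc e (vsub x y))%:E = \int[mu]_y \int[mu1]_u F (y, u))%E.
  apply: eq_integral => y _; rewrite nu_truncE RintE; last exact: integ_vheat.
  by apply: eq_integral => u _; rewrite addr0.
rewrite fubini_tonelli// RintE//; apply: ge0_le_integral => //.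
- by move=> u _; exact: integral_ge0.
- exact: (measurable_fun_fubini_tonelli_G _ mF).
- by apply/measurable_EFinP; exact: integ_measurable vi.
move=> u _; rewrite /F/=.
have [ue|ue] := leP u e.
  rewrite integral0_eq ?lee_fin ?vlevy_ge0// => y _.
  by rewrite /vlevy wlevy0// !mul0r.
under eq_integral do rewrite EFinM.
have u0 : 0 < `|u| by rewrite normr_gt0 gt_eqF// (lt_trans e0).
have [mh h0 _ h1] := conv_kernel_heat u0.
rewrite ge0_integralZl//; last 3 first.
- by apply/measurable_EFinP; apply: measurableT_comp mh _; exact: measurable_vsubT.
- by move=> y _; rewrite lee_fin.
- by rewrite lee_fin vlevy_ge0.
by rewrite -[leRHS]mule1; apply: lee_wpmul2l; rewrite ?lee_fin ?vlevy_ge0.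
Qed.

Lemma integ_heatT f (n : nat) : integ mu f ->
  integ mu2 (fun p => heat n.+1%:R^-1 (vsub p.1 p.2) * (f p.1 * f p.2)).
Proof.
move=> fi; have s0 : 0 < n.+1%:R^-1 :> R by rewrite invr_gt0.
have [mh h0 _ _] := conv_kernel_heat s0.
apply: (integ_kernel fi fi (measurable_Kdiff mh) (M := Num.sqrt (4 * pi * n.+1%:R^-1) ^- d)) => p.
by rewrite ger0_norm// heat_le.
Qed.

Section quadratic.
Variables (f : Rvec R d -> R) (e t A B C : R).
Hypotheses (e0 : 0 < e) (t0 : 0 < t) (A0 : 0 <= A)
  (m0 : forall z : Rvec R d, 0 <= A + B * jump_symbol a e z + C * rsymbol_exp a t z).

Let kn (n : nat) x := B * nu_smooth e n.+1%:R^-1 x +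
  C * cosft (fun z => rsymbol_exp a t z * expR (- n.+1%:R^-1 * dotv z z)) x.

Let k x := B * nu_trunc e x + C * rheat a t x.

Lemma qform_L1 : integ mu f -> integ mu (fun x => f x ^+ 2) ->
  0 <= A * \int[mu]_x (f x ^+ 2) + qform k f.
Proof.
move=> fi f2; have mf := integ_measurable fi.
have s0 n : 0 < n.+1%:R^-1 :> R by rewrite invr_gt0.
have mti := @integ_rsymbol_exp R d a a0 t t0.
have mtn n : integ mu (fun z => rsymbol_exp a t z * expR (- n.+1%:R^-1 * dotv z z)).
  apply: integM_bounded (integ_gaussd d (s0 n)) (measurable_rsymbol_exp a t) _ => z.
  by apply: rsymbol_exp_le1 => //; exact: ltW.
have Ln n : integ mu (fun z => jump_symbol a e z * expR (- n.+1%:R^-1 * dotv z z)).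
  exact: integ_bounded_meas (bounded_meas_jump_symbol a0 a1 e0) (s0 n).
pose Mt : R := (2 * pi) ^- d * \int[mu]_z `|rsymbol_exp a t z|.
pose Mn := `|B| * (Num.sqrt (4 * pi * e) ^- d * \int[mu1]_u vlevy a e u) + `|C| * Mt.
have knE n x : kn n x = cosft (fun z => B * (jump_symbol a e z * expR (- n.+1%:R^-1 * dotv z z)) +
    C * (rsymbol_exp a t z * expR (- n.+1%:R^-1 * dotv z z))) x.
  by rewrite cosftD ?cosftZ ?cosft_jump_symbol//; exact: integZ.
have knM n x : `|kn n x| <= Mn.
  apply: le_trans (ler_normD _ _) _; rewrite [`|B * _|]normrM [`|C * _|]normrM.
  apply: lerD; apply: ler_wpM2l => //.
    by apply: nu_smooth_bnd => //; exact: ltW.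
  apply: le_trans (cosft_bnd (mtn n) x) _; apply: ler_wpM2l.
    by rewrite invr_ge0 exprn_ge0// mulr_ge0// pi_ge0.
  apply: Rint_le; try exact: integrable_norm.
  move=> z; rewrite normrM ler_piMr// ger0_norm ?expR_ge0//.
  by rewrite -expR0 ler_expR mulNr lerNl oppr0 mulr_ge0// dotv_ge0.
have mkn n : measurable_fun setT (kn n).
  rewrite (_ : kn n = cosft (fun z => B * (jump_symbol a e z * expR (- n.+1%:R^-1 * dotv z z)) +
    C * (rsymbol_exp a t z * expR (- n.+1%:R^-1 * dotv z z)))); last by apply/funext => x; exact: knE.
  by apply: measurable_cosft; apply: integD; exact: integZ.
have mk : measurable_fun setT k.
  apply: measurable_funD; apply: measurable_funM => //; first exact: measurable_nu_trunc.
  exact: measurable_rheat.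
have cvk : qform (kn n) f @[n --> \oo] --> qform k f.
  apply: (@Rint_dct _ _ _ mu2 (fun n p => kn n (vsub p.1 p.2) * (f p.1 * f p.2)) _
    (fun p => Mn * `|f p.1 * f p.2|)).
  - move=> n; apply: measurable_funM; first exact: measurable_Kdiff.
    by apply: measurable_funM; exact: measurableT_comp mf _.
  - apply: measurable_funM; first exact: measurable_Kdiff.
    by apply: measurable_funM; exact: measurableT_comp mf _.
  - by apply: integZ; exact/integrable_norm/integ_tensor.
  - move=> p; apply: cvgMl; apply: cvgD; apply: cvgMr; first exact: cvg_nu_smooth.
    exact: cvg_cosft_smooth.
  - by move=> n p; rewrite normrM ler_wpM2r.
have pos n : 0 <= A * \int[mu]_x (f x ^+ 2) + qform (kn n) f.
  pose m z := (A + B * jump_symbol a e z + C * rsymbol_exp a t z) * expR (- n.+1%:R^-1 * dotv z z).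
  have mE : m = (fun z => A * expR (- n.+1%:R^-1 * dotv z z) +
     (B * (jump_symbol a e z * expR (- n.+1%:R^-1 * dotv z z)) +
      C * (rsymbol_exp a t z * expR (- n.+1%:R^-1 * dotv z z)))).
    by apply/funext => z; rewrite /m; ring.
  have gi := integ_gaussd d (s0 n).
  have mi : integ mu m.
    by rewrite mE; apply: integD; [exact: integZ|apply: integD; exact: integZ].
  have mge z : 0 <= m z by rewrite /m mulr_ge0// expR_ge0.
  have := qform_cosft_ge0 mi mge fi.
  have -> : qform (cosft m) f = A * qform (heat n.+1%:R^-1) f + qform (kn n) f.
    have ih := integ_heatT n fi.
    have ik := integ_kernel fi fi (measurable_Kdiff (mkn n)) (fun p => knM n _).
    rewrite /qform -RintegralZl// -RintegralD//; last exact: integZ.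
    apply: eq_Rint => p; rewrite mE cosftD; last 2 first.
    - exact: integZ.
    - by apply: integD; exact: integZ.
    by rewrite cosftZ// cosft_gauss// -knE; ring.
  move=> h; apply: le_trans h _; rewrite lerD2r ler_wpM2l//.
  by have := qform_le (conv_kernel_heat (s0 n)) mf f2; rewrite mul1r.
have cv : A * \int[mu]_x (f x ^+ 2) + qform (kn n) f @[n --> \oo] -->
   A * \int[mu]_x (f x ^+ 2) + qform k f by apply: cvgD => //; exact: cvg_cst.
by apply: (cvgr_to_ge cv); exact: nearW.
Qed.

End quadratic.

(** The transfer of symbol inequalities to forms. For integrable f it follows from
    [qform_cosft_ge0] applied to the symbol times e^(-s |z|^2); here A |f|_2^2 dominates the
    form of the heat kernel at time s, since that kernel has mass 1. Truncation extends it
    to L^2. *)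
Lemma quad_ge0 f (e t A B C : R) : 0 < e -> 0 < t -> 0 <= A ->
  (forall z : Rvec R d, 0 <= A + B * jump_symbol a e z + C * rsymbol_exp a t z) ->
  measurable_fun setT f -> integ mu (fun x => f x ^+ 2) ->
  0 <= A * \int[mu]_x (f x ^+ 2) + (B * qform (nu_trunc e) f + C * qform (rheat a t) f).
Proof.
move=> e0 t0 A0 m0 mf f2.
have gn := conv_kernel_nu_trunc e0; have gp := conv_kernel_rheat t0.
have split (g : Rvec R d -> R) : measurable_fun setT g -> integ mu (fun x => g x ^+ 2) ->
  qform (fun x => B * nu_trunc e x + C * rheat a t x) g = B * qform (nu_trunc e) g + C * qform (rheat a t) g.
  move=> mg g2; have i1 := integ_qform gn mg g2; have i2 := integ_qform gp mg g2.
  rewrite /qform -!RintegralZl// -RintegralD//; try exact: integZ.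
  by apply: eq_Rint => p; ring.
pose fn := ftrunc f.
have cv : A * \int[mu]_x (fn n x ^+ 2) + (B * qform (nu_trunc e) (fn n) + C * qform (rheat a t) (fn n))
   @[n --> \oo] --> A * \int[mu]_x (f x ^+ 2) + (B * qform (nu_trunc e) f + C * qform (rheat a t) f).
  apply: cvgD; first by apply: cvgMr; exact: cvg_ftrunc2.
  by apply: cvgD; apply: cvgMr; apply: cvg_qform_ftrunc; eassumption.
apply: (cvgr_to_ge cv); apply: nearW => n; rewrite -split.
- by apply: qform_L1 => //; [exact: integ_ftrunc|exact: integ_ftrunc2].
- exact: measurable_ftrunc.
- exact: integ_ftrunc2.
Qed.

End energy_comparison.

(** * The Dirichlet form as a limit of truncated jump energies *)

Section exponential_bounds.
Context {R : realType}.

Lemma one_sub_expR_ge (y : R) : 0 <= y -> y - y ^+ 2 <= 1 - expR (- y).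
Proof.
move=> y0; suff : expR (- y) <= 1 - y + y ^+ 2 by lra.
rewrite expRN; have y1 : 0 < 1 + y by lra.
apply: le_trans (_ : (1 + y)^-1 <= _).
  by rewrite lef_pV2 ?posrE ?expR_gt0// expR_ge1Dx.
rewrite -[(1 + y)^-1]mul1r ler_pdivrMr//.
have -> : (1 - y + y ^+ 2) * (1 + y) = 1 + y ^+ 3 by ring.
by rewrite lerDl exprn_ge0.
Qed.

Lemma one_sub_expR_le (y : R) : 1 - expR (- y) <= y.
Proof. by have := expR_ge1Dx (- y); lra. Qed.

End exponential_bounds.

Section energies.
Context {R : realType} {d : nat}.
Local Notation mu1 := (@lebesgue_measure R).
Local Notation mu := (leb R d).
Local Notation mu2 := (leb R d \x leb R d)%E.
Variable a : R.
Hypotheses (a0 : 0 < a) (a1 : a < 1).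
Variable f : Rvec R d -> R.
Hypotheses (mf : measurable_fun setT f) (f2 : integ mu (fun x => f x ^+ 2)).

Let F : R := \int[mu]_x (f x ^+ 2).

Let F0 : 0 <= F. Proof. by apply: Rintegral_ge0 => x _; exact: sqr_ge0. Qed.

(** The form of f |-> N f - nu * f. *)
Definition jump_energy (e : R) : R := Nlevy a e * F - qform (nu_trunc a e) f.
(** The form of (f - P_t f)/t. *)
Definition heat_energy (t : R) : R := t^-1 * (F - qform (rheat a t) f).

(** The symbol inequality is S - t S^2 <= (1 - e^(-t S))/t <= (1 - e^(-t lam^a))/t, where
    S <= lam^a and S <= N. *)
Lemma jump_energy_le_heat_energy e t : 0 < e -> 0 < t -> jump_energy e <= heat_energy t + t * Nlevy a e ^+ 2 * F.
Proof.
move=> e0 t0; pose N := Nlevy a e.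
have ti : t * t^-1 = 1 by rewrite divff// gt_eqF.
(* the symbol of the form of P_t plus t N^2 minus the symbol of the truncated jumps *)
have := @quad_ge0 R d a a0 a1 f e t (t^-1 + t * N ^+ 2 - N) 1 (- t^-1) e0 t0.
rewrite -/F; suff h : 0 <= t^-1 + t * N ^+ 2 - N /\ forall z : Rvec R d,
    0 <= t^-1 + t * N ^+ 2 - N + 1 * jump_symbol a e z + - t^-1 * rsymbol_exp a t z.
  move=> /(_ h.1 h.2 mf f2); rewrite /heat_energy /jump_energy -/N; lra.
have t'0 : 0 < t^-1 by rewrite invr_gt0.
split.
  have -> : t^-1 + t * N ^+ 2 - N = t^-1 * ((1 - t * N) ^+ 2 + t * N).
    by field; rewrite gt_eqF.
  by rewrite mulr_ge0 ?(ltW t'0)// addr_ge0 ?sqr_ge0// mulr_ge0 ?Nlevy_ge0// ltW.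
move=> z; have l0 := sqnorm1_gt0 z; pose S := Slevy a e (sqnorm1 z).
have SE : S = N - jump_symbol a e z by rewrite /S SlevyE// ltW.
have S0 : 0 <= S by apply: Slevy_ge0 => //; exact: ltW.
have SN : S <= N by apply: Slevy_le_N => //; exact: ltW.
have SP : S <= rsymbol a z by apply: Slevy_le_pow => //; exact: ltW.
have tS0 : 0 <= t * S by rewrite mulr_ge0// ltW.
have h1 := one_sub_expR_ge tS0.
have h2 : rsymbol_exp a t z <= expR (- (t * S)).
  by rewrite ler_expR mulNr lerN2 ler_wpM2l// ltW.
have h3 : t^-1 * (t * S - (t * S) ^+ 2) <= t^-1 * (1 - rsymbol_exp a t z).
  apply: ler_wpM2l; first exact: ltW.
  by apply: le_trans h1 _; rewrite lerD2l lerN2.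
have h4 : t^-1 * (t * S - (t * S) ^+ 2) = S - t * S ^+ 2.
  by field; rewrite gt_eqF.
have h5 : t * S ^+ 2 <= t * N ^+ 2.
  by rewrite ler_wpM2l ?(ltW t0)// lerXn2r ?nnegrE// (le_trans S0).
rewrite h4 in h3; have -> : jump_symbol a e z = N - S by rewrite SE; ring.
lra.
Qed.

(** The remainder is the Laplace exponent of the small times, hence increasing. *)
Lemma Rlevy_homo e (lam lam' : R) : 0 <= e -> 0 < lam -> lam <= lam' ->
  lam `^ a - Slevy a e lam <= lam' `^ a - Slevy a e lam'.
Proof.
move=> e0 l0 ll; have l0' := lt_le_trans l0 ll.
have E0 (l : R) : 0 < l -> l `^ a = Slevy a 0 l.
  by move=> ?; apply: EFin_inj; rewrite -levy_khintchine_e// RintE//; exact: integ_wlevy_exp.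
rewrite !E0// /Slevy -!RintegralB//; try exact: integ_wlevy_exp.
apply: Rint_le; try by apply: integB; exact: integ_wlevy_exp.
move=> u; rewrite -[leLHS]mulrBl -[leRHS]mulrBl.
have w0 : 0 <= wlevy a 0 u - wlevy a e u by rewrite subr_ge0; exact: wlevy_le.
apply: (ler_wpM2l w0).
by rewrite lerD2l lerN2 ler_expR lerN2 ler_wpM2l.
Qed.

(** The remainder lam^a - S(lam) at the lam for which lam^a = 1/t. *)
Definition cut_error e t : R := t^-1 - Slevy a e ((t^-1) `^ a^-1).

(** The symbol (1 - e^(-t lam^a))/t is at most lam^a and at most 1/t. The first bound is used
    where lam^a <= 1/t, the second one elsewhere; in both cases the difference to S is
    largest at lam^a = 1/t. *)
Lemma heat_energy_le_jump_energy e t : 0 < e -> 0 < t -> heat_energy t <= jump_energy e + cut_error e t * F.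
Proof.
move=> e0 t0; pose N := Nlevy a e; pose L := (t^-1) `^ a^-1.
have t'0 : 0 < t^-1 by rewrite invr_gt0.
have L0 : 0 < L by exact: powR_gt0.
have La : L `^ a = t^-1 by rewrite /L -powRrM mulVf ?gt_eqF// powRr1// ltW.
pose r := cut_error e t.
(* the symbol of the truncated jumps plus r minus the symbol of the form of P_t *)
have := @quad_ge0 R d a a0 a1 f e t (N + r - t^-1) (- 1) (t^-1) e0 t0.
rewrite -/F; suff h : 0 <= N + r - t^-1 /\ forall z : Rvec R d,
    0 <= N + r - t^-1 + - 1 * jump_symbol a e z + t^-1 * rsymbol_exp a t z.
  move=> /(_ h.1 h.2 mf f2); rewrite /heat_energy /jump_energy -/N -/r; lra.
split.
  have : Slevy a e L <= N by apply: Slevy_le_N => //; exact: ltW.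
  by rewrite /r /cut_error -/L; lra.
move=> z; have l0 := sqnorm1_gt0 z; pose S := Slevy a e (sqnorm1 z).
have SE : S = N - jump_symbol a e z by rewrite /S SlevyE// ltW.
suff : t^-1 * (1 - rsymbol_exp a t z) <= S + r by rewrite SE; lra.
have [zL|jump_symbol] := leP (sqnorm1 z) L.
  have h := Rlevy_homo (ltW e0) l0 zL.
  rewrite La -/S in h.
  apply: le_trans (_ : rsymbol a z <= _); last by rewrite /r /cut_error /rsymbol -/L; lra.
  rewrite mulrC ler_pdivrMr// mulrC; have := one_sub_expR_le (t * rsymbol a z).
  by rewrite /rsymbol_exp mulNr.
have h : Slevy a e L <= S by apply: Slevy_homo => //; exact: ltW.
have m0 : 0 <= rsymbol_exp a t z by exact: expR_ge0.
apply: le_trans (_ : t^-1 <= _); last by rewrite /r /cut_error -/L; lra.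
by rewrite ler_piMr ?(ltW t'0)// gerBl.
Qed.

Lemma cvg_cut_error t : 0 < t -> cut_error (epsn n) t @[n --> \oo] --> (0 : R).
Proof.
move=> t0; have t'0 : 0 < t^-1 by rewrite invr_gt0.
have L0 : 0 < (t^-1) `^ a^-1 by exact: powR_gt0.
have La : ((t^-1) `^ a^-1) `^ a = t^-1 by rewrite -powRrM mulVf ?gt_eqF// powRr1// ltW.
have := cvg_Slevy a0 a1 L0; rewrite La => h.
by rewrite -[X in _ --> X](subrr t^-1); apply: cvgB => //; exact: cvg_cst.
Qed.

Local Open Scope ereal_scope.

(** At fixed t the quotient is at most the limit of the energies, and at fixed e it exceeds
    the energy up to an error that vanishes with t. So the two limits agree, finite or not. *)
Lemma cvg_heat_energy (Q : \bar R) : (jump_energy (epsn n))%:E @[n --> \oo] --> Q ->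
  (heat_energy t)%:E @[t --> 0^'+] --> Q.
Proof.
move=> EQ.
have up t : (0 < t)%R -> (heat_energy t)%:E <= Q.
  move=> t0.
  have dF : ((cut_error (epsn n) t * F)%R)%:E @[n --> \oo] --> 0.
    apply: cvg_EFin; first exact: nearW.
    by rewrite -[X in _ --> X](mul0r F); apply: cvgMl; exact: cvg_cut_error.
  have cv : (jump_energy (epsn n))%:E + ((cut_error (epsn n) t * F)%R)%:E @[n --> \oo] --> Q + 0.
    by apply: cvgeD => //; rewrite fin_num_adde_defl.
  rewrite adde0 in cv.
  apply: (@cvge_to_ge _ _ _ _ _ _ _ cv); apply: nearW => n.
  by rewrite -EFinD lee_fin; apply: heat_energy_le_jump_energy => //; exact: epsn_gt0.
have low (n : nat) (eta : R) : (0 < eta)%R ->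
    \forall t \near 0^'+, (jump_energy (epsn n) - eta <= heat_energy t)%R.
  move=> eta0; pose N2 := (Nlevy a (epsn n) ^+ 2 * F + 1)%R.
  have N20 : (0 < N2)%R by rewrite ltr_wpDl// mulr_ge0// sqr_ge0.
  near=> t.
  have t0 : (0 < t)%R by near: t; exact: nbhs_right_gt.
  have te : (t <= eta / N2)%R by near: t; apply: nbhs_right_le; exact: divr_gt0.
  have h := jump_energy_le_heat_energy (@epsn_gt0 R n) t0.
  rewrite lerBlDr; apply: le_trans h _; rewrite lerD2l -mulrA.
  rewrite ler_pdivlMr// in te; apply: le_trans te.
  by rewrite ler_wpM2l ?(ltW t0)// lerDl.
case: Q EQ up => [r| |] EQ up.
- apply: cvg_EFin; first exact: nearW.
  apply/cvgrPdist_le => /= e e0.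
  have e20 : (0 < e / 2)%R by rewrite divr_gt0.
  move/fine_cvgP : EQ => [_ /cvgrPdist_le/(_ _ e20)[n _ /(_ n (leqnn n)) /= En]].
  have lo := low n _ e20; near=> t.
  have t0 : (0 < t)%R by near: t; exact: nbhs_right_gt.
  have := up t t0; rewrite lee_fin => ut.
  have lt : (jump_energy (epsn n) - e / 2 <= heat_energy t)%R by near: t.
  move: En; rewrite ler_norml => /andP[E1 E2].
  by rewrite ger0_norm ?subr_ge0//; lra.
- apply/cvgeyPge => M.
  move/cvgeyPge : EQ => /(_ (M + 1)%R)[n _ /(_ n (leqnn n)) /=]; rewrite lee_fin => En.
  have := low n _ ltr01; apply: filterS => t lo; rewrite lee_fin; lra.
- by have := up 1%R ltr01; rewrite leeNy_eq.
Unshelve. all: by end_near. Qed.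

End energies.

Section form_link.
Context {R : realType} {d : nat}.
Local Notation mu := (leb R d).
Local Notation mu2 := (leb R d \x leb R d)%E.
Variable alpha : R.
Hypotheses (a0 : 0 < alpha / 2) (a1 : alpha / 2 < 1).
Variable f : Rvec R d -> R.
Hypotheses (mf : measurable_fun setT f) (f2 : integ mu (fun x => f x ^+ 2)).

Lemma heat_kernelE t (x y : Rvec R d) : heat_kernel alpha t x y = rheat (alpha / 2) t (vsub x y).
Proof.
rewrite /heat_kernel /heat_kernelC /rheat /cosft /Cintegral.
rewrite /= mul0r subr0; congr (_ * _); apply: eq_Rint => z.
rewrite /expi /= mulr0 subr0 enormK.
by congr (cos _ * _); rewrite !dotvBl opprB.
Qed.

(** Fubini's theorem gives the inner integral for almost every x with f x != 0; where
    f x = 0 both sides vanish. *)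
Lemma integ_fPt t : 0 < t ->
  integ mu (fun x => f x * semigroup alpha t f x) /\
  \int[mu]_x (f x * semigroup alpha t f x) = qform (rheat (alpha / 2) t) f.
Proof.
move=> t0; have gp := @conv_kernel_rheat R d _ a0 a1 t t0.
have iq := integ_qform gp mf f2.
have [mp _ _ _] := gp.
pose G (p : Rvec R d * Rvec R d) := rheat (alpha / 2) t (vsub p.1 p.2) * f p.2.
have mG : measurable_fun setT G.
  by apply: measurable_funM; [exact: measurable_Kdiff|exact: measurableT_comp mf _].
have mS : measurable_fun setT (fun x => f x * \int[mu]_y G (x, y)).
  by apply: measurable_funM => //; exact: (measurable_Rint1 mu mG).
have SE : (fun x => f x * semigroup alpha t f x) = (fun x => f x * \int[mu]_y G (x, y)).
  apply/funext => x; congr (_ * _); apply: eq_Rint => y; by rewrite heat_kernelE.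
have [i1 e1] := integ_prod iq.
have ae : {ae mu, forall x, setT x ->
    ((f x * \int[mu]_y G (x, y))%:E =
    (\int[mu]_y (rheat (alpha / 2) t (vsub (x, y).1 (x, y).2) * (f (x, y).1 * f (x, y).2)))%:E)%E}.
  have := ae_integrable1 iq; apply: filterS => x ix _; congr EFin.
  have [fx|fx] := eqVneq (f x) 0.
    rewrite /= fx mul0r; apply/esym; under eq_Rint do rewrite mul0r mulr0.
    by rewrite Rintegral_cst// mul0r.
  have iG : integ mu (fun y => G (x, y)).
    have := integZ (f x)^-1 ix; apply: eq_integrable => // y _ /=; congr EFin.
    by rewrite /G /= mulrCA mulKf.
  rewrite -RintegralZl//; apply: eq_Rint => y; rewrite /G /=; ring.
rewrite SE; split.
  have /integrableP[mi ii] := i1.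
  apply/integrableP; split; first exact/measurable_EFinP.
  rewrite (@ae_eq_integral _ _ _ mu setT (fun x => `|(\int[mu]_y
    (rheat (alpha / 2) t (vsub (x, y).1 (x, y).2) * (f (x, y).1 * f (x, y).2)))%:E|)%E)//.
  - by apply: measurableT_comp => //; exact/measurable_EFinP.
  - exact: measurableT_comp.
  - by apply: filterS ae => x /= h _; have [->] := h I.
rewrite /qform e1 /Rintegral; congr fine; apply: ae_eq_integral => //.
- exact/measurable_EFinP.
- by have /integrableP[] := i1.
Qed.

Lemma form_quotientE t : 0 < t -> form_quotient alpha f t = heat_energy (alpha / 2) f t.
Proof.
move=> t0; have [i e] := integ_fPt t0.
rewrite /form_quotient /heat_energy /inner_L2 -e -RintegralB//.
by congr (_ * _); apply: eq_Rint => x; ring.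
Qed.

Lemma cvg_form_quotient (Q : \bar R) :
  (jump_energy (alpha / 2) f (epsn n))%:E @[n --> \oo] --> Q ->
  (form_quotient alpha f t)%:E @[t --> 0^'+] --> Q.
Proof.
move=> h; have h' := cvg_heat_energy a0 a1 mf f2 h.
apply: cvg_trans h'; apply: near_eq_cvg; near=> t.
by rewrite form_quotientE//; near: t; exact: nbhs_right_gt.
Unshelve. all: by end_near. Qed.

End form_link.

(** * Convolutions of powers on the half-line *)

(* Conversion must not unfold Gamma into its analytic continuation. *)
Local Opaque Gamma.

Section convolution.
Context {R : realType}.
Local Notation mu := (@lebesgue_measure R).
Local Open Scope ereal_scope.

Lemma measurable_addp : measurable_fun setT
  (fun p : measurableTypeR R * measurableTypeR R => (p.1 + p.2)%R : measurableTypeR R).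
Proof. exact: measurable_funD. Qed.

Lemma measurable_subp : measurable_fun setT
  (fun p : measurableTypeR R * measurableTypeR R => (p.2 - p.1)%R : measurableTypeR R).
Proof. exact: measurable_funB. Qed.

(** The substitution w = u + v, followed by Tonelli's theorem: the coefficient at w is the
    convolution of k and l. *)
Lemma convolution_swap (k psi l : R -> R) :
  measurable_fun setT k -> measurable_fun setT psi -> measurable_fun setT l ->
  (forall u, 0 <= k u)%R -> (forall u, 0 <= psi u)%R -> (forall u, 0 <= l u)%R ->
  \int[mu]_u \int[mu]_v (k u * (psi (u + v) * l v))%:E =
  \int[mu]_w \int[mu]_u (psi w * (k u * l (w - u)))%:E.
Proof.
move=> mk mpsi ml k0 psi0 l0.
pose G (p : measurableTypeR R * measurableTypeR R) : \bar R :=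
  (k p.1 * (psi p.2 * l (p.2 - p.1)))%:E.
have mG : measurable_fun setT G.
  apply/measurable_EFinP; apply: measurable_funM; first exact: measurableT_comp mk _.
  apply: measurable_funM; first exact: measurableT_comp mpsi _.
  exact: measurableT_comp ml measurable_subp.
have G0 p : 0 <= G p by rewrite lee_fin !mulr_ge0.
transitivity (\int[mu]_u \int[mu]_w G (u, w)).
  apply: eq_integral => u _.
  have := @ge0_integral_affine R 1%R u (fun w => G (u, w)) ltr01.
  rewrite invr1 mul1e => <- //; last by apply: measurableT_comp mG _.
  by apply: eq_integral => v _; rewrite /G /= mul1r addrK (addrC v u).
rewrite (@fubini_tonelli _ _ _ _ _ mu mu G mG G0); apply: eq_integral => w _.
by apply: eq_integral => u _; rewrite /G /= mulrCA.
Qed.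

End convolution.

Section ramp.
Context {R : realType}.
Local Notation mu := (@lebesgue_measure R).

(** The kernel of fractional integration of order g, up to a constant. *)
Definition pospow (g v : R) : R := above 0 v * v `^ (g - 1).

Lemma pospow_ge0 g v : 0 <= pospow g v.
Proof. by rewrite mulr_ge0 ?above_ge0 ?powR_ge0. Qed.

Lemma measurable_pospow g : measurable_fun setT (pospow g).
Proof. by apply: measurable_funM; [exact: measurable_above|exact: measurable_powR]. Qed.

Lemma gamma_funE g v : gamma_fun g v = pospow g v * expR (- v).
Proof. by rewrite /gamma_fun mulrA. Qed.

Lemma pospow_scale g w v : 0 < w -> pospow g (w * v) = w `^ (g - 1) * pospow g v.
Proof.
move=> w0; rewrite /pospow /above pmulr_rgt0//; case: ltP => [v0|_]; last by rewrite !mul0r mulr0.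
by rewrite !mul1r powRM ?ltW.
Qed.

Lemma GammaEe g : 0 < g -> (Gamma g)%:E = (\int[mu]_u (gamma_fun g u)%:E)%E.
Proof. by move=> g0; rewrite (GammaE g0); apply: RintE; exact: integ_gamma_fun. Qed.

Lemma ge0_int_scale w (f : R -> R) : 0 < w -> measurable_fun setT f ->
  (forall u, 0 <= f u) ->
  (\int[mu]_u (f u)%:E = w%:E * \int[mu]_u (f (w * u))%:E)%E.
Proof.
move=> w0 mf f0.
have mf' : measurable_fun setT (EFin \o f) by exact/measurable_EFinP.
have f0' x : (0 <= (EFin \o f) x)%E by rewrite lee_fin.
have h := @ge0_integral_affine R w 0 (EFin \o f) w0 mf' f0'.
transitivity (w%:E * ((w^-1)%:E * \int[mu]_u (f u)%:E))%E.
  by rewrite muleA -EFinM divff ?gt_eqF// mul1e.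
by rewrite -h; congr (_ * _)%E; apply: eq_integral => u _; rewrite /= addr0.
Qed.

(** Euler's argument: by the substitution w = u + v the product Gamma p * Gamma q equals
    Gamma (p + q) times this integral, so the integral is finite. *)
Lemma beta_fin p q : 0 < p -> 0 < q -> integ mu (fun u => pospow p u * pospow q (1 - u)).
Proof.
move=> p0 q0.
have m1 (w : R) : measurable_fun setT (fun u => pospow p u * pospow q (w - u)).
  apply: measurable_funM; first exact: measurable_pospow.
  by apply: measurableT_comp; [exact: measurable_pospow|exact: measurable_funB].
have m0 (w u : R) : 0 <= pospow p u * pospow q (w - u) by rewrite mulr_ge0 ?pospow_ge0.
apply: ge0_integ; [exact: m1|by move=> u; exact: m0|].
set b := (X in (X < _)%E).
have b0 : (0 <= b)%E by apply: integral_ge0 => u _; rewrite lee_fin.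
have mE : measurable_fun setT (fun w : R => above 0 w * expR (- w)).
  apply: measurable_funM; first exact: measurable_above.
  by apply: measurableT_comp => //; exact: measurable_funN.
have E0 (w : R) : 0 <= above 0 w * expR (- w) by rewrite mulr_ge0 ?above_ge0 ?expR_ge0.
have := convolution_swap (measurable_pospow p) mE (measurable_pospow q) (pospow_ge0 p) E0 (pospow_ge0 q).
set lhs := (X in X = _ -> _); set rhs := (X in _ = X -> _) => lr.
have lfin : (lhs < +oo)%E.
  apply: (@le_lt_trans _ _ (\int[mu]_u (Gamma q * gamma_fun p u)%:E)%E).
    have mPsi : measurable_fun setT (fun z : measurableTypeR R * measurableTypeR R =>
      above 0 (z.1 + z.2) * expR (- (z.1 + z.2)) * pospow q z.2).
      apply: measurable_funM; first exact: (measurableT_comp mE measurable_addp).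
      by apply: measurableT_comp; [exact: measurable_pospow|exact: measurable_snd].
    pose Fz (z : measurableTypeR R * measurableTypeR R) : \bar R :=
      (pospow p z.1 * (above 0 (z.1 + z.2) * expR (- (z.1 + z.2)) * pospow q z.2))%:E.
    have mFz : measurable_fun setT Fz.
      apply/measurable_EFinP; apply: measurable_funM; last exact: mPsi.
      by apply: measurableT_comp; [exact: measurable_pospow|exact: measurable_fst].
    have Fz0 z : (0 <= Fz z)%E.
      by rewrite lee_fin; apply: mulr_ge0; [exact: pospow_ge0|apply: mulr_ge0; [exact: E0|exact: pospow_ge0]].
    apply: ge0_le_int.
    - by move=> u; apply: integral_ge0 => v _; exact: (Fz0 (u, v)).
    - exact: (@measurable_fun_fubini_tonelli_F _ _ _ _ _ mu Fz mFz Fz0).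
    - by apply/measurable_EFinP; apply: measurable_funM; [exact: measurable_cst|exact: measurable_gamma_fun].
    move=> u; have [u0|u0] := leP u 0.
      rewrite integral0_eq; last by move=> v _; rewrite /pospow /above ltNge u0 !mul0r.
      by rewrite lee_fin; apply: mulr_ge0; [exact: ltW (Gamma_gt0 q0)|exact: gamma_fun_ge0].
    rewrite mulrC EFinM (GammaEe q0).
    have <- := ge0_intZl mu (measurable_gamma_fun q) (gamma_fun_ge0 q) (gamma_fun_ge0 p u).
    apply: ge0_le_int.
    - by move=> v; exact: (Fz0 (u, v)).
    - apply/measurable_EFinP; apply: measurable_funM; first exact: measurable_cst.
      exact: (measurable_section1 (u : measurableTypeR R) mPsi).
    - by apply/measurable_EFinP; apply: measurable_funM; [exact: measurable_cst|exact: measurable_gamma_fun].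
    move=> v; rewrite lee_fin !gamma_funE.
    have -> : pospow p u * expR (- u) * (pospow q v * expR (- v)) = pospow p u * (1 * expR (- (u + v)) * pospow q v).
      by rewrite opprD expRD; ring.
    apply: ler_wpM2l; first exact: pospow_ge0.
    apply: ler_wpM2r; first exact: pospow_ge0.
    by apply: ler_wpM2r; [exact: expR_ge0|exact: above_le1].
  have gi := integZ (Gamma q) (integ_gamma_fun p0).
  by rewrite -(RintE gi) ltry.
have rE : (rhs = (Gamma (p + q))%:E * b)%E.
  have pq0 : 0 < p + q by rewrite addr_gt0.
  rewrite (GammaEe pq0).
  rewrite -(@ge0_integralZr _ _ _ mu _ measurableT (EFin \o gamma_fun (p + q))); last 3 first.
  - by apply/measurable_EFinP; exact: measurable_gamma_fun.
  - by move=> w _; rewrite lee_fin gamma_fun_ge0.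
  - exact: b0.
  apply: eq_integral => w _; rewrite /comp.
  have [w0|w0] := leP w 0.
    rewrite /gamma_fun /above ltNge w0 !mul0r mul0e; apply: integral0_eq => u _.
    by rewrite !mul0r.
  have wi0 : 0 < w^-1 by rewrite invr_gt0.
  rewrite (ge0_intZl mu (m1 w) (m0 w) (E0 w)).
  rewrite (ge0_int_scale w0 (m1 w) (m0 w)).
  have -> : (\int[mu]_u (pospow p (w * u) * pospow q (w - w * u))%:E =
      \int[mu]_u ((w `^ (p - 1) * w `^ (q - 1)) * (pospow p u * pospow q (1 - u)))%:E)%E.
    apply: eq_integral => u _; congr EFin.
    have -> : w - w * u = w * (1 - u) by ring.
    by rewrite (pospow_scale p u w0) (pospow_scale q (1 - u) w0); ring.
  have ww0 : 0 <= w `^ (p - 1) * w `^ (q - 1) by rewrite mulr_ge0 ?powR_ge0.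
  rewrite (ge0_intZl mu (m1 1) (m0 1) ww0).
  rewrite -/b !muleA -!EFinM; congr (_%:E * _)%E.
  have -> : above 0 w = 1 by rewrite /above w0.
  have -> : gamma_fun (p + q) w = w `^ (p + q - 1) * expR (- w).
    by rewrite /gamma_fun /above w0 mul1r.
  have -> : w `^ (p + q - 1) = w * (w `^ (p - 1) * w `^ (q - 1)).
    rewrite -{2}(powRr1 (ltW w0)) -(powRDp _ _ w0) -(powRDp _ _ w0).
    by congr (_ `^ _); ring.
  ring.
have G0 := Gamma_gt0 (addr_gt0 p0 q0).
have {}lfin : ((Gamma (p + q))%:E * b < +oo)%E by rewrite -rE -lr; exact: lfin.
rewrite ltey; apply/eqP => by_; move: lfin; rewrite by_ gt0_muley.
  by rewrite ltxx.
by rewrite lte_fin.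
Qed.

End ramp.

(** * Fractional differentiation of a power, with truncation *)

Section defect_function.
Context {R : realType}.
Local Notation mu := (@lebesgue_measure R).
Variables (a g : R).
Hypotheses (a0 : 0 < a) (a1 : a < 1) (ag : a < g).

Let g0 : 0 < g. Proof. exact: lt_trans a0 ag. Qed.
Let ga0 : 0 < g - a. Proof. by rewrite subr_gt0. Qed.

(** The drop of the power w^(g-1) under a jump of size u back from w = 1. It is defined for
    all u, with value 1 once the jump leaves the half-line. *)
Definition ramp_defect (u : R) : R := 1 - pospow g (1 - u).

Lemma ramp_defect_ge1 u : 1 <= u -> ramp_defect u = 1.
Proof.
by move=> u1; rewrite /ramp_defect /pospow /above ltNge subr_le0 u1 mul0r subr0.
Qed.

Lemma measurable_ramp_defect : measurable_fun setT ramp_defect.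
Proof.
apply: measurable_funB => //.
by apply: measurableT_comp; [exact: measurable_pospow|exact: measurable_funB].
Qed.

Let gm : R := Num.min g 1.
Let ng : R := (Num.truncn g).+1%:R.

Let gm0 : 0 < gm. Proof. by rewrite lt_min g0 ltr01. Qed.

Lemma bernoulli_le (n : nat) (u : R) : 0 <= u <= 1 -> 1 - (1 - u) ^+ n <= n%:R * u.
Proof.
move=> /andP[u0 u1]; elim: n => [|n ih]; first by rewrite expr0 subrr mul0r.
have p0 : 0 <= (1 - u) ^+ n by rewrite exprn_ge0// subr_ge0.
have p1 : (1 - u) ^+ n <= 1 by rewrite exprn_ile1 ?subr_ge0// gerBl.
rewrite exprS -natr1 mulrDl mul1r; nra.
Qed.

(** The drop is of order u at 0, which makes the Lévy weight integrable there. For g < 1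
    it has the integrable singularity (1 - u)^(g-1) at 1. *)
Let ramp_defect_bnd u : 0 < u -> u < 1 -> `|ramp_defect u| <= ng * u * pospow gm (1 - u).
Proof.
move=> u0 u1; have v0 : 0 < 1 - u by rewrite subr_gt0.
have n1 : 1 <= ng by rewrite ler1n.
rewrite /ramp_defect /pospow /above v0 !mul1r /gm; case: (leP g 1) => gle.
- have p1 : 1 <= (1 - u) `^ (g - 1) by apply: powR_ge1; rewrite ?v0 ?gerBl ?(ltW u0) ?subr_le0.
  rewrite ler0_norm ?subr_le0// opprB.
  apply: le_trans (_ : u * (1 - u) `^ (g - 1) <= _); last first.
    by rewrite ler_wpM2r ?powR_ge0// ler_peMl// ltW.
  have : (1 - u) `^ g <= 1 by apply: powR_le1; rewrite ?v0 ?gerBl ?(ltW u0) ?(ltW g0).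
  rewrite -(mulr_powRB1 (ltW v0) g0); lra.
- rewrite subrr powRr0 mulr1.
  have p1 : (1 - u) `^ (g - 1) <= 1.
    by apply: powR_le1; rewrite ?v0 ?gerBl ?(ltW u0)// subr_ge0 ltW.
  rewrite ger0_norm ?subr_ge0//.
  have u01 : 0 <= u <= 1 by rewrite !ltW.
  apply: le_trans (bernoulli_le (Num.truncn g).+1 u01).
  rewrite lerD2l lerN2 -powR_mulrn ?(ltW v0)//.
  apply: ger_powR; first by rewrite v0 gerBl ltW.
  by apply: le_trans (ltW (truncnS_gt g)); rewrite gerBl.
Qed.

(** The weight of [beta_fin] dominates for u < 1, and the jumps that leave the half-line
    have finite Lévy mass. *)
Let domg u : R := ng * levy_cst a * (pospow (1 - a) u * pospow gm (1 - u)) + wlevy a 2^-1 u.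

Let integ_domg : integ mu domg.
Proof.
apply: integD; last by apply: integ_wlevy => //; rewrite invr_gt0.
by apply: integZ; apply: beta_fin => //; rewrite subr_gt0.
Qed.

Let wphi_bnd e u : 0 <= e -> `|wlevy a e u * ramp_defect u| <= domg u.
Proof.
move=> e0; rewrite normrM (ger0_norm (wlevy_ge0 a0 a1 e u)).
apply: le_trans (_ : wlevy a 0 u * `|ramp_defect u| <= _).
  by apply: ler_wpM2r => //; exact: wlevy_le.
have kp := ltW (levy_cst_gt0 a0 a1).
have d0 : 0 <= ng * levy_cst a * (pospow (1 - a) u * pospow gm (1 - u)).
  by apply: mulr_ge0; [exact: mulr_ge0|apply: mulr_ge0; exact: pospow_ge0].
have [u0|u0] := leP u 0.
  by rewrite wlevy0// mul0r addr_ge0// wlevy_ge0.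
have [u1|u1] := leP 1 u.
  rewrite ramp_defect_ge1// normr1 mulr1 -[leLHS]add0r; apply: lerD => //.
  rewrite /wlevy /above u0 (_ : 2^-1 < u)//.
  by apply: lt_le_trans u1; rewrite invf_lt1// ltr1n.
rewrite -[leLHS]addr0; apply: lerD; last exact: wlevy_ge0.
apply: le_trans (ler_wpM2l (wlevy_ge0 a0 a1 0 u) (ramp_defect_bnd u0 u1)) _.
rewrite /wlevy [pospow (1 - a) u]/pospow /above u0 !mul1r.
have -> : u `^ (1 - a - 1) = u * u `^ (- a - 1).
  by rewrite -{2}(powRr1 (ltW u0)) -powRDp//; congr (_ `^ _); ring.
by rewrite le_eqVlt; apply/orP; left; apply/eqP; ring.
Qed.

Lemma integ_wphi e : 0 <= e -> integ mu (fun u => wlevy a e u * ramp_defect u).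
Proof.
move=> e0; apply: (@integ_le _ _ _ mu _ domg).
- by apply: measurable_funM; [exact: measurable_wlevy|exact: measurable_ramp_defect].
- exact: integ_domg.
- by move=> u; exact: wphi_bnd.
Qed.

(** The Marchaud derivative of order a of the power w^(g-1) at w = 1, with the jumps
    below e removed. *)
Definition beta_defect (e : R) : R := \int[mu]_u (wlevy a e u * ramp_defect u).

Definition beta_defect_bound : R := \int[mu]_u domg u.

Lemma beta_defect_bnd e : 0 <= e -> `|beta_defect e| <= beta_defect_bound.
Proof.
move=> e0; apply: Rint_norm_le; [exact: integ_wphi|exact: integ_domg|].
by move=> u; exact: wphi_bnd.
Qed.

Lemma cvg_beta_defect w : 0 < w -> beta_defect (epsn n / w) @[n --> \oo] --> beta_defect 0.
Proof.
move=> w0.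
have ew n : 0 <= @epsn R n / w by rewrite divr_ge0 ?(ltW w0)// ltW// epsn_gt0.
apply: (@Rint_dct _ _ _ mu (fun n u => wlevy a (epsn n / w) u * ramp_defect u) _ domg).
- by move=> n; exact: integ_measurable (integ_wphi (ew n)).
- exact: integ_measurable (integ_wphi (lexx 0)).
- exact: integ_domg.
- move=> u; apply: cvgMl; apply: cvgMl.
  have := @cvg_above_epsn R (w * u).
  have -> : above 0 (w * u) = above 0 u by rewrite /above pmulr_rgt0.
  by under eq_cvg do rewrite /above -ltr_pdivrMl// mulrC.
- by move=> n u; exact: wphi_bnd.
Qed.

Lemma wlevy_scale e w u : 0 < w -> 0 <= e -> wlevy a e (w * u) = w `^ (- a - 1) * wlevy a (e / w) u.
Proof.
move=> w0 e0; rewrite /wlevy.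
have -> : above e (w * u) = above (e / w) u by rewrite /above ltr_pdivrMr// mulrC.
rewrite /above; case: ltP => [ewu|]; last by rewrite !mul0r mulr0.
have u0 : 0 < u by apply: le_lt_trans ewu; rewrite divr_ge0// ltW.
by rewrite powRM ?(ltW w0) ?(ltW u0)//; ring.
Qed.

(** The Lévy measure is homogeneous of degree -a. *)
Lemma Nlevy_scale e w : 0 < w -> 0 < e -> Nlevy a e = w `^ (- a) * Nlevy a (e / w).
Proof.
move=> w0 e0; have ew : 0 < e / w by rewrite divr_gt0.
have h := @Rint_affine R w 0 _ w0 (integ_wlevy a0 a1 e0).
have iw := integ_wlevy a0 a1 ew.
have : \int[mu]_u wlevy a e (w * u + 0) = w `^ (- a - 1) * Nlevy a (e / w).
  rewrite -(RintegralZl _ measurableT iw); apply: eq_Rint => u.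
  by rewrite addr0 (wlevy_scale u w0 (ltW e0)).
rewrite h => /(congr1 (fun z => w * z)); rewrite mulrA divff ?gt_eqF// mul1r -/(Nlevy a e) => ->.
rewrite mulrA; congr (_ * _).
by rewrite -{1}(powRr1 (ltW w0)) -(powRDp _ _ w0); congr (_ `^ _); ring.
Qed.

(** By homogeneity of the Lévy weight and of the power, the substitution u = w u' reduces
    the convolution at w to the one at 1 with the cut e/w. *)
Lemma wlevy_pospow_integral e w : 0 < e -> 0 < w ->
  (\int[mu]_u (wlevy a e u * pospow g (w - u))%:E =
   (Nlevy a e * w `^ (g - 1) - w `^ (g - a - 1) * beta_defect (e / w))%:E)%E.
Proof.
move=> e0 w0; have ew : 0 < e / w by rewrite divr_gt0.
have iw := integ_wlevy a0 a1 ew; have ip := integ_wphi (ltW ew).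
have m1 : measurable_fun setT (fun u => wlevy a e u * pospow g (w - u)).
  apply: measurable_funM; first exact: measurable_wlevy.
  by apply: measurableT_comp; [exact: measurable_pospow|exact: measurable_funB].
have m1_0 u : 0 <= wlevy a e u * pospow g (w - u) by rewrite mulr_ge0 ?pospow_ge0// wlevy_ge0.
rewrite (ge0_int_scale w0 m1 m1_0).
have -> : (\int[mu]_u (wlevy a e (w * u) * pospow g (w - w * u))%:E =
  \int[mu]_u ((w `^ (- a - 1) * w `^ (g - 1)) * (wlevy a (e / w) u - wlevy a (e / w) u * ramp_defect u))%:E)%E.
  apply: eq_integral => u _; congr EFin.
  have -> : w - w * u = w * (1 - u) by ring.
  by rewrite (pospow_scale g (1 - u) w0) (wlevy_scale u w0 (ltW e0)) /ramp_defect; ring.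
have id := integB iw ip.
rewrite -(RintE (integZ (w `^ (- a - 1) * w `^ (g - 1)) id)).
rewrite (RintegralZl _ measurableT id) (RintegralB measurableT iw ip).
rewrite -/(Nlevy a (e / w)) -/(beta_defect (e / w)) -EFinM; congr EFin.
rewrite (Nlevy_scale w0 e0).
have -> : w `^ (- a) = w * w `^ (- a - 1).
  by rewrite -{2}(powRr1 (ltW w0)) -(powRDp _ _ w0); congr (_ `^ _); ring.
have -> : w `^ (g - a - 1) = w * (w `^ (- a - 1) * w `^ (g - 1)).
  rewrite -{2}(powRr1 (ltW w0)) -(powRDp _ _ w0) -(powRDp _ _ w0).
  by congr (_ `^ _); ring.
ring.
Qed.

Lemma measurable_beta_defect_div e : measurable_fun setT (fun w : measurableTypeR R => beta_defect (e / w)).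
Proof.
apply: (@measurable_Rint1 _ _ _ _ _ mu (fun p : measurableTypeR R * measurableTypeR R =>
  wlevy a (e / p.1) p.2 * ramp_defect p.2)).
have mew : measurable_fun setT (fun p : measurableTypeR R * measurableTypeR R => e / p.1).
  apply: measurable_funM; first exact: measurable_cst.
  exact: (measurableT_comp (@measurable_invr R) measurable_fst).
apply: measurable_funM; last exact: (measurableT_comp measurable_ramp_defect measurable_snd).
apply: measurable_funM.
  have -> : (fun p : measurableTypeR R * measurableTypeR R => above (e / p.1) p.2) =
    (fun p => above 0 (p.2 - e / p.1)).
    by apply/funext => p; rewrite /above subr_gt0.
  apply: (measurableT_comp (@measurable_above R 0)).
  by apply: measurable_funB; [exact: measurable_snd|exact: mew].
apply: measurable_funM; first exact: measurable_cst.
exact: (measurableT_comp (measurable_powR _) measurable_snd).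
Qed.

(** With s = u + v the inner weight is a convolution of the Lévy weight and a power, given
    by [wlevy_pw_integral]. The case where psi is a heat kernel is the ground state
    computation; psi = 1 determines [beta_defect] at 0. *)
Lemma weighted_defect (psi : R -> R) (M e : R) : measurable_fun setT psi ->
  (forall w, 0 <= psi w) -> (forall w, 0 < w -> psi w <= M) -> 0 < e ->
  [/\ integ mu (fun w => gamma_fun g w * psi w),
      integ mu (fun w => gamma_fun (g - a) w * beta_defect (e / w) * psi w) &
  (\int[mu]_u \int[mu]_v (wlevy a e u * (psi (u + v) * expR (- (u + v)) * pospow g v))%:E =
   (Nlevy a e * \int[mu]_w (gamma_fun g w * psi w) -
    \int[mu]_w (gamma_fun (g - a) w * beta_defect (e / w) * psi w))%:E)%E].
Proof.
move=> mpsi psi0 psiM e0.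
have i1 r : 0 < r -> integ mu (fun w => gamma_fun r w * psi w).
  move=> r0; apply: (integ_le _ (integZ M (integ_gamma_fun r0))).
    by apply: measurable_funM; [exact: measurable_gamma_fun|exact: mpsi].
  move=> w; rewrite normrM (ger0_norm (gamma_fun_ge0 r w)) (ger0_norm (psi0 w)) mulrC.
  have [w0|w0] := leP w 0; first by rewrite /gamma_fun /above ltNge w0 !mul0r !mulr0.
  by apply: ler_wpM2r; [exact: gamma_fun_ge0|exact: psiM].
have mD := measurable_beta_defect_div e.
have ii1 := i1 g g0.
have ii2 : integ mu (fun w => gamma_fun (g - a) w * beta_defect (e / w) * psi w).
  apply: (integ_le _ (integZ beta_defect_bound (i1 _ ga0))).
    apply: measurable_funM; last exact: mpsi.
    by apply: measurable_funM; [exact: measurable_gamma_fun|exact: mD].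
  move=> w; rewrite normrM (ger0_norm (psi0 w)) mulrA; apply: ler_wpM2r; first exact: psi0.
  rewrite normrM (ger0_norm (gamma_fun_ge0 _ w)) mulrC.
  have [w0|w0] := leP w 0; first by rewrite /gamma_fun /above ltNge w0 !mul0r !mulr0.
  by apply: ler_wpM2r; [exact: gamma_fun_ge0|apply: beta_defect_bnd; rewrite divr_ge0 ?(ltW e0) ?(ltW w0)].
split => //.
have mpsi' : measurable_fun setT (fun w => psi w * expR (- w)).
  apply: measurable_funM; first exact: mpsi.
  by apply: measurableT_comp => //; exact: measurable_funN.
have psi'0 w : 0 <= psi w * expR (- w) by apply: mulr_ge0; [exact: psi0|exact: expR_ge0].
rewrite (convolution_swap (measurable_wlevy a e) mpsi' (measurable_pospow g)
  (wlevy_ge0 a0 a1 e) psi'0 (pospow_ge0 g)).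
rewrite -(RintegralZl _ measurableT ii1) -(RintegralB measurableT (integZ _ ii1) ii2).
rewrite (RintE (integB (integZ _ ii1) ii2)); apply: eq_integral => w _.
have [w0|w0] := leP w 0.
  rewrite integral0_eq; first by rewrite /gamma_fun /above ltNge w0 !mul0r !mulr0 subr0.
  move=> u _; have [ue|ue] := leP u e; first by rewrite (wlevy0 a ue) mul0r mulr0.
  rewrite /pospow /above ltNge subr_le0 (le_trans w0 (ltW (lt_trans e0 ue))).
  by rewrite mul0r !mulr0.
have m1 : measurable_fun setT (fun u => wlevy a e u * pospow g (w - u)).
  apply: measurable_funM; first exact: measurable_wlevy.
  by apply: measurableT_comp; [exact: measurable_pospow|exact: measurable_funB].
have m1_0 u : 0 <= wlevy a e u * pospow g (w - u) by rewrite mulr_ge0 ?pospow_ge0// wlevy_ge0.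
rewrite (ge0_intZl mu m1 m1_0 (psi'0 w)) (wlevy_pospow_integral e0 w0) -EFinM; congr EFin.
by rewrite /gamma_fun /above w0 !mul1r; ring.
Qed.

(** Instead of integrating explicitly, apply [weighted_defect] to psi = 1: it says that
    the integral of w^(g-a-1) e^(-w) D(e/w) is Gamma(g) S(1), and S(1) -> 1 for e -> 0. *)
Lemma beta_defect0E : beta_defect 0 * Gamma (g - a) = Gamma g.
Proof.
have m1 : measurable_fun setT (fun _ : R => 1 : R) by exact: measurable_cst.
have key n : \int[mu]_w (gamma_fun (g - a) w * beta_defect (epsn n / w) * 1) =
    Gamma g * Slevy a (epsn n) 1.
  have e0 := @epsn_gt0 R n.
  have [i1 i2] := weighted_defect m1 (fun _ => ler01) (fun _ _ => lexx 1) e0.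
  under [in RHS]eq_Rint do rewrite mulr1.
  rewrite -GammaE// => h.
  have : (\int[mu]_u \int[mu]_v (wlevy a (epsn n) u * (1 * expR (- (u + v)) * pospow g v))%:E =
    (Gamma g * Llevy a (epsn n) 1)%:E)%E.
    have il := integ_wlevy_cexp a0 a1 e0 ler01.
    rewrite /Llevy -(RintegralZl _ measurableT il) (RintE (integZ (Gamma g) il)).
    apply: eq_integral => u _.
    transitivity (\int[mu]_v ((wlevy a (epsn n) u * cexp 1 u) * gamma_fun g v)%:E)%E.
      apply: eq_integral => v _; congr EFin; rewrite gamma_funE opprD expRD /cexp mulr1.
      have [ue|ue] := leP u (epsn n); first by rewrite (wlevy0 a ue) !mul0r.
      by rewrite gtr0_norm ?(lt_trans e0)//; ring.
    rewrite (ge0_intZl mu (measurable_gamma_fun g) (gamma_fun_ge0 g) (wcexp_ge0 a0 a1 _ _ _)).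
    by rewrite -(GammaEe g0) -EFinM mulrC.
  rewrite h => -[h']; rewrite (SlevyE a0 a1 e0 ler01).
  by rewrite mulrBr -h'; ring.
have c1 : Gamma g * Slevy a (epsn n) 1 @[n --> \oo] --> Gamma g.
  have := cvg_Slevy a0 a1 ltr01; rewrite powR1 => h.
  by rewrite -[X in _ --> X]mulr1; exact: cvgMr.
have c2 : \int[mu]_w (gamma_fun (g - a) w * beta_defect (epsn n / w) * 1) @[n --> \oo] -->
    \int[mu]_w (beta_defect 0 * gamma_fun (g - a) w).
  apply: (@Rint_dct _ _ _ mu (fun n w => gamma_fun (g - a) w * beta_defect (epsn n / w) * 1) _
    (fun w => beta_defect_bound * gamma_fun (g - a) w)).
  - move=> n; have [_ i2 _] := weighted_defect m1 (fun _ => ler01) (fun _ _ => lexx 1) (@epsn_gt0 R n).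
    exact: integ_measurable i2.
  - by apply: measurable_funM; [exact: measurable_cst|exact: measurable_gamma_fun].
  - by apply: integZ; exact: integ_gamma_fun.
  - move=> w; have [w0|w0] := leP w 0.
      rewrite /gamma_fun /above ltNge w0; apply: cvg_near_cst; apply: nearW => n.
      by rewrite !mul0r mulr0.
    rewrite [X in _ --> X]mulrC -[X in _ --> X]mulr1; apply: cvgMl; apply: cvgMr.
    exact: cvg_beta_defect.
  - move=> n w; rewrite mulr1 normrM (ger0_norm (gamma_fun_ge0 _ w)) mulrC.
    have [w0|w0] := leP w 0; first by rewrite /gamma_fun /above ltNge w0 !mul0r !mulr0.
    apply: ler_wpM2r; first exact: gamma_fun_ge0.
    by apply: beta_defect_bnd; rewrite divr_ge0 ?(ltW w0)// ltW// epsn_gt0.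
rewrite (GammaE ga0) -(RintegralZl _ measurableT (integ_gamma_fun ga0)).
have c2' : \int[mu]_w (gamma_fun (g - a) w * beta_defect (epsn n / w) * 1) @[n --> \oo] --> Gamma g.
  by apply: cvg_trans c1; apply: near_eq_cvg; apply: nearW => n; rewrite key.
by apply: (cvg_unique _ c2 c2'); exact: norm_hausdorff.
Qed.

Lemma beta_defect0_gt0 : 0 < beta_defect 0.
Proof.
have := Gamma_gt0 g0; rewrite -beta_defect0E pmulr_lgt0//; exact: Gamma_gt0.
Qed.

(** For g >= 1 the integrand is nonnegative. For g < 1 it is negative before the jump
    leaves the half-line, so removing small jumps only increases the integral, whose value
    without a cut is positive. *)
Lemma beta_defect_ge0 e : 0 <= e -> 0 <= beta_defect e.
Proof.
move=> e0; have [g1|g1] := leP 1 g.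
  apply: Rintegral_ge0 => u _.
  have [u0|u0] := leP u 0; first by rewrite (wlevy0 a (le_trans u0 e0)) mul0r.
  apply: mulr_ge0; first exact: wlevy_ge0.
  have [u1|u1] := leP 1 u; first by rewrite ramp_defect_ge1// ler01.
  rewrite /ramp_defect subr_ge0 /pospow /above subr_gt0 u1 mul1r.
  by apply: powR_le1; rewrite ?subr_gt0 ?u1 ?gerBl ?(ltW u0) ?subr_ge0.
have [e1|e1] := leP 1 e.
  apply: Rintegral_ge0 => u _.
  have [ue|ue] := leP u e; first by rewrite (wlevy0 a ue) mul0r.
  by rewrite ramp_defect_ge1 ?mulr1 ?wlevy_ge0// (le_trans e1)// ltW.
apply: le_trans (ltW beta_defect0_gt0) _.
apply: Rint_le; [exact: integ_wphi|exact: integ_wphi|].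
move=> u; have [u0|u0] := leP u 0; first by rewrite (wlevy0 a u0) (wlevy0 a (le_trans u0 e0)).
have [u1|u1] := leP u e; last first.
  by rewrite /wlevy /above u0 u1.
rewrite (wlevy0 a u1) mul0r.
apply: mulr_ge0_le0; first exact: wlevy_ge0.
have v0 : 0 < 1 - u by rewrite subr_gt0; exact: le_lt_trans e1.
rewrite /ramp_defect subr_le0 /pospow /above v0 mul1r.
by apply: powR_ge1; rewrite ?v0 ?gerBl ?(ltW u0) ?subr_le0 ?(ltW g1).
Qed.

End defect_function.

(** * Heat kernel bounds and the semigroup property *)

Section heat_bounds.
Context {R : realType} {d : nat}.
Local Notation mu := (leb R d).
Implicit Types (x y z : Rvec R d) (u v : R).

(** Away from the origin e^(-q/(4u)) beats every power of 1/u as u -> 0. The bound B u is what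
    makes the Lévy density finite. *)
Lemma heat_bnd x : 0 < dotv x x -> exists B, forall u, 0 < u -> heat u x <= B /\ heat u x <= B * u.
Proof.
move=> q0; set q := dotv x x in q0 *.
(* with y = q / (4 u) one has 1 / (4 pi u) = c y, so that
   heat u x <= (1 + c)^d (1 + y)^d e^(-y), and u = q / (4 y) *)
pose c := (pi * q)^-1.
have c0 : 0 < c by rewrite invr_gt0 mulr_gt0// pi_gt0.
pose C := (1 + c) ^+ d * (d.+1`!%:R * expR 1).
have C0 : 0 <= C.
  by rewrite mulr_ge0 ?exprn_ge0 ?addr_ge0 ?(ltW c0)// mulr_ge0// expR_ge0.
have key u : 0 < u -> (1 + q / (4 * u)) * heat u x <= C.
  move=> u0; set y := q / (4 * u).
  have y0 : 0 < y by rewrite divr_gt0// mulr_gt0.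
  have s1 : Num.sqrt (4 * pi * u) ^- d <= (1 + c) ^+ d * (1 + y) ^+ d.
    rewrite -exprVn -exprMn; apply: lerXn2r.
    - by rewrite nnegrE invr_ge0 sqrtr_ge0.
    - by rewrite nnegrE mulr_ge0// addr_ge0// ltW.
    have p0 : 0 < 4 * pi * u by rewrite !mulr_gt0// pi_gt0.
    have -> : (Num.sqrt (4 * pi * u))^-1 = Num.sqrt (c * y).
      rewrite -(sqrtrV (ltW p0)); congr Num.sqrt; rewrite /c /y.
      have aux (P : R) : 0 < P -> (4 * P * u)^-1 = (P * q)^-1 * (q / (4 * u)).
        by move=> P0; field; rewrite !gt_eqF.
      exact: aux (pi_gt0 R).
    have cy0 : 0 <= c * y by rewrite mulr_ge0// ltW.
    have s0 := sqrtr_ge0 (c * y).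
    have := sqr_sqrtr cy0; set s := Num.sqrt _ in s0 *.
    have : 0 <= (s - 1) ^+ 2 by exact: sqr_ge0.
    nra.
  have e1 : (1 + y) ^+ d.+1 * expR (- y) <= d.+1`!%:R * expR 1.
    have y1 : 0 <= 1 + y by rewrite addr_ge0// ltW.
    have := expR_bound d.+1 y1; rewrite expRD => h.
    apply: le_trans (ler_wpM2r (expR_ge0 _) h) _.
    by rewrite -!mulrA -expRD subrr expR0 mulr1.
  have -> : heat u x = Num.sqrt (4 * pi * u) ^- d * expR (- y) by [].
  rewrite mulrCA.
  apply: le_trans (ler_wpM2r _ s1) _.
    by rewrite mulr_ge0 ?expR_ge0// addr_ge0// ltW.
  rewrite /C -mulrA ler_wpM2l ?exprn_ge0 ?addr_ge0 ?(ltW c0)//.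
  by apply: le_trans e1; rewrite exprS -mulrA mulrCA.
exists (C + C * (4 / q)) => u u0.
have k := key u u0; have h0 := heat_ge0 u x.
have y0 : 0 < q / (4 * u) by rewrite divr_gt0// mulr_gt0.
have k2 : 0 <= C * (4 / q) by rewrite mulr_ge0// divr_ge0// ltW.
split; first by nra.
have h1 : heat u x * (q / (4 * u)) <= C by nra.
have h2 : heat u x <= C * (4 / q) * u.
  have -> : C * (4 / q) * u = C / (q / (4 * u)) by field; rewrite !gt_eqF.
  by rewrite ler_pdivlMr.
by apply: (le_trans h2); have := mulr_ge0 C0 (ltW u0); nra.
Qed.

(** The transform of heat u against the Gaussian heat v, evaluated by [cosft_gauss_weight]. *)
Lemma heat_semigroup u v x : 0 < u -> 0 < v ->
  (\int[mu]_y (heat u (vsub x y) * heat v y)%:E = (heat (u + v) x)%:E)%E.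
Proof.
move=> u0 v0.
pose m z := expR (- u * dotv z z).
have mi : integ mu m by exact: integ_gaussd.
have hu : heat u = cosft m by apply/funext => z; rewrite cosft_gauss.
have s0 : 0 < (4 * v)^-1 by rewrite invr_gt0 mulr_gt0.
have hv y : heat v y = Num.sqrt (4 * pi * v) ^- d * expR (- (4 * v)^-1 * dotv y y).
  by rewrite /heat mulNr [(4 * v)^-1 * _]mulrC.
have mv := integ_gaussd d s0.
have ii : integ mu (fun y => cosft m (vsub x y) * expR (- (4 * v)^-1 * dotv y y)).
  apply: (integM_bounded mv _ (fun y => cosft_bnd mi _)).
  by apply: measurableT_comp; [exact: measurable_cosft|exact: measurable_vsubT].
have E y : heat u (vsub x y) * heat v y = Num.sqrt (4 * pi * v) ^- d *
  (cosft m (vsub x y) * expR (- (4 * v)^-1 * dotv y y)) by rewrite hu hv mulrCA.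
under eq_integral do rewrite E.
rewrite -(RintE (integZ _ ii)) (RintegralZl _ measurableT ii); congr EFin.
under eq_Rint do rewrite mulrC.
rewrite (cosft_gauss_weight x mi s0) -cosft_gauss ?addr_gt0// /cosft.
rewrite mulrA.
have -> : Num.sqrt (4 * pi * v) ^- d * ((2 * pi) ^- d * Num.sqrt (pi / (4 * v)^-1) ^+ d) = (2 * pi) ^- d.
  rewrite invrK mulrCA (_ : pi * (4 * v) = 4 * pi * v); last by ring.
  by rewrite mulVf ?mulr1// expf_neq0// sqrtr_eq0 -ltNge !mulr_gt0// pi_gt0.
congr (_ * _); apply: eq_Rint => z; rewrite -mulrA; congr (_ * _).
rewrite /m -expRD; congr expR.
by field; rewrite gt_eqF.
Qed.

End heat_bounds.

Section origin.
Context {R : realType} {d : nat}.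
Local Notation mu := (leb R d).
Hypothesis d0 : (0 < d)%N.
Implicit Types (x y z : Rvec R d).

(** The mixtures below diverge at the origin, where the Bessel quotients of the theorem are
    meaningless; the origin is a null set because d > 0. *)
Definition nz x : bool := 0 < dotv x x.

Definition vzero : Rvec R d := [tuple 0 | i < d].

Lemma nzN x : ~~ nz x -> x = vzero.
Proof.
rewrite /nz -leNgt => x0; apply: eq_from_tnth => i; rewrite tnth_mktuple.
apply/eqP; rewrite -sqrf_eq0 eq_le sqr_ge0 andbT expr2; apply: le_trans x0.
rewrite /dotv (bigD1 i)//= lerDl; apply: sumr_ge0 => j _; rewrite -expr2; exact: sqr_ge0.
Qed.

Lemma measurable_vzero : measurable [set vzero].
Proof.
have -> : [set vzero] = [set x : Rvec R d | dotv x x = 0].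
  apply/seteqP; split => x /=.
    move=> ->; rewrite /dotv big1// => i _.
    by rewrite /Defs.coord tnth_mktuple mul0r.
  by move=> h; apply: nzN; rewrite /nz h ltxx.
rewrite -[X in measurable X]setTI.
have := @measurable_dotvT R d _ (Rvec R d) id id (@measurable_id _ _ _) (@measurable_id _ _ _).
by move=> /(_ measurableT [set 0] (measurable_set1 _)); apply.
Qed.

Lemma leb_vzero : mu [set vzero] = 0%E.
Proof.
have -> : [set vzero] = [set x : Rvec R d | forall i, [set (0:R)] (tnth x i)].
  apply/seteqP; split => x /=.
    by move=> -> i; rewrite tnth_mktuple.
  by move=> h; apply: eq_from_tnth => i; rewrite tnth_mktuple.
rewrite (leb_box (A := fun _ => [set (0:R)])) => [|i]; last exact: measurable_set1.
by rewrite (bigD1 (Ordinal d0))//= lebesgue_measure_set1 mul0e.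
Qed.

Lemma ae_nz (P : Rvec R d -> Prop) : (forall x, nz x -> P x) -> {ae mu, forall x, P x}.
Proof.
move=> h; exists [set vzero]; split; [exact: measurable_vzero|exact: leb_vzero|].
move=> x /= nP; apply: nzN; apply/negP => /h; exact: nP.
Qed.

Lemma measurable_nz : measurable_fun setT (fun x : Rvec R d => nz x).
Proof.
apply: measurable_fun_ltr; first exact: measurable_cst.
exact: (@measurable_dotvT R d _ (Rvec R d) id id (@measurable_id _ _ _) (@measurable_id _ _ _)).
Qed.

Lemma measurable_off_zero (F G : Rvec R d -> \bar R) : measurable_fun setT G ->
  (forall x, nz x -> F x = G x) -> measurable_fun setT F.
Proof.
move=> mG FG.
have mb := measurable_nz.
have -> : F = (fun x => if nz x then G x else F vzero).
  by apply/funext => x; case: ifPn => [/FG//|/nzN ->].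
by apply: measurable_fun_if => //; exact: measurable_funTS.
Qed.

(** Only one side has to be known measurable: functions that agree outside one point are
    measurable together. *)
Lemma eq_off_zero (F G : Rvec R d -> \bar R) : measurable_fun setT G ->
  (forall x, nz x -> F x = G x) -> (\int[mu]_x F x = \int[mu]_x G x)%E.
Proof.
move=> mG FG; apply: ae_eq_integral => //; first exact: measurable_off_zero FG.
by apply: ae_nz => x /FG.
Qed.

End origin.

(** * Gamma mixtures of heat kernels *)

Section tonelli3.
Context d1 d2 d3 (X : measurableType d1) (Y : measurableType d2) (Z : measurableType d3)
  (R : realType).
Variables (m1 : {sigma_finite_measure set X -> \bar R})
  (m2 : {sigma_finite_measure set Y -> \bar R})
  (m3 : {sigma_finite_measure set Z -> \bar R}).

Lemma tonelli3_F (F : (X * Y) * Z -> \bar R) : measurable_fun setT F ->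
  (forall q, 0 <= F q)%E ->
  measurable_fun setT (fun x => \int[m2]_y \int[m3]_z F ((x, y), z))%E.
Proof.
move=> mF F0; pose G (p : X * Y) := (\int[m3]_z F (p, z))%E.
have mG : measurable_fun setT G := @measurable_fun_fubini_tonelli_F _ _ _ _ _ m3 F mF F0.
have G0 p : (0 <= G p)%E by apply: integral_ge0.
exact: (@measurable_fun_fubini_tonelli_F _ _ _ _ _ m2 G mG G0).
Qed.

Lemma tonelli3_rotate (F : (X * Y) * Z -> \bar R) : measurable_fun setT F ->
  (forall q, 0 <= F q)%E ->
  (\int[m1]_x \int[m2]_y \int[m3]_z F ((x, y), z) =
   \int[m2]_y \int[m3]_z \int[m1]_x F ((x, y), z))%E.
Proof.
move=> mF F0; pose G (p : X * Y) := (\int[m3]_z F (p, z))%E.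
have mG : measurable_fun setT G := @measurable_fun_fubini_tonelli_F _ _ _ _ _ m3 F mF F0.
have G0 p : (0 <= G p)%E by apply: integral_ge0.
rewrite (@fubini_tonelli _ _ _ _ _ m1 m2 G mG G0); apply: eq_integral => y _.
pose H (p : X * Z) := F ((p.1, y), p.2).
have mH : measurable_fun setT H.
  apply: measurableT_comp mF _; apply: measurable_fun_pair; last exact: measurable_snd.
  by apply: measurable_fun_pair; [exact: measurable_fst|exact: measurable_cst].
exact: (@fubini_tonelli _ _ _ _ _ m1 m3 H mH (fun p => F0 _)).
Qed.

End tonelli3.

Section ground_state.
Context {R : realType} {d : nat}.
Local Notation mu1 := (@lebesgue_measure R).
Local Notation mu := (leb R d).
Hypothesis d0 : (0 < d)%N.
Variables (a g : R).
Hypotheses (a0 : 0 < a) (a1 : a < 1) (ag : a < g).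
Implicit Types (x y z : Rvec R d) (r e : R).

Let g0 : 0 < g. Proof. exact: lt_trans a0 ag. Qed.
Let ga0 : 0 < g - a. Proof. by rewrite subr_gt0. Qed.

Definition heat_at x (w : R) : R := heat `|w| x.

Lemma heat_at_ge0 x w : 0 <= heat_at x w. Proof. exact: heat_ge0. Qed.

Lemma heat_at_bnd x : nz x -> exists B, forall w, 0 < w -> heat_at x w <= B.
Proof.
move=> /heat_bnd[B h]; exists B => w w0; rewrite /heat_at gtr0_norm//.
exact: (h w w0).1.
Qed.

Lemma measurable_heatn2 : measurable_fun setT
  (fun p : Rvec R d * measurableTypeR R => heat_at p.1 p.2).
Proof.
have sw : measurable_fun setT (fun p : Rvec R d * measurableTypeR R => (p.2, p.1)).
  by apply: measurable_fun_pair.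
have := measurableT_comp (measurable_heat2 0) sw.
by apply: eq_measurable_fun => p _ /=; rewrite addr0.
Qed.

Lemma measurable_heat_at x : measurable_fun setT (heat_at x).
Proof. exact: (measurable_section1 x measurable_heatn2). Qed.

(** A constant multiple of |x|^(r - d/2) K_(d/2 - r)(|x|). *)
Definition gheat r x : R := \int[mu1]_w (gamma_fun r w * heat_at x w).

(** The function N H - nu * H for the mixture H at parameter g. *)
Definition gheat_defect e x : R := \int[mu1]_w (gamma_fun (g - a) w * beta_defect a g (e / w) * heat_at x w).

Lemma integ_gheat r x : 0 < r -> nz x -> integ mu1 (fun w => gamma_fun r w * heat_at x w).
Proof.
move=> r0 /heat_at_bnd[B hB].
apply: (integ_le _ (integZ B (integ_gamma_fun r0))).
  by apply: measurable_funM; [exact: measurable_gamma_fun|exact: measurable_heat_at].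
move=> w; rewrite normrM (ger0_norm (gamma_fun_ge0 r w)) (ger0_norm (heat_at_ge0 x w)) mulrC.
have [w0|w0] := leP w 0; first by rewrite /gamma_fun /above ltNge w0 !mul0r !mulr0.
by apply: ler_wpM2r; [exact: gamma_fun_ge0|exact: hB].
Qed.

Lemma gheat_gt0 r x : 0 < r -> nz x -> 0 < gheat r x.
Proof.
move=> r0 xn; apply: (Rint_gt0 (integ_gheat r0 xn)).
  by move=> w; rewrite mulr_ge0 ?gamma_fun_ge0 ?heat_at_ge0.
move=> w /andP[w0 _]; rewrite /gamma_fun /above w0 mul1r /heat_at gtr0_norm// /heat.
by rewrite !mulr_gt0 ?powR_gt0 ?expR_gt0// invr_gt0 exprn_gt0// sqrtr_gt0 !mulr_gt0// pi_gt0.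
Qed.

Lemma measurable_gheat r : measurable_fun setT (gheat r).
Proof.
apply: (@measurable_Rint1 _ _ _ _ _ mu1 (fun p : Rvec R d * measurableTypeR R =>
  gamma_fun r p.2 * heat_at p.1 p.2)).
apply: measurable_funM; last exact: measurable_heatn2.
exact: measurableT_comp (measurable_gamma_fun r) _.
Qed.

Let wd e x : nz x -> 0 < e -> [/\ integ mu1 (fun w => gamma_fun g w * heat_at x w),
      integ mu1 (fun w => gamma_fun (g - a) w * beta_defect a g (e / w) * heat_at x w) &
  (\int[mu1]_u \int[mu1]_v (wlevy a e u * (heat_at x (u + v) * expR (- (u + v)) * pospow g v))%:E =
   (Nlevy a e * gheat g x - gheat_defect e x)%:E)%E].
Proof.
move=> /heat_at_bnd[B hB] e0.
exact: (weighted_defect a0 a1 ag (measurable_heat_at x) (heat_at_ge0 x) hB e0).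
Qed.

(** The bound does not depend on e, since D is bounded. *)
Lemma gheat_defect_bnd e x : nz x -> 0 < e -> 0 <= gheat_defect e x <= beta_defect_bound a g * gheat (g - a) x.
Proof.
move=> xn e0; have [_ i2 _] := wd xn e0; apply/andP; split.
  apply: Rintegral_ge0 => w _; have [w0|w0] := leP w 0.
    by rewrite /gamma_fun /above ltNge w0 !mul0r.
  apply: mulr_ge0; last exact: heat_at_ge0.
  apply: mulr_ge0; first exact: gamma_fun_ge0.
  by apply: beta_defect_ge0 => //; rewrite divr_ge0// ltW.
rewrite /gheat -(RintegralZl _ measurableT (integ_gheat ga0 xn)).
apply: (Rint_le i2); first exact/integZ/integ_gheat.
move=> w; rewrite mulrA; apply: ler_wpM2r; first exact: heat_at_ge0.
rewrite mulrC.
have [w0|w0] := leP w 0; first by rewrite /gamma_fun /above ltNge w0 !mul0r !mulr0.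
apply: ler_wpM2r; first exact: gamma_fun_ge0.
apply: le_trans (ler_norm _) _; apply: beta_defect_bnd => //; rewrite divr_ge0// ltW//.
Qed.

Lemma cvg_gheat_defect x : nz x -> gheat_defect (epsn n) x @[n --> \oo] --> beta_defect a g 0 * gheat (g - a) x.
Proof.
move=> xn; rewrite /gheat -(RintegralZl _ measurableT (integ_gheat ga0 xn)).
apply: (@Rint_dct _ _ _ mu1
  (fun n w => gamma_fun (g - a) w * beta_defect a g (epsn n / w) * heat_at x w) _
  (fun w => beta_defect_bound a g * (gamma_fun (g - a) w * heat_at x w))).
- by move=> n; have [_ i2 _] := wd xn (epsn_gt0 n); exact: integ_measurable i2.
- by have := integ_measurable (integZ (beta_defect a g 0) (integ_gheat ga0 xn)).
- exact/integZ/integ_gheat.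
- move=> w; have [w0|w0] := leP w 0.
    rewrite /gamma_fun /above ltNge w0; apply: cvg_near_cst; apply: nearW => n.
    by rewrite !mul0r mulr0.
  rewrite (_ : beta_defect a g 0 * _ = gamma_fun (g - a) w * beta_defect a g 0 * heat_at x w); last by ring.
  apply: cvgMl; apply: cvgMr.
  exact: cvg_beta_defect.
- move=> n w; rewrite normrM (ger0_norm (heat_at_ge0 x w)) mulrA.
  apply: ler_wpM2r; first exact: heat_at_ge0.
  rewrite normrM (ger0_norm (gamma_fun_ge0 _ w)) mulrC.
  have [w0|w0] := leP w 0; first by rewrite /gamma_fun /above ltNge w0 !mul0r !mulr0.
  apply: ler_wpM2r; first exact: gamma_fun_ge0.
  by apply: beta_defect_bnd => //; rewrite divr_ge0 ?(ltW w0)// ltW// epsn_gt0.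
Qed.

Lemma measurable_gheat_defect e : measurable_fun setT (gheat_defect e).
Proof.
apply: (@measurable_Rint1 _ _ _ _ _ mu1 (fun p : Rvec R d * measurableTypeR R =>
  gamma_fun (g - a) p.2 * beta_defect a g (e / p.2) * heat_at p.1 p.2)).
apply: measurable_funM; last exact: measurable_heatn2.
apply: (measurableT_comp (f := fun w => gamma_fun (g - a) w * beta_defect a g (e / w))); last exact: measurable_snd.
apply: measurable_funM; first exact: measurable_gamma_fun.
exact: measurable_beta_defect_div.
Qed.

(** By Tonelli's theorem and the semigroup property, nu * H is the double mixture of
    heat (u + v) with the Lévy weight in u and the Gamma weight in v; [weighted_defect]
    reduces it to a simple mixture. *)
Lemma nu_trunc_gheat e x : nz x -> 0 < e ->
  (\int[mu]_y (nu_trunc a e (vsub x y) * gheat g y)%:E = (Nlevy a e * gheat g x - gheat_defect e x)%:E)%E.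
Proof.
move=> xn e0; have [_ _ <-] := wd xn e0.
pose F (q : Rvec R d * measurableTypeR R * measurableTypeR R) : \bar R :=
  (vlevy a e q.1.2 * heat_at (vsub x q.1.1) q.1.2 * (gamma_fun g q.2 * heat_at q.1.1 q.2))%:E.
have F0 q : (0 <= F q)%E.
  by rewrite lee_fin; apply: mulr_ge0; apply: mulr_ge0; rewrite ?heat_at_ge0 ?gamma_fun_ge0 ?vlevy_ge0.
have mF : measurable_fun setT F.
  have m11 : measurable_fun setT (fun q : Rvec R d * measurableTypeR R * measurableTypeR R => q.1.1).
    exact: (measurableT_comp measurable_fst measurable_fst).
  have m12 : measurable_fun setT (fun q : Rvec R d * measurableTypeR R * measurableTypeR R => q.1.2).
    exact: (measurableT_comp measurable_snd measurable_fst).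
  have mv : measurable_fun setT (fun q : Rvec R d * measurableTypeR R * measurableTypeR R => vsub x q.1.1).
    by apply: measurable_vsubT; [exact: measurable_cst|exact: m11].
  have mp1 := measurable_fun_pair mv m12.
  have mp2 := measurable_fun_pair m11 (@measurable_snd _ _ (Rvec R d * measurableTypeR R)%type (measurableTypeR R)).
  apply/measurable_EFinP; apply: measurable_funM; apply: measurable_funM.
  - exact: (measurableT_comp (integ_measurable (integ_vlevy a0 a1 e0)) m12).
  - exact: (measurableT_comp measurable_heatn2 mp1).
  - exact: (measurableT_comp (measurable_gamma_fun g) (@measurable_snd _ _ (Rvec R d * measurableTypeR R)%type (measurableTypeR R))).
  - exact: (measurableT_comp measurable_heatn2 mp2).
have mI := @tonelli3_F _ _ _ _ _ _ R mu1 mu1 F mF F0.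
rewrite (eq_off_zero d0 mI); last first.
  move=> y yn.
  have i1 : integ mu1 (fun u => vlevy a e u * heat_at (vsub x y) u).
    have := integ_vheat a0 a1 (vsub x y) e0 (lexx 0).
    by apply: eq_integrable => // u _ /=; rewrite addr0.
  have i2 := integ_gheat g0 yn.
  have p1 u : 0 <= vlevy a e u * heat_at (vsub x y) u by rewrite mulr_ge0 ?heat_at_ge0// vlevy_ge0.
  have p2 v : 0 <= gamma_fun g v * heat_at y v by rewrite mulr_ge0 ?heat_at_ge0// gamma_fun_ge0.
  rewrite /F/=.
  under eq_integral => u _.
    rewrite (ge0_intZl mu1 (integ_measurable i2) p2 (p1 u)) -(RintE i2) -EFinM mulrC.
    over.
  rewrite (ge0_intZl mu1 (integ_measurable i1) p1 (ltW (gheat_gt0 g0 yn))) -(RintE i1).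
  rewrite mulrC; exact: EFinM.
rewrite (@tonelli3_rotate _ _ _ _ _ _ R mu mu1 mu1 F mF F0).
apply: eq_integral => u _; apply: eq_integral => v _; rewrite /F/=.
have [ue|ue] := leP u e.
  rewrite (wlevy0 a ue) mul0r integral0_eq// => y _.
  by rewrite /vlevy (wlevy0 a ue) !mul0r.
have [v0|v0] := leP v 0.
  rewrite /pospow /above ltNge v0 /= mul0r !mulr0 integral0_eq// => y _.
  by rewrite /gamma_fun /above ltNge v0 /= !mul0r !mulr0.
have u0 := lt_trans e0 ue.
rewrite /heat_at (gtr0_norm u0) (gtr0_norm v0) (gtr0_norm (addr_gt0 u0 v0)).
have mh s : 0 < s -> measurable_fun setT (@heat R d s) by move=> s0; have [] := @conv_kernel_heat R d s s0.
have E y : vlevy a e u * heat u (vsub x y) * (gamma_fun g v * heat v y) =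
  (vlevy a e u * gamma_fun g v) * (heat u (vsub x y) * heat v y) by ring.
under eq_integral do rewrite E.
rewrite ge0_intZl.
- rewrite heat_semigroup// -EFinM; congr EFin.
  rewrite /vlevy gamma_funE /cexp (gtr0_norm u0) mulr1 opprD expRD; ring.
- apply: measurable_funM; last exact: mh.
  apply: (measurableT_comp (mh _ u0)); apply: measurable_vsubT; [exact: measurable_cst|exact: measurable_id].
- by move=> y; rewrite mulr_ge0// heat_ge0.
- by rewrite mulr_ge0 ?vlevy_ge0// gamma_fun_ge0.
Qed.

End ground_state.

(** * The ground state identity for an integrable kernel *)

Section ground_state_identity.
Context {R : realType} {d : nat}.
Local Notation mu := (leb R d).
Local Notation mu2 := (leb R d \x leb R d)%E.
Hypothesis d0 : (0 < d)%N.
Implicit Types (x y z : Rvec R d).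
Variables (K H U f : Rvec R d -> R) (M N : R).
Hypotheses (gK : conv_kernel K M) (mH : measurable_fun setT H) (H0 : forall x, 0 < H x)
  (mU : measurable_fun setT U) (U0 : forall x, 0 <= U x <= N * H x)
  (KH : forall x, nz x -> (\int[mu]_y (K (vsub x y) * H y)%:E = (N * H x - U x)%:E)%E)
  (mf : measurable_fun setT f) (f2 : integ mu (fun x => f x ^+ 2)).

Let mK : measurable_fun setT K. Proof. by case: gK. Qed.
Let K0 x : 0 <= K x. Proof. by case: gK. Qed.
Let mf1 : measurable_fun setT (fun p : Rvec R d * Rvec R d => f p.1).
Proof. exact: measurableT_comp mf measurable_fst. Qed.
Let mf2 : measurable_fun setT (fun p : Rvec R d * Rvec R d => f p.2).
Proof. exact: measurableT_comp mf measurable_snd. Qed.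
Let mH1 : measurable_fun setT (fun p : Rvec R d * Rvec R d => H p.1).
Proof. exact: measurableT_comp mH measurable_fst. Qed.
Let mH2 : measurable_fun setT (fun p : Rvec R d * Rvec R d => H p.2).
Proof. exact: measurableT_comp mH measurable_snd. Qed.
Let mKd := measurable_Kdiff mK.

Let F : R := \int[mu]_x (f x ^+ 2).

(** The integrand of the jump form of f/H under the measure H(x) H(y) K(x-y) dx dy. *)
Definition jump_term (p : Rvec R d * Rvec R d) : R :=
  (f p.1 / H p.1 - f p.2 / H p.2) ^+ 2 * H p.2 * H p.1 * K (vsub p.1 p.2).

Let W x : R := f x ^+ 2 * (U x / H x).

Let mW : measurable_fun setT W.
Proof.
apply: measurable_funM; first exact: measurable_funX.
by apply: measurable_funM => //; exact: (measurableT_comp (@measurable_invr R) mH).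
Qed.

Let iW : integ mu W.
Proof.
apply: (integ_le mW (integZ N f2)) => x; have /andP[u0 uN] := U0 x.
rewrite ger0_norm; last by rewrite mulr_ge0 ?sqr_ge0// divr_ge0// ltW.
rewrite /W mulrC; apply: ler_wpM2r; first exact: sqr_ge0.
by rewrite ler_pdivrMr.
Qed.

Let S1 (p : Rvec R d * Rvec R d) := (f p.1 ^+ 2 / H p.1) * (K (vsub p.1 p.2) * H p.2).
Let S2 (p : Rvec R d * Rvec R d) := (f p.2 ^+ 2 / H p.2) * (K (vsub p.1 p.2) * H p.1).

Let mS1 : measurable_fun setT S1.
Proof.
apply: measurable_funM; last exact: measurable_funM.
apply: measurable_funM; first exact: measurable_funX.
exact: (measurableT_comp (@measurable_invr R) mH1).
Qed.

Let mS2 : measurable_fun setT S2.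
Proof.
apply: measurable_funM; last exact: measurable_funM.
apply: measurable_funM; first exact: measurable_funX.
exact: (measurableT_comp (@measurable_invr R) mH2).
Qed.

Let S1_ge0 p : 0 <= S1 p.
Proof. by rewrite mulr_ge0 ?divr_ge0 ?sqr_ge0 ?mulr_ge0 ?(ltW (H0 _)). Qed.

Let S2_ge0 p : 0 <= S2 p.
Proof. by rewrite mulr_ge0 ?divr_ge0 ?sqr_ge0 ?mulr_ge0 ?(ltW (H0 _)). Qed.

(** Integrating in y first produces f^2/H (N H - U). *)
Let int_S1 : (\int[mu2]_p (S1 p)%:E = (N * F - \int[mu]_x W x)%:E)%E.
Proof.
have mE : measurable_fun setT (fun p => (S1 p)%:E) by exact/measurable_EFinP.
have E0 p : (0 <= (S1 p)%:E)%E by rewrite lee_fin.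
rewrite (fubini_tonelli1 _ mE E0).
have mG : measurable_fun setT (fun x => (N * f x ^+ 2 - W x)%:E).
  apply/measurable_EFinP; apply: measurable_funB; last exact: mW.
  by apply: measurable_funM; [exact: measurable_cst|exact: measurable_funX].
rewrite (eq_off_zero d0 mG).
  rewrite /F -(RintegralZl _ measurableT f2) -(RintegralB measurableT (integZ N f2) iW).
  by rewrite (RintE (integB (integZ N f2) iW)).
move=> x xn; rewrite /fubini_F.
have mk : measurable_fun setT (fun y => K (vsub x y) * H y).
  by apply: measurable_funM mH; exact: (measurable_section1 x mKd).
have k0 y : 0 <= K (vsub x y) * H y by rewrite mulr_ge0// ltW.
have c0 : 0 <= f x ^+ 2 / H x by rewrite divr_ge0 ?sqr_ge0// ltW.
rewrite (ge0_intZl mu mk k0 c0) KH// -EFinM; congr EFin; rewrite /W.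
by field; rewrite gt_eqF.
Qed.

Let int_S2 : (\int[mu2]_p (S2 p)%:E = \int[mu2]_p (S1 p)%:E)%E.
Proof.
have m1 : measurable_fun setT (fun p => (S1 p)%:E) by exact/measurable_EFinP.
have m2 : measurable_fun setT (fun p => (S2 p)%:E) by exact/measurable_EFinP.
have E1 p : (0 <= (S1 p)%:E)%E by rewrite lee_fin.
have E2 p : (0 <= (S2 p)%:E)%E by rewrite lee_fin.
rewrite (fubini_tonelli2 _ m2 E2) (fubini_tonelli1 _ m1 E1).
apply: eq_integral => x _; apply: eq_integral => y _ /=.
by rewrite /S1 /S2/=; case: gK => _ _ -> _.
Qed.

Let iS1 : integ mu2 S1.
Proof. by apply: (ge0_integ mS1 S1_ge0); rewrite int_S1 ltry. Qed.

Let iS2 : integ mu2 S2.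
Proof. by apply: (ge0_integ mS2 S2_ge0); rewrite int_S2 int_S1 ltry. Qed.

Let jumpE p : jump_term p = S1 p + S2 p - 2 * (K (vsub p.1 p.2) * (f p.1 * f p.2)).
Proof. by rewrite /jump_term /S1 /S2; field; rewrite !gt_eqF. Qed.

Let ikf := integ_qform gK mf f2.

(** Expanding the square gives the two diagonal terms S1 and S2, which have the same integral
    by symmetry of the kernel, and the cross term -2 K f f. All three are integrable
    because K has finite mass. *)
Lemma ground_state_identity :
  [/\ integ mu (fun x => f x ^+ 2 * (U x / H x)), integ mu2 jump_term &
    N * F - qform K f = \int[mu]_x (f x ^+ 2 * (U x / H x)) + 2^-1 * \int[mu2]_p jump_term p].
Proof.
have iT := integB (integD iS1 iS2) (integZ 2 ikf).
split; first exact: iW.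
  by rewrite (_ : jump_term = fun p => S1 p + S2 p - 2 * (K (vsub p.1 p.2) * (f p.1 * f p.2)));
    [exact: iT|apply/funext => p; exact: jumpE].
rewrite (eq_Rint mu2 jumpE) (RintegralB measurableT (integD iS1 iS2) (integZ 2 ikf)).
rewrite (RintegralD measurableT iS1 iS2) (RintegralZl _ measurableT ikf).
have e1 : \int[mu2]_p S1 p = N * F - \int[mu]_x W x.
  by rewrite /Rintegral int_S1.
have e2 : \int[mu2]_p S2 p = N * F - \int[mu]_x W x.
  by rewrite /Rintegral int_S2 int_S1.
by rewrite e1 e2 /W /qform; field.
Qed.

End ground_state_identity.

Section monotone_limits.
Context dsp (T : measurableType dsp) (R : realType).
Variable mu : {measure set T -> \bar R}.

(** If the limit has a finite integral, it dominates the sequence up to the factor C. If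
    its integral is infinite, Fatou's lemma forces the integrals to tend to +oo. *)
Lemma self_dominated_cvg (g_ : nat -> T -> R) (g : T -> R) (C : R) :
  (forall n, measurable_fun setT (g_ n)) -> measurable_fun setT g ->
  (forall n x, 0 <= g_ n x <= C * g x) -> 0 <= C -> (forall x, 0 <= g x) ->
  (forall x, g_ n x @[n --> \oo] --> g x) ->
  (\int[mu]_x (g_ n x)%:E @[n --> \oo] --> \int[mu]_x (g x)%:E)%E.
Proof.
move=> mg_ mg gC C0 g0 cg.
have mE : measurable_fun setT (fun x => (g x)%:E) by exact/measurable_EFinP.
have mE_ n : measurable_fun setT (fun x => (g_ n x)%:E) by exact/measurable_EFinP.
have cE x : setT x -> (g_ n x)%:E @[n --> \oo] --> (g x)%:E.
  by move=> _; apply: cvg_EFin; [exact: nearW|exact: cg].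
have [fin|] := ltP (\int[mu]_x (g x)%:E)%E +oo%E.
  have gi := ge0_integ mg g0 fin.
  have dom : {ae mu, forall x n, setT x -> (`|(g_ n x)%:E| <= (C * g x)%:E)%E}.
    by apply: aeW => x n _; have /andP[h0 h] := gC n x; rewrite /= lee_fin ger0_norm.
  have [_ _ h] := @dominated_convergence _ _ _ mu setT measurableT
    (fun n x => (g_ n x)%:E) (fun x => (g x)%:E) (fun x => (C * g x)%:E)
    mE_ mE (aeW _ cE) (integZ C gi) dom.
  exact: h.
rewrite leye_eq => /eqP goo; rewrite goo.
have E0 n x : setT x -> (0 <= (g_ n x)%:E)%E.
  by move=> _; have /andP[h0 _] := gC n x; rewrite lee_fin.
have := @fatou _ _ _ mu setT measurableT (fun n x => (g_ n x)%:E) mE_ E0.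
have -> : (\int[mu]_x limn_einf (fun n => (g_ n x)%:E) = +oo)%E.
  rewrite -goo; apply: eq_integral => x _.
  by have [-> _] := cvg_limn_einf_sup (cE x I).
rewrite leye_eq => /eqP lo; set u := fun n => (\int[mu]_x (g_ n x)%:E)%E.
have h : (-%E \o u) @ \oo --> -oo%E.
  apply: limn_esup_le_cvg => [|n]; last exact: leNye.
  by rewrite limn_esupN lo.
apply/cvgeyPge => A; have /cvgeNyPle/(_ (- A)) := h.
by apply: filterS => n /=; rewrite EFinN leeN2.
Qed.

End monotone_limits.

(** * Removing the truncation *)

Section limit_identity.
Context {R : realType} {d : nat}.
Local Notation mu1 := (@lebesgue_measure R).
Local Notation mu := (leb R d).
Local Notation mu2 := (leb R d \x leb R d)%E.
Hypothesis d0 : (0 < d)%N.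
Variables (a g : R).
Hypotheses (a0 : 0 < a) (a1 : a < 1) (ag : a < g).
Implicit Types (x y z : Rvec R d).

Let g0 : 0 < g. Proof. exact: lt_trans a0 ag. Qed.
Let ga0 : 0 < g - a. Proof. by rewrite subr_gt0. Qed.

(** The mixture at g, made positive at the origin so that quotients by it are unconditional. *)
Definition ground x : R := if nz x then gheat g x else 1.
Definition ground_defect e x : R := if nz x then gheat_defect a g e x else 0.
Definition ground_shift x : R := if nz x then gheat (g - a) x else 0.

Lemma ground_gt0 x : 0 < ground x.
Proof. by rewrite /ground; case: ifPn => // xn; exact: gheat_gt0. Qed.

Lemma ground_shift_ge0 x : 0 <= ground_shift x.
Proof. by rewrite /ground_shift; case: ifPn => // xn; apply: ltW; exact: gheat_gt0. Qed.

Lemma measurable_ground : measurable_fun setT ground.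
Proof.
apply: measurable_fun_if; [exact: measurableT|exact: measurable_nz| |exact: measurable_cst].
exact: measurable_funTS (measurable_gheat g).
Qed.

Lemma measurable_ground_defect e : measurable_fun setT (ground_defect e).
Proof.
apply: measurable_fun_if; [exact: measurableT|exact: measurable_nz| |exact: measurable_cst].
exact: measurable_funTS (measurable_gheat_defect a g e).
Qed.

Lemma measurable_ground_shift : measurable_fun setT ground_shift.
Proof.
apply: measurable_fun_if; [exact: measurableT|exact: measurable_nz| |exact: measurable_cst].
exact: measurable_funTS (measurable_gheat (g - a)).
Qed.

Lemma nu_trunc_ge0 e x : 0 <= nu_trunc a e x.
Proof. by apply: Rintegral_ge0 => u _; rewrite mulr_ge0 ?vlevy_ge0 ?heat_ge0. Qed.

Lemma nu_trunc_ground e x : nz x -> 0 < e ->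
  (\int[mu]_y (nu_trunc a e (vsub x y) * ground y)%:E = (Nlevy a e * ground x - ground_defect e x)%:E)%E.
Proof.
move=> xn e0; rewrite /ground /ground_defect xn -nu_trunc_gheat//.
apply: (eq_off_zero d0); last by move=> y ->.
apply/measurable_EFinP; apply: measurable_funM; last exact: measurable_gheat.
exact: (measurable_section1 x (measurable_Kdiff (measurable_nu_trunc a e))).
Qed.

(** The upper bound says that nu * H is nonnegative. *)
Lemma ground_defect_bnd e x : 0 < e -> 0 <= ground_defect e x <= Nlevy a e * ground x.
Proof.
move=> e0; case: (boolP (nz x)) => xn; last first.
  by rewrite /ground_defect /ground (negbTE xn) lexx mulr1 Nlevy_ge0.
have /andP[u0 _] := gheat_defect_bnd a0 a1 ag xn e0.
rewrite {1}/ground_defect xn u0 /= -subr_ge0 -lee_fin -nu_trunc_ground//.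
by apply: integral_ge0 => y _; rewrite lee_fin mulr_ge0 ?nu_trunc_ge0// ltW// ground_gt0.
Qed.

(** The Lévy density of the relativistic stable process. *)
Definition nu_full x : R := \int[mu1]_u (vlevy a 0 u * heat_at x u).

Lemma integ_nu_full x : nz x -> integ mu1 (fun u => vlevy a 0 u * heat_at x u).
Proof.
move=> /heat_bnd[B hB].
have a10 : 0 < 1 - a by rewrite subr_gt0.
apply: (integ_le _ (integZ (levy_cst a * B) (integ_gamma_fun a10))).
  apply: measurable_funM; last exact: measurable_heat_at.
  by apply: measurable_funM; [exact: measurable_wlevy|exact: measurable_cexp].
move=> u; rewrite (ger0_norm (mulr_ge0 (vlevy_ge0 a0 a1 _ _) (heat_at_ge0 _ _))).
have [u0|u0] := leP u 0.
  by rewrite /vlevy (wlevy0 a u0) /gamma_fun /above ltNge u0 !mul0r mulr0.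
rewrite /heat_at /vlevy /wlevy /gamma_fun /above u0 !mul1r /cexp (gtr0_norm u0) mulr1.
have -> : levy_cst a * B * (u `^ (1 - a - 1) * expR (- u)) =
    levy_cst a * u `^ (- a - 1) * expR (- u) * (B * u).
  rewrite (_ : 1 - a - 1 = - a - 1 + 1); last by ring.
  by rewrite (powRDp _ _ u0) powRr1 ?(ltW u0)//; ring.
apply: ler_wpM2l; last exact: (hB u u0).2.
by rewrite mulr_ge0 ?expR_ge0// mulr_ge0 ?powR_ge0// ltW// levy_cst_gt0.
Qed.

Lemma measurable_nu_full : measurable_fun setT nu_full.
Proof.
apply: (@measurable_Rint1 _ _ _ _ _ mu1 (fun p : Rvec R d * measurableTypeR R =>
  vlevy a 0 p.2 * heat_at p.1 p.2)).
apply: measurable_funM; last exact: measurable_heatn2.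
apply: (measurableT_comp (f := vlevy a 0)); last exact: measurable_snd.
by apply: measurable_funM; [exact: measurable_wlevy|exact: measurable_cexp].
Qed.

Lemma vlevy_le0 e u : 0 < e -> vlevy a e u <= vlevy a 0 u.
Proof.
by move=> e0; apply: ler_wpM2r; [exact: cexp_ge0|apply: wlevy_le => //; exact: ltW].
Qed.

Lemma nu_trunc_le_nu_full e x : nz x -> 0 < e -> nu_trunc a e x <= nu_full x.
Proof.
move=> xn e0; apply: Rint_le; last first.
- by move=> u; apply: ler_wpM2r; [exact: heat_ge0|exact: vlevy_le0].
- exact: integ_nu_full.
have := integ_vheat a0 a1 x e0 (lexx 0).
by apply: eq_integrable => // u _ /=; rewrite addr0.
Qed.

Lemma cvg_nu_trunc x : nz x -> nu_trunc a (epsn n) x @[n --> \oo] --> nu_full x.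
Proof.
move=> xn; apply: (@Rint_dct _ _ _ mu1 (fun n u => vlevy a (epsn n) u * heat_at x u) _
  (fun u => vlevy a 0 u * heat_at x u)).
- move=> n; apply: measurable_funM; last exact: measurable_heat_at.
  by apply: measurable_funM; [exact: measurable_wlevy|exact: measurable_cexp].
- exact: integ_measurable (integ_nu_full xn).
- exact: integ_nu_full.
- by move=> u; apply: cvgMl; apply: cvgMl; exact: cvg_wlevy.
- move=> n u; rewrite (ger0_norm (mulr_ge0 (vlevy_ge0 a0 a1 _ _) (heat_at_ge0 _ _))).
  by apply: ler_wpM2r; [exact: heat_at_ge0|apply: vlevy_le0; exact: epsn_gt0].
Qed.

Section form.
Variable f : Rvec R d -> R.
Hypotheses (mf : measurable_fun setT f) (f2 : integ mu (fun x => f x ^+ 2)).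

Lemma measurable_jump_term K : measurable_fun setT K ->
  measurable_fun setT (jump_term K ground f).
Proof.
move=> mK.
have mfst : measurable_fun setT (fun p : Rvec R d * Rvec R d => p.1) by exact: measurable_fst.
have msnd : measurable_fun setT (fun p : Rvec R d * Rvec R d => p.2) by exact: measurable_snd.
have mq : measurable_fun setT (fun x => f x / ground x).
  apply: measurable_funM mf _; exact: (measurableT_comp (@measurable_invr R) measurable_ground).
apply: measurable_funM; last exact: measurable_Kdiff.
apply: measurable_funM; last exact: (measurableT_comp measurable_ground mfst).
apply: measurable_funM; last exact: (measurableT_comp measurable_ground msnd).
apply: measurable_funX; apply: measurable_funB.
  exact: (measurableT_comp mq mfst).
exact: (measurableT_comp mq msnd).
Qed.

Lemma vsub_nzN x y : ~~ nz (vsub x y) -> x = y.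
Proof.
move=> /nzN xy; apply: eq_from_tnth => i; apply/eqP; rewrite -subr_eq0; apply/eqP.
by have := congr1 (fun t => tnth t i) xy; rewrite !tnth_mktuple.
Qed.

Lemma jump_term_diag K p : ~~ nz (vsub p.1 p.2) -> jump_term K ground f p = 0.
Proof. by move=> /vsub_nzN e; rewrite /jump_term e subrr expr0n !mul0r. Qed.

Lemma jump_coef_ge0 (p : Rvec R d * Rvec R d) :
  0 <= (f p.1 / ground p.1 - f p.2 / ground p.2) ^+ 2 * ground p.2 * ground p.1.
Proof.
apply: mulr_ge0 (ltW (ground_gt0 _)); apply: mulr_ge0 (ltW (ground_gt0 _)).
exact: sqr_ge0.
Qed.

Lemma nu_full_ge0 x : 0 <= nu_full x.
Proof. by apply: Rintegral_ge0 => u _; rewrite mulr_ge0 ?vlevy_ge0 ?heat_at_ge0. Qed.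

Lemma cvg_jump : (\int[mu2]_p (jump_term (nu_trunc a (epsn n)) ground f p)%:E @[n --> \oo] -->
  \int[mu2]_p (jump_term nu_full ground f p)%:E)%E.
Proof.
apply: (@self_dominated_cvg _ _ _ mu2 (fun n p => jump_term (nu_trunc a (epsn n)) ground f p) _ 1).
- by move=> n; apply: measurable_jump_term; exact: measurable_nu_trunc.
- by apply: measurable_jump_term; exact: measurable_nu_full.
- move=> n p; case: (boolP (nz (vsub p.1 p.2))) => pn; last first.
    by rewrite !jump_term_diag// mulr0 lexx.
  rewrite mul1r; apply/andP; split.
    apply: mulr_ge0; [exact: jump_coef_ge0|exact: nu_trunc_ge0].
  by apply: ler_wpM2l; [exact: jump_coef_ge0|apply: nu_trunc_le_nu_full => //; exact: epsn_gt0].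
- exact: ler01.
- by move=> p; apply: mulr_ge0; [exact: jump_coef_ge0|exact: nu_full_ge0].
- move=> p; case: (boolP (nz (vsub p.1 p.2))) => pn; last first.
    rewrite jump_term_diag//; apply: cvg_near_cst; apply: nearW => n.
    by rewrite jump_term_diag.
  by apply: cvgMr; exact: cvg_nu_trunc.
Qed.

(** The potential at level e is at most a multiple of its limit because D is bounded and
    D(0) > 0. *)
Lemma cvg_potential : (\int[mu]_x (f x ^+ 2 * (ground_defect (epsn n) x / ground x))%:E @[n --> \oo] -->
  \int[mu]_x (f x ^+ 2 * (beta_defect a g 0 * ground_shift x / ground x))%:E)%E.
Proof.
have D0 := beta_defect0_gt0 a0 a1 ag.
have minv := measurableT_comp (@measurable_invr R) measurable_ground.
have b n x : 0 <= ground_defect (epsn n) x <= beta_defect_bound a g / beta_defect a g 0 * (beta_defect a g 0 * ground_shift x).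
  rewrite mulrA divfK ?gt_eqF// /ground_defect /ground_shift; case: ifPn => xn; last by rewrite mulr0 lexx.
  by apply: gheat_defect_bnd => //; exact: epsn_gt0.
apply: (@self_dominated_cvg _ _ _ mu (fun n x => f x ^+ 2 * (ground_defect (epsn n) x / ground x)) _
  (beta_defect_bound a g / beta_defect a g 0)).
- move=> n; apply: measurable_funM; first exact: measurable_funX.
  by apply: measurable_funM; [exact: measurable_ground_defect|exact: minv].
- apply: measurable_funM; first exact: measurable_funX.
  apply: measurable_funM; last exact: minv.
  by apply: measurable_funM; [exact: measurable_cst|exact: measurable_ground_shift].
- move=> n x; have /andP[b0 b1] := b n x.
  have h0 : 0 <= (ground x)^-1 by rewrite invr_ge0 ltW// ground_gt0.
  apply/andP; split; first by rewrite mulr_ge0 ?sqr_ge0// mulr_ge0.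
  rewrite [leRHS]mulrCA; apply: ler_wpM2l; first exact: sqr_ge0.
  by rewrite [leRHS]mulrA; apply: ler_wpM2r.
- rewrite divr_ge0 ?(ltW D0)//; apply: le_trans (normr_ge0 _) (beta_defect_bnd a0 a1 ag (lexx 0)).
- move=> x; rewrite mulr_ge0 ?sqr_ge0// divr_ge0 ?(ltW (ground_gt0 x))//.
  by rewrite mulr_ge0 ?ground_shift_ge0// ltW.
- move=> x; apply: cvgMr; apply: cvgMl; rewrite /ground_defect /ground_shift; case: ifPn => xn.
    exact: cvg_gheat_defect.
  by rewrite mulr0; exact: cvg_cst.
Qed.

(** The ground state identity in the limit, with the mixtures in place of the Bessel
    functions. *)
Lemma cvg_jump_energy : ((jump_energy a f (epsn n))%:E @[n --> \oo] -->
  \int[mu]_x (f x ^+ 2 * (beta_defect a g 0 * ground_shift x / ground x))%:E +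
  (2^-1)%:E * \int[mu2]_p (jump_term nu_full ground f p)%:E)%E.
Proof.
have E n : (jump_energy a f (epsn n))%:E = (\int[mu]_x (f x ^+ 2 * (ground_defect (epsn n) x / ground x))%:E +
  (2^-1)%:E * \int[mu2]_p (jump_term (nu_trunc a (epsn n)) ground f p)%:E)%E.
  have e0 := @epsn_gt0 R n.
  have [i1 i2 e] := ground_state_identity d0 (conv_kernel_nu_trunc a0 a1 e0) measurable_ground
    ground_gt0 (measurable_ground_defect _) (fun x => ground_defect_bnd x e0) (fun x xn => nu_trunc_ground xn e0) mf f2.
  by rewrite /jump_energy e EFinD EFinM (RintE i1) (RintE i2).
under eq_cvg do rewrite E.
apply: cvgeD; [|exact: cvg_potential|].
- apply: ge0_adde_def; rewrite inE.
    apply: integral_ge0 => x _; rewrite lee_fin mulr_ge0 ?sqr_ge0// divr_ge0 ?(ltW (ground_gt0 x))//.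
    by rewrite mulr_ge0 ?ground_shift_ge0// ltW// beta_defect0_gt0.
  apply: mule_ge0; first by rewrite lee_fin.
  apply: integral_ge0 => p _; rewrite lee_fin.
  by apply: mulr_ge0; [exact: jump_coef_ge0|exact: nu_full_ge0].
- by apply: cvgeZl => //; exact: cvg_jump.
Qed.

End form.
End limit_identity.

(** * Bessel functions *)

Section bessel_identification.
Context {R : realType} {d : nat}.
Local Notation mu1 := (@lebesgue_measure R).
Local Notation mu := (leb R d).
Implicit Types (x y z : Rvec R d) (b r s : R).

Lemma enorm_gt0 x : nz x -> 0 < enorm x.
Proof. by move=> xn; rewrite /enorm sqrtr_gt0. Qed.

Lemma sqrt_powR (c : R) : 0 < c -> Num.sqrt c ^+ d = c `^ (d%:R / 2).
Proof.
move=> c0; rewrite -powR_mulrn ?sqrtr_ge0// -powR12_sqrt ?ltW// -powRrM.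
by congr (_ `^ _); rewrite mulrC.
Qed.

(** The integrals agree once heat w is written as (4 pi w)^(-d/2) e^(-|x|^2/(4w)); integrability
    is needed only to pull out the constant, and holds also for some r <= 0. *)
Lemma BesselK_heat x b r : nz x -> r = d%:R / 2 - b ->
  integ mu1 (fun w => gamma_fun r w * heat_at x w) ->
  BesselK b (enorm x) =
  2^-1 * (enorm x / 2) `^ b * ((4 * pi) `^ (d%:R / 2) * gheat r x).
Proof.
move=> xn rE i1; congr (_ * _).
rewrite /gheat -(RintegralZl _ measurableT i1) -Rintegral_above; apply: eq_Rint => w.
rewrite /gamma_fun; have [w0|w0] := leP w 0.
  by rewrite /above ltNge w0 !mul0r mulr0.
have p0 : 0 < 4 * pi :> R by rewrite mulr_gt0// pi_gt0.
rewrite /above w0 !mul1r /heat_at (gtr0_norm w0) /heat enormK.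
rewrite (sqrt_powR (mulr_gt0 p0 w0)) (powRM _ (ltW p0) (ltW w0)).
rewrite expRD (_ : r - 1 = (- b - 1) + d%:R / 2); last by rewrite rE; ring.
rewrite (powRDp (- b - 1) _ w0).
set A := (4 * pi) `^ _; set B := w `^ (d%:R / 2).
have A0 : A != 0 by rewrite gt_eqF// powR_gt0.
have B0 : B != 0 by rewrite gt_eqF// powR_gt0.
by field; rewrite A0 B0.
Qed.

End bessel_identification.

Section identification.
Context {R : realType} {d : nat}.
Local Notation mu1 := (@lebesgue_measure R).
Local Notation mu := (leb R d).
Local Notation mu2 := (leb R d \x leb R d)%E.
Variables (alpha delta : R).
Hypotheses (d0 : (0 < d)%N) (alpha_gt0 : 0 < alpha) (alpha_lt : alpha < Num.min 2 d%:R)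
  (delta_gt0 : 0 < delta) (delta_lt : delta < d%:R - alpha).
Implicit Types (x y z : Rvec R d).

Local Notation a := (alpha / 2).
Local Notation g := ((d%:R - delta) / 2).

Let a0 : 0 < a. Proof. by rewrite divr_gt0. Qed.
Let a1 : a < 1.
Proof. by move: alpha_lt; rewrite lt_min => /andP[h _]; rewrite ltr_pdivrMr// mul1r. Qed.
Let ag : a < g.
Proof. by rewrite ltr_pM2r// ltrBrDl -ltrBrDr. Qed.
Let g0 : 0 < g. Proof. exact: lt_trans a0 ag. Qed.
Let ga0 : 0 < g - a. Proof. by rewrite subr_gt0. Qed.

Let BK1 x : nz x -> BesselK (delta / 2) (enorm x) =
  2^-1 * (enorm x / 2) `^ (delta / 2) * ((4 * pi) `^ (d%:R / 2) * gheat g x).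
Proof.
move=> xn; apply: BesselK_heat => //; first by field.
exact: integ_gheat.
Qed.

Let BK2 x : nz x -> BesselK ((delta + alpha) / 2) (enorm x) =
  2^-1 * (enorm x / 2) `^ ((delta + alpha) / 2) * ((4 * pi) `^ (d%:R / 2) * gheat (g - a) x).
Proof.
move=> xn; apply: BesselK_heat => //; first by field.
exact: integ_gheat.
Qed.

Let nu_full_fun x u : vlevy a 0 u * heat_at x u = levy_cst a * (gamma_fun (- a) u * heat_at x u).
Proof.
rewrite /vlevy /wlevy /gamma_fun /cexp mulr1; have [u0|u0] := leP u 0.
  by rewrite /above ltNge u0 !mul0r mulr0.
by rewrite (gtr0_norm u0); ring.
Qed.

Let integ_nu x : nz x -> integ mu1 (fun u => gamma_fun (- a) u * heat_at x u).
Proof.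
move=> xn; have := integZ (levy_cst a)^-1 (integ_nu_full a0 a1 xn).
apply: eq_integrable => // u _ /=; congr EFin.
by rewrite nu_full_fun mulKf// gt_eqF// levy_cst_gt0.
Qed.

Let nu_fullE x : nz x -> nu_full a x = levy_cst a * gheat (- a) x.
Proof.
move=> xn; rewrite /nu_full (eq_Rint mu1 (nu_full_fun x)).
by rewrite (RintegralZl _ measurableT (integ_nu xn)).
Qed.

Let BK3 x : nz x -> BesselK ((d%:R + alpha) / 2) (enorm x) =
  2^-1 * (enorm x / 2) `^ ((d%:R + alpha) / 2) * ((4 * pi) `^ (d%:R / 2) * gheat (- a) x).
Proof.
move=> xn; apply: BesselK_heat => //; first by field.
exact: integ_nu.
Qed.

Let half_powR (r s : R) : 0 < r -> (r / 2) `^ s = r `^ s / 2 `^ s.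
Proof.
move=> r0; have h : 0 <= 2^-1 :> R by rewrite invr_ge0.
rewrite (powRM s (ltW r0) h).
by rewrite -powR_inv1// -powRrM mulN1r powRN.
Qed.

Let powR2_neq0 s : 2 `^ s != 0 :> R. Proof. by rewrite gt_eqF// powR_gt0. Qed.

Let chh : R := c_const d alpha delta * 2^-1 / 2 `^ (delta / 2) * (4 * pi) `^ (d%:R / 2).

Let chh_gt0 : 0 < chh.
Proof.
have p0 : 0 < 4 * pi :> R by rewrite mulr_gt0// pi_gt0.
have dd : 0 < d%:R - delta by have := alpha_gt0; have := delta_lt; lra.
rewrite /chh /c_const !mulr_gt0 ?invr_gt0 ?mulr_gt0 ?powR_gt0 ?Gamma_gt0//.
by rewrite divr_gt0.
Qed.

(** The powers of |x| in h_delta and in the Bessel function cancel. The constant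
    then drops out of the identity, in which h_delta is homogeneous of degree 0. *)
Lemma h_funE x : nz x -> h_fun alpha delta x = chh * gheat g x.
Proof.
move=> xn; have r0 := enorm_gt0 xn; rewrite /h_fun BK1// half_powR// powRN.
set A := enorm x `^ _; have A0 : A != 0 by rewrite gt_eqF// powR_gt0.
rewrite /chh; set c := c_const _ _ _; set B := 2 `^ _; set P := (4 * pi) `^ _; set H := gheat _ _.
have B0 : B != 0 by exact: powR2_neq0.
by field; rewrite A0 B0.
Qed.

Lemma V_funE x : nz x -> V_fun alpha delta x = beta_defect a g 0 * gheat (g - a) x / gheat g x.
Proof.
move=> xn; have r0 := enorm_gt0 xn; rewrite /V_fun BK1// BK2// !half_powR// powRN.
have p0 : 0 < (4 * pi) `^ (d%:R / 2) :> R by rewrite powR_gt0// mulr_gt0// pi_gt0.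
rewrite (_ : (d%:R - delta - alpha) / 2 = g - a); last by field.
rewrite -(beta_defect0E a0 a1 ag).
rewrite (_ : (delta + alpha) / 2 = delta / 2 + a); last by field.
rewrite !(powRDp _ _ r0) !powRDp//.
have G0 := gt_eqF (Gamma_gt0 ga0); have H0 := gt_eqF (gheat_gt0 g0 xn).
move: G0 H0; set G := Gamma _; set H := gheat g x; set H2 := gheat (g - a) x; set D := beta_defect _ _ _.
set A := enorm x `^ (delta / 2); set A' := enorm x `^ a.
have A0 : A != 0 by rewrite gt_eqF// powR_gt0.
have A'0 : A' != 0 by rewrite gt_eqF// powR_gt0.
have := powR2_neq0 (delta / 2); have := powR2_neq0 a.
set B := 2 `^ (delta / 2); set B' := 2 `^ a => B'0 B0 G0 H0.
move: p0; set P := (4 * pi) `^ _ => /gt_eqF p0.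
by field; rewrite A0 A'0 B0 B'0 G0 H0 p0.
Qed.

Lemma levy_densityE x : nz x -> levy_density alpha x = nu_full a x.
Proof.
move=> xn; have r0 := enorm_gt0 xn; rewrite /levy_density BK3// half_powR// nu_fullE//.
rewrite (_ : (d%:R + alpha) / 2 = d%:R / 2 + a); last by field.
rewrite (_ : (alpha - d%:R) / 2 + 1 = a + - (d%:R / 2) + 1); last by field.
rewrite !(@powRDp _ 2)// powRr1// powRN.
rewrite powRM ?pi_ge0// (_ : (4 : R) = 2 * 2); last by rewrite -natrM.
rewrite powRM// /levy_cst.
have K0 := levy_cst_gt0 a0 a1; rewrite /levy_cst invr_gt0 in K0.
move/gt_eqF: K0; set G := `|Gamma _|.
set A := enorm x `^ _.
have A0 : A != 0 by rewrite gt_eqF// powR_gt0.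
have P0 : (pi : R) `^ (d%:R / 2) != 0 by rewrite gt_eqF// powR_gt0// pi_gt0.
move: P0; set P := (pi : R) `^ _.
have := powR2_neq0 (d%:R / 2); have := powR2_neq0 a.
set B := 2 `^ (d%:R / 2); set B' := 2 `^ a; set H := gheat _ _ => B'0 B0 P0 G0.
by field; rewrite A0 B0 B'0 P0 G0.
Qed.

Variable f : Rvec R d -> R.
Hypotheses (mf : measurable_fun setT f).

Lemma potentialE :
  (\int[mu]_x (f x ^+ 2 * V_fun alpha delta x)%:E =
   \int[mu]_x (f x ^+ 2 * (beta_defect a g 0 * ground_shift a g x / ground g x))%:E)%E.
Proof.
apply: (eq_off_zero d0); last first.
  by move=> x xn; rewrite V_funE// /ground_shift /ground xn.
apply/measurable_EFinP; apply: measurable_funM; first exact: measurable_funX.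
apply: measurable_funM; last exact: (measurableT_comp (@measurable_invr R) (measurable_ground _)).
by apply: measurable_funM; [exact: measurable_cst|exact: measurable_ground_shift].
Qed.

(** On the diagonal the squared difference vanishes, whatever the value of the Lévy density
    at 0. *)
Lemma jump_integralE :
  (\int[mu]_x \int[mu]_y
     ((f x / h_fun alpha delta x - f y / h_fun alpha delta y) ^+ 2 *
      h_fun alpha delta y * h_fun alpha delta x * levy_density alpha (vsub x y))%:E =
   \int[mu2]_p (jump_term (nu_full a) (ground g) f p)%:E)%E.
Proof.
have mJ := measurable_jump_term g mf (measurable_nu_full a).
have mE : measurable_fun setT (fun p => (jump_term (nu_full a) (ground g) f p)%:E).
  exact/measurable_EFinP.
have E0 p : (0 <= (jump_term (nu_full a) (ground g) f p)%:E)%E.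
  by rewrite lee_fin; apply: mulr_ge0; [exact: (jump_coef_ge0 a0 ag)|exact: (nu_full_ge0 a0 a1)].
rewrite (fubini_tonelli1 _ mE E0).
apply: (eq_off_zero d0); first exact: (measurable_fun_fubini_tonelli_F _ mE E0).
move=> x xn; apply: (eq_off_zero d0).
  by apply/measurable_EFinP; exact: (measurable_section1 x mJ).
move=> y yn; congr EFin; case: (boolP (nz (vsub x y))) => xyn; last first.
  rewrite (jump_term_diag _ _ _ (p := (x, y)) xyn).
  by rewrite (vsub_nzN xyn) subrr expr0n !mul0r.
rewrite /jump_term /= levy_densityE// !h_funE// /ground xn yn; congr (_ * _).
have := gt_eqF chh_gt0; have := gt_eqF (gheat_gt0 g0 xn); have := gt_eqF (gheat_gt0 g0 yn).
set c := chh; set Hx := gheat g x; set Hy := gheat g y => Hy0 Hx0 c0.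
by field; rewrite Hy0 Hx0 c0.
Qed.

End identification.

Theorem corollary1p3 (R : realType) (d : nat) (alpha delta : R)
    (d_gt0 : (0 < d)%N)
    (alpha_gt0 : 0 < alpha) (alpha_lt : alpha < Num.min 2 d%:R)
    (delta_gt0 : 0 < delta) (delta_lt : delta < d%:R - alpha)
    (f : Rvec R d -> R) (f_L2 : f \in Lfun (leb R d) 2%:E) :
  cvg ((form_quotient alpha f t)%:E @[t --> 0^'+]) /\
  energy_form alpha f =
    (\int[leb R d]_x (f x ^+ 2 * V_fun alpha delta x)%:E +
     (2^-1)%:E *
     \int[leb R d]_x \int[leb R d]_y
       ((f x / h_fun alpha delta x - f y / h_fun alpha delta y) ^+ 2 *
        h_fun alpha delta y * h_fun alpha delta x *
        levy_density alpha (vsub x y))%:E)%E.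
Proof.
have mf : measurable_fun setT f.
  by have := sub_Lfun_mfun f_L2; rewrite inE.
have f2 : integ (leb R d) (fun x => f x ^+ 2) by exact: Lfun2_integrable_sqr.
have a0 : 0 < alpha / 2 by rewrite divr_gt0.
have a1 : alpha / 2 < 1.
  by move: alpha_lt; rewrite lt_min => /andP[h _]; rewrite ltr_pdivrMr// mul1r.
have ag : alpha / 2 < (d%:R - delta) / 2 by rewrite ltr_pM2r// ltrBrDl -ltrBrDr.
have h := cvg_form_quotient a0 a1 mf f2 (cvg_jump_energy d_gt0 a0 a1 ag mf f2).
split; first by apply/cvg_ex; eexists; exact: h.
rewrite /energy_form (cvg_lim _ h)//.
by rewrite potentialE// jump_integralE.
Qed.
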